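(* Let $0<|q|<1$ and $a,b\in\mathbb C^\ast$, such that no denominator factors vanish. Let $\omega$ be a fixed primitive third root of unity. Then $${}_8\Psi_8\left(a;b^{1/3},\omega b^{1/3},\omega^2b^{1/3},q^{1/3}ab^{-1/3},\omega q^{1/3}ab^{-1/3},\omega^2q^{1/3}ab^{-1/3};q,q\right)=\sum_{k=-\infty}^\infty\frac{1-aq^{2k}}{1-a}\,\frac{(b,\frac{qa^3}{b};q^3)_k}{(q^2b,\frac{q^3a^3}{b};q^3)_k}\,q^k$$ $$=\frac{(qa,\frac qa;q)_\infty}{(\frac{q^3}{b},q^2b;q^3)_\infty\,\vartheta(\frac{b}{a^2};q)}\Biggl(\frac{(q^2,q^3,\frac{qb^2}{a^3};q^3)_\infty\left(\vartheta(\frac{b^2}{a^3},\frac{qb}{a^3};q^3)+\frac ba\,\vartheta(\frac{b}{a^3},\frac{qa^3}{b^2};q^3)\right)}{(q,q,\frac{q^2b}{a^3},\frac{q^3a^3}{b},\frac{b^2}{a^3};q^3)_\infty}$$ $$\qquad+\frac{\frac{a^2}{b}\,\vartheta(\frac{b}{a^3},\frac{qb^2}{a^3};q^3)-\frac{b}{a^2}\,\vartheta(\frac{qa^3}{b},\frac{a^3}{b^2};q^3)}{(1-\frac{a^3}{b^2})\,(\frac{q^2b}{a^3},\frac{q^3a^3}{b};q^3)_\infty}\;{}_2\phi_1\left(\tfrac{qb^2}{a^3},q^3;\tfrac{q^3b^2}{a^3};q^3,q\right)\Biggr).$$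
   Context: $\mathbb C^\ast=\mathbb C\setminus\{0\}$. For a base $p$ with $0<|p|<1$ (here $p=q$ or $p=q^3$): $(x;p)_\infty=\prod_{n\ge0}(1-xp^n)$, $(x;p)_k=(x;p)_\infty/(xp^k;p)_\infty$ for $k\in\mathbb Z$, $(x_1,\dots,x_m;p)_k=\prod_i(x_i;p)_k$ for $k\in\mathbb Z\cup\{\infty\}$; $\vartheta(z;p)=(z,p/z;p)_\infty$ and $\vartheta(z_1,\dots,z_m;p)=\prod_i\vartheta(z_i;p)$. ${}_2\phi_1(A,B;C;p,z)=\sum_{k\ge0}\frac{(A,B;p)_k}{(p,C;p)_k}z^k$. Very-well-poised bilateral series: $${}_8\Psi_8(a;a_3,\dots,a_8;q,z)=\sum_{k=-\infty}^\infty\frac{1-aq^{2k}}{1-a}\prod_{j=3}^8\frac{(a_j;q)_k}{(qa/a_j;q)_k}\,z^k .$$ Fixed branches of $q^{1/3}$ and $b^{1/3}$ are taken. *)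

(* Defs.v *)
From Stdlib Require Import Reals ZArith List Lra Lia.
From Coquelicot Require Import Coquelicot.
Import ListNotations.

Open Scope C_scope.

Definition CLim_seq (u : nat -> C) : C :=
  (real (Lim_seq (fun n => Re (u n))), real (Lim_seq (fun n => Im (u n)))).

Definition CSeries (f : nat -> C) : C := CLim_seq (fun n => sum_n f n).

Definition ex_CSeries (f : nat -> C) : Prop :=
  @ex_series C_AbsRing C_NormedModule f.

(* The two halves k >= 0 and k <= -1 are summed (and required to converge)
   independently. *)
Definition CSeriesZ (f : Z -> C) : C :=
  CSeries (fun n => f (Z.of_nat n)) + CSeries (fun n => f (- Z.of_nat (S n))%Z).

Definition ex_CSeriesZ (f : Z -> C) : Prop :=
  ex_CSeries (fun n => f (Z.of_nat n)) /\
  ex_CSeries (fun n => f (- Z.of_nat (S n))%Z).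

Definition CpowZ (x : C) (k : Z) : C :=
  match k with
  | Z0 => 1
  | Zpos n => x ^ Pos.to_nat n
  | Zneg n => / x ^ Pos.to_nat n
  end.

Definition primitive_root (n : nat) (w : C) : Prop :=
  w ^ n = 1 /\ forall m : nat, (0 < m < n)%nat -> w ^ m <> 1.

Definition Cprod (l : list C) : C := fold_right Cmult 1 l.

(* (x;p)_n for n : nat *)
Fixpoint qpochN (x p : C) (n : nat) : C :=
  match n with
  | O => 1
  | S m => qpochN x p m * (1 - x * p ^ m)
  end.

(* (x;p)_oo *)
Definition qpoch_inf (x p : C) : C := CLim_seq (qpochN x p).

(* (x;p)_k for k : Z.  Where (x p^k;p)_oo is nonzero this is the quotient
   (x;p)_oo / (x p^k;p)_oo (lemma qpoch_quotient); the finite product is also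
   meaningful when that quotient reads 0 / 0, e.g. x = p^-m and 0 <= k <= m.
   At a pole (k < 0 only) the value is 0 by the convention / 0 = 0; such a
   symbol in a denominator thus contributes 0, in accordance with 1/oo = 0. *)
Definition qpoch (x p : C) (k : Z) : C :=
  match k with
  | Z0 => 1
  | Zpos n => qpochN x p (Pos.to_nat n)
  | Zneg n => / qpochN (x * CpowZ p (Zneg n)) p (Pos.to_nat n)
  end.

Definition qpochs (xs : list C) (p : C) (k : Z) : C :=
  Cprod (map (fun x => qpoch x p k) xs).

Definition qpochs_inf (xs : list C) (p : C) : C :=
  Cprod (map (fun x => qpoch_inf x p) xs).

Definition theta (z p : C) : C := qpochs_inf [z; p / z] p.

Definition thetas (zs : list C) (p : C) : C :=
  Cprod (map (fun z => theta z p) zs).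

Definition phi21_term (A B D p z : C) (k : nat) : C :=
  qpochs [A; B] p (Z.of_nat k) / qpochs [p; D] p (Z.of_nat k) * z ^ k.

Definition phi21 (A B D p z : C) : C := CSeries (phi21_term A B D p z).

Definition Psi88_term (a a3 a4 a5 a6 a7 a8 q z : C) (k : Z) : C :=
  (1 - a * CpowZ q (2 * k)) / (1 - a) *
  Cprod (map (fun aj => qpoch aj q k / qpoch (q * a / aj) q k)
             [a3; a4; a5; a6; a7; a8]) *
  CpowZ z k.

Definition Psi88 (a a3 a4 a5 a6 a7 a8 q z : C) : C :=
  CSeriesZ (Psi88_term a a3 a4 a5 a6 a7 a8 q z).

Lemma CLim_seq_correct (u : nat -> C) (l : C) :
  filterlim u eventually (locally l) -> CLim_seq u = l.
Proof.
intros H.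
assert (HP : forall eps : posreal,
  eventually (fun n => ball (fst l) eps (fst (u n)) /\
                       ball (snd l) eps (snd (u n)))).
{ intros eps. apply (H (ball l eps)). now exists eps. }
assert (H1 : is_lim_seq (fun n => Re (u n)) (Re l)).
{ intros P [eps HQ]. destruct (HP eps) as [N HN].
  exists N. intros n Hn. apply HQ. apply (HN n Hn). }
assert (H2 : is_lim_seq (fun n => Im (u n)) (Im l)).
{ intros P [eps HQ]. destruct (HP eps) as [N HN].
  exists N. intros n Hn. apply HQ. apply (HN n Hn). }
unfold CLim_seq.
rewrite (is_lim_seq_unique _ _ H1), (is_lim_seq_unique _ _ H2).
now destruct l.
Qed.

Lemma CSeries_correct (f : nat -> C) (l : C) :
  @is_series C_AbsRing C_NormedModule f l -> CSeries f = l.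
Proof. intros H. apply CLim_seq_correct. exact H. Qed.

Lemma qpochN_bound (x p : C) (n : nat) :
  (Cmod p < 1)%R ->
  (Cmod (qpochN x p n) <= exp (Cmod x * ((1 - Cmod p ^ n) / (1 - Cmod p))))%R.
Proof.
intros Hp. induction n as [|n IH].
- simpl qpochN. rewrite Cmod_1. simpl.
  replace (Cmod x * ((1 - 1) / (1 - Cmod p)))%R with 0%R by (field; lra).
  rewrite exp_0. lra.
- simpl qpochN. rewrite Cmod_mult.
  replace (Cmod x * ((1 - Cmod p ^ S n) / (1 - Cmod p)))%R
    with (Cmod x * ((1 - Cmod p ^ n) / (1 - Cmod p)) + Cmod x * Cmod p ^ n)%R
    by (simpl; field; lra).
  rewrite exp_plus.
  apply Rmult_le_compat; try apply Cmod_ge_0; [exact IH|].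
  eapply Rle_trans; [|apply exp_ineq1_le].
  unfold Cminus. eapply Rle_trans; [apply Cmod_triangle|].
  rewrite Cmod_1, Cmod_opp, Cmod_mult, Cmod_pow. lra.
Qed.

Lemma qpochN_cvg (x p : C) :
  (Cmod p < 1)%R ->
  filterlim (qpochN x p) eventually (locally (qpoch_inf x p)).
Proof.
intros Hp.
set (M := exp (Cmod x * (1 / (1 - Cmod p)))%R).
assert (HM : forall n, (Cmod (qpochN x p n) <= M)%R).
{ intros n. eapply Rle_trans; [now apply qpochN_bound|].
  assert (H0 := Cmod_ge_0 x). assert (H1 := Cmod_ge_0 p).
  assert (H2 : (0 <= Cmod p ^ n)%R) by now apply pow_le.
  assert (exp_mono : forall u v, (u <= v)%R -> (exp u <= exp v)%R).
  { intros u v [Huv|Huv]; [left; now apply exp_increasing|right; now f_equal]. }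
  apply exp_mono.
  apply Rmult_le_compat_l; [exact H0|].
  apply Rmult_le_compat_r; [|lra].
  left; apply Rinv_0_lt_compat; lra. }
set (d := fun n => - (qpochN x p n * (x * p ^ n))).
assert (Hd : @ex_series C_AbsRing C_CompleteNormedModule d).
{ apply (@ex_series_le C_AbsRing C_CompleteNormedModule d
           (fun n => (M * Cmod x) * Cmod p ^ n)%R).
  - intros n. change (norm (d n)) with (Cmod (d n)). unfold d.
    rewrite Cmod_opp, !Cmod_mult, Cmod_pow.
    rewrite <- Rmult_assoc.
    apply Rmult_le_compat_r; [apply pow_le, Cmod_ge_0|].
    apply Rmult_le_compat_r; [apply Cmod_ge_0|apply HM].
  - apply (ex_series_scal (V := R_NormedModule) (M * Cmod x)%R (fun n => Cmod p ^ n)%R).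
    apply ex_series_geom. rewrite Rabs_pos_eq; [exact Hp|apply Cmod_ge_0]. }
destruct Hd as [l Hl].
assert (Hs : forall n, qpochN x p (S n) = plus (RtoC 1) (sum_n d n)).
{ induction n as [|n IH].
  - rewrite sum_O. unfold d, plus; simpl. ring.
  - rewrite sum_Sn.
    change (qpochN x p (S (S n)))
      with (qpochN x p (S n) * (1 - x * p ^ S n)).
    transitivity (qpochN x p (S n) + d (S n)).
    + unfold d. ring.
    + rewrite IH. unfold plus; simpl. ring. }
assert (HP : filterlim (qpochN x p) eventually
               (@locally C_UniformSpace (plus (RtoC 1) l))).
{ assert (HS : filterlim (fun n => qpochN x p (S n)) eventually
                 (@locally C_UniformSpace (plus (RtoC 1) l))).
  { apply (filterlim_ext (fun n => plus (RtoC 1) (sum_n d n))).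
    - intros n; now rewrite Hs.
    - apply (filterlim_comp_2 (H := @locally C_UniformSpace l)
               (G := @locally C_UniformSpace (RtoC 1))).
      + apply filterlim_const.
      + exact Hl.
      + apply (@filterlim_plus C_AbsRing C_NormedModule). }
  intros P HPP. destruct (HS P HPP) as [N HN].
  exists (S N). intros [|n] Hn; [lia|]. apply HN. lia. }
unfold qpoch_inf. rewrite (CLim_seq_correct _ _ HP). exact HP.
Qed.

Lemma qpochN_add (x p : C) (m n : nat) :
  qpochN x p (m + n) = qpochN x p m * qpochN (x * p ^ m) p n.
Proof.
induction n as [|n IH].
- rewrite Nat.add_0_r. simpl. ring.
- rewrite Nat.add_succ_r. simpl. rewrite IH, Cpow_add_r. ring.
Qed.

Lemma qpoch_inf_shift (x p : C) (m : nat) :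
  (Cmod p < 1)%R -> qpoch_inf x p = qpochN x p m * qpoch_inf (x * p ^ m) p.
Proof.
intros Hp. unfold qpoch_inf at 1. apply CLim_seq_correct.
assert (H : filterlim (fun n => qpochN x p (m + n)) eventually
          (@locally C_UniformSpace (qpochN x p m * qpoch_inf (x * p ^ m) p))).
{ apply (filterlim_ext (fun n => scal (qpochN x p m) (qpochN (x * p ^ m) p n))).
  - intros n. now rewrite qpochN_add.
  - eapply filterlim_comp; [now apply qpochN_cvg|].
    apply (@filterlim_scal_r C_AbsRing C_NormedModule). }
intros P HP. destruct (H P HP) as [N HN].
exists (m + N)%nat. intros n Hn.
replace n with (m + (n - m))%nat by lia. apply HN. lia.
Qed.

Lemma qpoch_quotient (x p : C) (k : Z) :
  (0 < Cmod p < 1)%R -> qpoch_inf (x * CpowZ p k) p <> 0 ->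
  qpoch x p k = qpoch_inf x p / qpoch_inf (x * CpowZ p k) p.
Proof.
intros [Hp0 Hp] H. destruct k as [|n|n].
- simpl in *. rewrite Cmult_1_r in *. now field.
- simpl in *. rewrite (qpoch_inf_shift x p (Pos.to_nat n) Hp). now field.
- cbn [qpoch]. set (y := x * CpowZ p (Zneg n)) in *.
  assert (Hpn : p ^ Pos.to_nat n <> 0).
  { apply Cpow_nz. intros E. rewrite E, Cmod_0 in Hp0. lra. }
  assert (E : x = y * p ^ Pos.to_nat n).
  { unfold y. simpl. now field. }
  rewrite (qpoch_inf_shift y p (Pos.to_nat n) Hp) in *.
  rewrite <- E in *.
  assert (H1 : qpochN y p (Pos.to_nat n) <> 0).
  { intros E1. apply H. rewrite E1. ring. }
  assert (H2 : qpoch_inf x p <> 0).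
  { intros E1. apply H. rewrite E1. ring. }
  field. now split.
Qed.

(* Main.v *)
(** Let [p = q^3] and [B = b^2/a^3].  Up to a constant the bilateral sum is
    [T(b) - a T(b/a^3)], where [T(u)] is a 2psi2 series in base [p] with parameters
    [u] and [q u/B]; the second term comes from reversing the order of summation.

    Both 2psi2 series transform by Bailey's method: the product of two of Ramanujan's
    1psi1 sums, regrouped into two other 1psi1 sums, is compared at its constant term.
    The transformed series contains a factor of type [1/(1 - u p^k/B)].  Shifting its
    other factor by [n] gives sums [S_n] with a first-order recursion
    [(1 - qBp^n) S_(n+1) = (1 - Bp^n) S_n + const q^n]; solving it produces the 2phi1
    series, and the limit of [S_n] is again a 1psi1 sum.  Hence [T(u)] is a combination
    of two products of theta functions, with coefficients depending only on [B].

    The theta functions of base [q^3] are finally matched with the stated ones by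
    Weierstrass' three-term relation in base [q], applied at a primitive cube root of
    unity. *)

Require Import Defs.
From Stdlib Require Import Reals ZArith List Lra Lia Permutation Classical ClassicalEpsilon.
From Coquelicot Require Import Coquelicot.
Import ListNotations.

Open Scope C_scope.

(** * Unconditional sums *)

(** The hypotheses permit parameters such as [b = p^(-m)]. There the quotients in the usual form of
    the 1psi1 sums read [0/0], and the simple fraction in a transformed series has a pole. Clearing
    the factors of their denominators by a theta function, as [wfac] does, gives summands defined
    for every nonzero parameter. Ramanujan's sum then holds without exceptional cases, and no
    continuation argument is needed.

    Bailey's regrouping is possible because both pairs of 1psi1 sums have the four denominators with
    arguments [z], [q z], [q/z], [q^2/z]. Exchanging [q/z] with [q^2/z] turns the parameter ratios
    [q^2, q^2] into [q, q^3], and a ratio equal to the base [p = q^3] is what makes one factor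
    collapse to a simple fraction. Constant terms are extracted by averaging over roots of unity on
    a circle, so absolutely convergent sums suffice and no integral occurs.

    Reversal sends [u] to [B/u] and fixes [B]. Both 2psi2 series therefore involve the same 2phi1,
    and only its coefficient and the remaining term have to be matched, each by one theta
    identity. *)

Definition dec {I : Type} (x y : I) : {x = y} + {x <> y} :=
  excluded_middle_informative (x = y).

Definition lsum {I : Type} (f : I -> C) (l : list I) : C :=
  fold_right (fun i s => f i + s) 0 l.

Definition lsumR {I : Type} (g : I -> R) (l : list I) : R :=
  fold_right (fun i s => (g i + s)%R) 0%R l.

(** Finite subsets are encoded as duplicate-free lists. Summation along this filter depends on no
    enumeration, so reindexing, splitting and double sums need no rearrangement theorem. *)
Definition fin_filter (I : Type) (P : list I -> Prop) : Prop :=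
  exists l0 : list I, forall l, NoDup l -> incl l0 l -> P l.

Definition has_sum {I : Type} (f : I -> C) (S : C) : Prop :=
  forall eps : R, (0 < eps)%R ->
    fin_filter I (fun l => (Cmod (lsum f l - S) < eps)%R).

Definition summable {I : Type} (g : I -> R) : Prop :=
  exists M : R, forall l, NoDup l -> (lsumR g l <= M)%R.

Definition asummable {I : Type} (f : I -> C) : Prop :=
  summable (fun i => Cmod (f i)).

Definition Clim (u : nat -> C) (l : C) : Prop :=
  forall eps : R, (0 < eps)%R ->
    exists N : nat, forall n, (N <= n)%nat -> (Cmod (u n - l) < eps)%R.

Lemma Cmod_sub_triangle (x y z : C) :
  (Cmod (x - z) <= Cmod (x - y) + Cmod (y - z))%R.
Proof.
replace (x - z) with ((x - y) + (y - z)) by ring. apply Cmod_triangle.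
Qed.

Lemma Cmod_sub_sym (x y : C) : Cmod (x - y) = Cmod (y - x).
Proof. rewrite <- Cmod_opp. f_equal. ring. Qed.

Lemma eq_of_Cmod_small (x y : C) :
  (forall eps : R, (0 < eps)%R -> (Cmod (x - y) < eps)%R) -> x = y.
Proof.
intros H. destruct (classic (x - y = 0)) as [E|E].
- replace x with (x - y + y) by ring. rewrite E. ring.
- apply Cmod_gt_0 in E. specialize (H _ E). lra.
Qed.

Lemma lsum_app {I} (f : I -> C) l1 l2 : lsum f (l1 ++ l2) = lsum f l1 + lsum f l2.
Proof.
induction l1 as [|i l1 IH]; simpl; [ring|]. unfold lsum in *; simpl. rewrite IH. ring.
Qed.

Lemma lsumR_app {I} (f : I -> R) l1 l2 :
  lsumR f (l1 ++ l2) = (lsumR f l1 + lsumR f l2)%R.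
Proof.
induction l1 as [|i l1 IH]; simpl; [ring|]. unfold lsumR in *; simpl. rewrite IH. ring.
Qed.

Lemma lsum_perm {I} (f : I -> C) l1 l2 : Permutation l1 l2 -> lsum f l1 = lsum f l2.
Proof.
induction 1; unfold lsum in *; simpl; try congruence. ring.
Qed.

Lemma lsumR_perm {I} (f : I -> R) l1 l2 : Permutation l1 l2 -> lsumR f l1 = lsumR f l2.
Proof.
induction 1; unfold lsumR in *; simpl; try congruence. ring.
Qed.

Lemma lsumR_ge0 {I} (g : I -> R) l : (forall i, 0 <= g i)%R -> (0 <= lsumR g l)%R.
Proof.
intros H. induction l as [|i l IH]; simpl; [lra|].
unfold lsumR in *; simpl. specialize (H i). lra.
Qed.

Lemma lsumR_le {I} (f g : I -> R) l :
  (forall i, f i <= g i)%R -> (lsumR f l <= lsumR g l)%R.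
Proof.
intros H. induction l as [|i l IH]; simpl; [lra|].
unfold lsumR in *; simpl. specialize (H i). lra.
Qed.

Lemma Cmod_lsum {I} (f : I -> C) l : (Cmod (lsum f l) <= lsumR (fun i => Cmod (f i)) l)%R.
Proof.
induction l as [|i l IH]; simpl; [rewrite Cmod_0; lra|].
unfold lsum, lsumR in *; simpl.
eapply Rle_trans; [apply Cmod_triangle|]. lra.
Qed.

Lemma lsum_sub {I} (f g : I -> C) l :
  lsum f l - lsum g l = lsum (fun i => f i - g i) l.
Proof.
induction l as [|i l IH]; unfold lsum in *; simpl; [ring|]. rewrite <- IH. ring.
Qed.

Lemma lsum_lin {I} (f g : I -> C) (c d : C) l :
  lsum (fun i => c * f i + d * g i) l = c * lsum f l + d * lsum g l.
Proof.
induction l as [|i l IH]; unfold lsum in *; simpl; [ring|]. rewrite IH. ring.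
Qed.

Lemma lsumR_scal {I} (g : I -> R) (c : R) l :
  lsumR (fun i => c * g i)%R l = (c * lsumR g l)%R.
Proof.
induction l as [|i l IH]; unfold lsumR in *; simpl; [ring|]. rewrite IH. ring.
Qed.

Lemma lsumR_plus {I} (f g : I -> R) l :
  lsumR (fun i => f i + g i)%R l = (lsumR f l + lsumR g l)%R.
Proof.
induction l as [|i l IH]; unfold lsumR in *; simpl; [ring|]. rewrite IH. ring.
Qed.

Lemma incl_split {I} (l0 l : list I) :
  NoDup l0 -> NoDup l -> incl l0 l ->
  exists l1, Permutation l (l0 ++ l1) /\ NoDup l1 /\
    forall i, In i l1 -> ~ In i l0.
Proof.
intros H0 H Hi.
set (l1 := filter (fun i => if in_dec dec i l0 then false else true) l).
assert (H1 : forall i, In i l1 <-> In i l /\ ~ In i l0).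
{ intros i. unfold l1. rewrite filter_In. destruct (in_dec dec i l0); split; intuition discriminate. }
exists l1. split; [|split].
- apply NoDup_Permutation; [exact H| |].
  + apply NoDup_app; [exact H0|now apply NoDup_filter|].
    intros i Hi0 Hi1. now apply H1 in Hi1.
  + intros i. rewrite in_app_iff, H1. specialize (Hi i).
    destruct (in_dec dec i l0); tauto.
- now apply NoDup_filter.
- intros i Hi1. now apply H1 in Hi1.
Qed.

Lemma lsumR_incl {I} (g : I -> R) (l0 l : list I) :
  (forall i, 0 <= g i)%R -> NoDup l0 -> NoDup l -> incl l0 l ->
  (lsumR g l0 <= lsumR g l)%R.
Proof.
intros Hg H0 H Hi. destruct (incl_split l0 l H0 H Hi) as [l1 [HP _]].
rewrite (lsumR_perm g _ _ HP), lsumR_app.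
assert (H1 := lsumR_ge0 g l1 Hg). lra.
Qed.

Lemma fin_filter_ex {I} (P : list I -> Prop) :
  fin_filter I P -> exists l, NoDup l /\ P l.
Proof.
intros [l0 H]. exists (nodup dec l0). split; [apply NoDup_nodup|].
apply H; [apply NoDup_nodup|]. intros i. apply nodup_In.
Qed.

Lemma fin_filter_and {I} (P Q : list I -> Prop) :
  fin_filter I P -> fin_filter I Q -> fin_filter I (fun l => P l /\ Q l).
Proof.
intros [l0 H0] [l1 H1]. exists (l0 ++ l1). intros l Hl Hi.
split; [apply H0|apply H1]; try exact Hl; intros i Hin; apply Hi, in_app_iff; tauto.
Qed.

Lemma fin_filter_imp {I} (P Q : list I -> Prop) :
  (forall l, NoDup l -> P l -> Q l) -> fin_filter I P -> fin_filter I Q.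
Proof. intros H [l0 H0]. exists l0. intros l Hl Hi. now apply H, H0. Qed.

Lemma fin_filter_incl {I} (l0 : list I) : fin_filter I (fun l => incl l0 l).
Proof. now exists l0. Qed.

#[local] Instance fin_filter_proper (I : Type) : ProperFilter (fin_filter I).
Proof.
constructor.
- intros P HP. destruct (fin_filter_ex P HP) as [l [_ Hl]]. now exists l.
- constructor.
  + now exists nil.
  + intros P Q. apply fin_filter_and.
  + intros P Q H. apply fin_filter_imp. intros l _. apply H.
Qed.

Lemma has_sum_unique {I} (f : I -> C) (S T : C) : has_sum f S -> has_sum f T -> S = T.
Proof.
intros HS HT. apply eq_of_Cmod_small. intros eps He.
destruct (fin_filter_ex _ (fin_filter_and _ _ (HS (eps / 2)%R ltac:(lra))
  (HT (eps / 2)%R ltac:(lra)))) as [l [_ [H1 H2]]].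
eapply Rle_lt_trans; [apply (Cmod_sub_triangle _ (lsum f l))|].
rewrite Cmod_sub_sym in H1. lra.
Qed.

Lemma lsum_ext {I} (f g : I -> C) l : (forall i, f i = g i) -> lsum f l = lsum g l.
Proof.
intros H. induction l as [|i l IH]; unfold lsum in *; simpl; [easy|]. now rewrite H, IH.
Qed.

Lemma has_sum_ext {I} (f g : I -> C) (S : C) :
  (forall i, f i = g i) -> has_sum f S -> has_sum g S.
Proof.
intros H HS eps He. eapply fin_filter_imp; [|apply (HS eps He)].
intros l _. cbv beta. now rewrite (lsum_ext f g l H).
Qed.

Lemma has_sum_lin {I} (f g : I -> C) (c d S T : C) :
  has_sum f S -> has_sum g T -> has_sum (fun i => c * f i + d * g i) (c * S + d * T).
Proof.
intros HS HT eps He.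
set (K := (Cmod c + Cmod d + 1)%R).
assert (HK : (0 < K)%R) by (unfold K; generalize (Cmod_ge_0 c) (Cmod_ge_0 d); lra).
assert (HeK : (0 < eps / K)%R) by now apply Rdiv_lt_0_compat.
eapply fin_filter_imp; [|exact (fin_filter_and _ _ (HS _ HeK) (HT _ HeK))].
intros l _ [H1 H2]. cbv beta. rewrite lsum_lin.
replace (c * lsum f l + d * lsum g l - (c * S + d * T))
  with (c * (lsum f l - S) + d * (lsum g l - T)) by ring.
eapply Rle_lt_trans; [apply Cmod_triangle|]. rewrite !Cmod_mult.
assert (Hc := Cmod_ge_0 c). assert (Hd := Cmod_ge_0 d).
apply Rle_lt_trans with (Cmod c * (eps / K) + Cmod d * (eps / K))%R.
{ apply Rplus_le_compat; apply Rmult_le_compat_l; lra. }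
apply Rlt_le_trans with (K * (eps / K))%R.
- rewrite <- Rmult_plus_distr_r. apply Rmult_lt_compat_r; [exact HeK|unfold K; lra].
- right. field. lra.
Qed.

Lemma has_sum_scal {I} (f : I -> C) (c S : C) :
  has_sum f S -> has_sum (fun i => c * f i) (c * S).
Proof.
intros H. replace (c * S) with (c * S + 0 * S) by ring.
apply (has_sum_ext (fun i => c * f i + 0 * f i)); [intros i; ring|].
now apply has_sum_lin.
Qed.

Lemma has_sum_plus {I} (f g : I -> C) (S T : C) :
  has_sum f S -> has_sum g T -> has_sum (fun i => f i + g i) (S + T).
Proof.
intros HS HT. replace (S + T) with (1 * S + 1 * T) by ring.
apply (has_sum_ext (fun i => 1 * f i + 1 * g i)); [intros i; ring|].
now apply has_sum_lin.
Qed.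

Lemma summable_le {I} (f g : I -> R) :
  (forall i, f i <= g i)%R -> summable g -> summable f.
Proof.
intros H [M HM]. exists M. intros l Hl.
eapply Rle_trans; [apply (lsumR_le f g l H)|now apply HM].
Qed.

Lemma summable_scal {I} (g : I -> R) (c : R) :
  (0 <= c)%R -> summable g -> summable (fun i => c * g i)%R.
Proof.
intros Hc [M HM]. exists (c * M)%R. intros l Hl. rewrite lsumR_scal.
apply Rmult_le_compat_l; [exact Hc|now apply HM].
Qed.

Lemma asummable_scal {I} (f : I -> C) (c : C) :
  asummable f -> asummable (fun i => c * f i).
Proof.
intros H. apply (summable_le _ (fun i => Cmod c * Cmod (f i))%R).
- intros i. rewrite Cmod_mult. lra.
- apply summable_scal; [apply Cmod_ge_0|exact H].
Qed.

Lemma asummable_ext {I} (f g : I -> C) :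
  (forall i, f i = g i) -> asummable f -> asummable g.
Proof. intros H. apply summable_le. intros i. rewrite H. lra. Qed.

Lemma asummable_plus {I} (f g : I -> C) :
  asummable f -> asummable g -> asummable (fun i => f i + g i).
Proof.
intros [M HM] [N HN]. exists (M + N)%R. intros l Hl.
eapply Rle_trans; [apply (lsumR_le _ (fun i => Cmod (f i) + Cmod (g i))%R); intros i; apply Cmod_triangle|].
rewrite lsumR_plus. apply Rplus_le_compat; auto.
Qed.

(** Take [l0] whose sum is within [eps] of the supremum of all finite sums; whatever is disjoint
    from it can add less than [eps]. *)
Lemma summable_tail {I} (g : I -> R) (eps : R) :
  (forall i, 0 <= g i)%R -> summable g -> (0 < eps)%R ->
  exists l0, NoDup l0 /\ forall l, NoDup l -> (forall i, In i l -> ~ In i l0) ->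
    (lsumR g l < eps)%R.
Proof.
intros Hg [M HM] He.
destruct (completeness (fun x => exists l, NoDup l /\ x = lsumR g l)) as [S [HS1 HS2]].
- exists M. intros x [l [Hl ->]]. now apply HM.
- exists 0%R, nil. split; [constructor|reflexivity].
- destruct (classic (exists l0, NoDup l0 /\ (S - eps < lsumR g l0)%R)) as [[l0 [H0 H1]]|H].
  + exists l0. split; [exact H0|]. intros l Hl Hd.
    assert (H2 : (lsumR g (l0 ++ l) <= S)%R).
    { apply HS1. exists (l0 ++ l). split; [|reflexivity].
      apply NoDup_app; auto. intros i Hi0 Hi. now apply (Hd i). }
    rewrite lsumR_app in H2. lra.
  + exfalso. assert (S <= S - eps)%R; [|lra].
    apply HS2. intros x [l [Hl ->]]. apply Rnot_lt_le. intros Hx. apply H. now exists l.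
Qed.

Lemma asummable_has_sum {I} (f : I -> C) : asummable f -> exists S, has_sum f S.
Proof.
intros Hf.
destruct (proj1 (@filterlim_locally_cauchy _ C_CompleteNormedModule (fin_filter I) _ (lsum f)))
  as [S HS].
- intros eps. assert (He := cond_pos eps).
  destruct (summable_tail _ (eps / 2)%R (fun i => Cmod_ge_0 (f i)) Hf ltac:(lra))
    as [l0 [H0 Ht]].
  exists (fun l => NoDup l /\ incl l0 l). split.
  + exists l0. auto.
  + assert (Hc : forall l, NoDup l -> incl l0 l -> (Cmod (lsum f l - lsum f l0) < eps / 2)%R).
    { intros l Hl Hi. destruct (incl_split l0 l H0 Hl Hi) as [l1 [HP [H1 Hd]]].
      rewrite (lsum_perm f _ _ HP), lsum_app.
      replace (lsum f l0 + lsum f l1 - lsum f l0) with (lsum f l1) by ring.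
      eapply Rle_lt_trans; [apply Cmod_lsum|]. now apply Ht. }
    intros u v [Hu Iu] [Hv Iv].
    apply C_NormedModule_mixin_compat1.
    change (minus (lsum f v) (lsum f u)) with (lsum f v - lsum f u).
    eapply Rle_lt_trans; [apply (Cmod_sub_triangle _ (lsum f l0))|].
    rewrite (Cmod_sub_sym (lsum f l0)).
    specialize (Hc u Hu Iu) as H3. specialize (Hc v Hv Iv). lra.
- exists S. intros eps He.
  (* Balls of [C] are squares, comparable with discs only up to a factor [sqrt 2]; hence the halved
     radius. *)
  assert (He2 : (0 < eps / 2)%R) by lra.
  destruct (HS (fun y => ball S (mkposreal _ He2) y)) as [l0 H0].
  { now exists (mkposreal _ He2). }
  exists l0. intros l Hl Hi. specialize (H0 l Hl Hi).
  apply C_NormedModule_mixin_compat2 in H0. simpl in H0.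
  change (minus (lsum f l) S) with (lsum f l - S) in H0.
  assert (Hs : (sqrt 2 <= 2)%R).
  { rewrite <- (sqrt_Rsqr 2) at 2 by lra. apply sqrt_le_1; unfold Rsqr; lra. }
  apply Rlt_le_trans with (1 := H0).
  replace eps with (2 * (eps / 2))%R at 2 by field.
  apply Rmult_le_compat_r; lra.
Qed.

(** * Limits of complex sequences *)

Lemma Clim_bound (u : nat -> C) (l : C) (M : R) :
  Clim u l -> (forall n, Cmod (u n) <= M)%R -> (Cmod l <= M)%R.
Proof.
intros H HM. apply Rnot_lt_le. intros Hl.
destruct (H (Cmod l - M)%R ltac:(lra)) as [N HN].
specialize (HN N (le_n N)). specialize (HM N).
assert (H1 := Cmod_sub_triangle l (u N) 0).
replace (l - 0) with l in H1 by ring. replace (u N - 0) with (u N) in H1 by ring.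
rewrite Cmod_sub_sym in H1. lra.
Qed.

Lemma Clim_unique (u : nat -> C) (l m : C) : Clim u l -> Clim u m -> l = m.
Proof.
intros Hl Hm. apply eq_of_Cmod_small. intros eps He.
destruct (Hl (eps / 2)%R ltac:(lra)) as [N HN].
destruct (Hm (eps / 2)%R ltac:(lra)) as [N' HN'].
specialize (HN (N + N')%nat ltac:(lia)). specialize (HN' (N + N')%nat ltac:(lia)).
eapply Rle_lt_trans; [apply (Cmod_sub_triangle _ (u (N + N')%nat))|].
rewrite Cmod_sub_sym in HN. lra.
Qed.

Lemma Clim_ext (u v : nat -> C) (l : C) : (forall n, u n = v n) -> Clim u l -> Clim v l.
Proof.
intros H Hu eps He. destruct (Hu eps He) as [N HN]. exists N. intros n Hn.
rewrite <- H. now apply HN.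
Qed.

Lemma Clim_const (c : C) : Clim (fun _ => c) c.
Proof.
intros eps He. exists 0%nat. intros n _. replace (c - c) with (RtoC 0) by ring.
now rewrite Cmod_0.
Qed.

Lemma Clim_filterlim (u : nat -> C) (l : C) :
  filterlim u eventually (locally l) <-> Clim u l.
Proof.
split.
- intros H eps He.
  assert (He2 : (0 < eps / 2)%R) by lra.
  destruct (H (fun y => ball l (mkposreal _ He2) y)) as [N HN].
  { now exists (mkposreal _ He2). }
  exists N. intros n Hn. specialize (HN n Hn).
  apply C_NormedModule_mixin_compat2 in HN. simpl in HN.
  change (minus (u n) l) with (u n - l) in HN.
  assert (Hs : (sqrt 2 <= 2)%R).
  { rewrite <- (sqrt_Rsqr 2) at 2 by lra. apply sqrt_le_1; unfold Rsqr; lra. }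
  apply Rlt_le_trans with (1 := HN).
  replace eps with (2 * (eps / 2))%R at 2 by field.
  apply Rmult_le_compat_r; lra.
- intros H P [eps HP]. destruct (H eps (cond_pos eps)) as [N HN].
  exists N. intros n Hn. apply HP. apply C_NormedModule_mixin_compat1.
  now apply HN.
Qed.

Lemma Clim_plus (u v : nat -> C) (l m : C) :
  Clim u l -> Clim v m -> Clim (fun n => u n + v n) (l + m).
Proof.
intros Hu Hv eps He.
destruct (Hu (eps / 2)%R ltac:(lra)) as [N HN].
destruct (Hv (eps / 2)%R ltac:(lra)) as [N' HN'].
exists (N + N')%nat. intros n Hn.
specialize (HN n ltac:(lia)). specialize (HN' n ltac:(lia)).
replace (u n + v n - (l + m)) with ((u n - l) + (v n - m)) by ring.
eapply Rle_lt_trans; [apply Cmod_triangle|]. lra.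
Qed.

Lemma Clim_mult (u v : nat -> C) (l m : C) :
  Clim u l -> Clim v m -> Clim (fun n => u n * v n) (l * m).
Proof.
intros Hu Hv eps He.
set (K := (Cmod l + Cmod m + 1)%R).
assert (Hl := Cmod_ge_0 l). assert (Hm := Cmod_ge_0 m).
assert (HK : (0 < K)%R) by (unfold K; lra).
assert (HeK : (0 < eps / K)%R) by now apply Rdiv_lt_0_compat.
destruct (Hu (eps / K)%R HeK) as [N HN].
destruct (Hv (Rmin 1 (eps / K))%R) as [N' HN'].
{ apply Rmin_glb_lt; lra. }
exists (N + N')%nat. intros n Hn.
specialize (HN n ltac:(lia)). specialize (HN' n ltac:(lia)).
assert (H1 := Rmin_l 1 (eps / K)). assert (H2 := Rmin_r 1 (eps / K)).
replace (u n * v n - l * m) with ((u n - l) * v n + l * (v n - m)) by ring.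
eapply Rle_lt_trans; [apply Cmod_triangle|]. rewrite !Cmod_mult.
assert (H3 : (Cmod (v n) <= Cmod m + 1)%R).
{ replace (v n) with ((v n - m) + m) by ring.
  eapply Rle_trans; [apply Cmod_triangle|]. lra. }
assert (Hun := Cmod_ge_0 (u n - l)). assert (Hvn := Cmod_ge_0 (v n)).
apply Rle_lt_trans with (Cmod (u n - l) * (Cmod m + 1) + Cmod l * (eps / K))%R.
{ apply Rplus_le_compat; apply Rmult_le_compat_l; lra. }
apply Rlt_le_trans with (eps / K * (Cmod m + 1) + Cmod l * (eps / K))%R.
{ apply Rplus_lt_compat_r. apply Rmult_lt_compat_r; lra. }
right. unfold K. field. unfold K in HK. lra.
Qed.

Lemma lsumR_Clim {I} (F : nat -> I -> C) (G : I -> C) (l : list I) (eps : R) :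
  (forall i, Clim (fun n => F n i) (G i)) -> (0 < eps)%R ->
  exists N, forall n, (N <= n)%nat -> (lsumR (fun i => Cmod (F n i - G i)) l < eps)%R.
Proof.
intros H. revert eps. induction l as [|i l IH]; intros eps He.
- exists 0%nat. intros n _. exact He.
- destruct (IH (eps / 2)%R ltac:(lra)) as [N HN].
  destruct (H i (eps / 2)%R ltac:(lra)) as [N' HN'].
  exists (N + N')%nat. intros n Hn.
  specialize (HN n ltac:(lia)). specialize (HN' n ltac:(lia)).
  unfold lsumR in *; simpl. lra.
Qed.

(** Dominated convergence: outside a finite set all [F n] and [G] have uniformly small sums, and on
    that set pointwise convergence is uniform. *)
Lemma tannery {I} (F : nat -> I -> C) (G : I -> C) (g : I -> R)
    (S : nat -> C) (T : C) :
  summable g -> (forall n i, Cmod (F n i) <= g i)%R ->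
  (forall i, Clim (fun n => F n i) (G i)) ->
  (forall n, has_sum (F n) (S n)) -> has_sum G T -> Clim S T.
Proof.
intros Hs Hg HF HS HT eps He.
assert (Hg0 : forall i, (0 <= g i)%R).
{ intros i. eapply Rle_trans; [apply Cmod_ge_0|apply (Hg 0%nat i)]. }
assert (HG : forall i, (Cmod (G i) <= g i)%R).
{ intros i. apply (Clim_bound _ _ _ (HF i)). intros n. apply Hg. }
destruct (summable_tail g (eps / 8)%R Hg0 Hs ltac:(lra)) as [l0 [H0 Ht]].
destruct (lsumR_Clim F G l0 (eps / 4)%R HF ltac:(lra)) as [N HN].
exists N. intros n Hn. specialize (HN n Hn).
destruct (fin_filter_ex _ (fin_filter_and _ _ (fin_filter_incl l0)
  (fin_filter_and _ _ (HS n (eps / 4)%R ltac:(lra)) (HT (eps / 4)%R ltac:(lra)))))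
  as [l [Hl [Hi [H1 H2]]]].
destruct (incl_split l0 l H0 Hl Hi) as [l1 [HP [Hl1 Hd]]].
assert (H3 : (Cmod (lsum (F n) l - lsum G l) < eps / 2)%R).
{ rewrite lsum_sub. eapply Rle_lt_trans; [apply Cmod_lsum|].
  rewrite (lsumR_perm _ _ _ HP), lsumR_app.
  assert (H4 : (lsumR (fun i => Cmod (F n i - G i)) l1 <= 2 * lsumR g l1)%R).
  { rewrite <- lsumR_scal. apply lsumR_le. intros i. unfold Cminus.
    eapply Rle_trans; [apply Cmod_triangle|]. rewrite Cmod_opp.
    specialize (Hg n i). specialize (HG i). lra. }
  specialize (Ht l1 Hl1 Hd). lra. }
eapply Rle_lt_trans; [apply (Cmod_sub_triangle _ (lsum (F n) l))|].
assert (H5 := Cmod_sub_triangle (lsum (F n) l) (lsum G l) T).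
rewrite Cmod_sub_sym in H1. lra.
Qed.

(** The common source of all reindexing: shifts and reflections of [Z], the two half-lines, the
    diagonal of [Z * Z] and its parity classes are ranges of injections off which the family is
    zero. *)
Lemma has_sum_inj {I J} (phi : J -> I) (f : I -> C) (S : C) :
  (forall j j', phi j = phi j' -> j = j') ->
  (forall i, (forall j, phi j <> i) -> f i = 0) ->
  has_sum (fun j => f (phi j)) S -> has_sum f S.
Proof.
intros Hinj Hz HS eps He. destruct (HS eps He) as [l0 H0].
exists (map phi l0). intros l Hl Hi.
assert (Hpre : exists l', NoDup l' /\ lsum f l = lsum (fun j => f (phi j)) l' /\
                 forall j, In (phi j) l <-> In j l').
{ clear Hi. induction Hl as [|i l Hil Hl IH].
  - exists nil. repeat split; [constructor|easy|easy].
  - destruct IH as [l' [H1 [H2 H3]]].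
    destruct (classic (exists j, phi j = i)) as [[j Hj]|Hj].
    + exists (j :: l'). repeat split.
      * constructor; [|exact H1]. rewrite <- H3, Hj. exact Hil.
      * unfold lsum in *; simpl. now rewrite H2, Hj.
      * intros [E|E]; [left; apply Hinj; congruence|right; now apply H3].
      * intros [E|E]; [left; congruence|right; now apply H3].
    + exists l'. repeat split; [exact H1| | |].
      * unfold lsum in *; simpl. rewrite Hz, H2; [ring|].
        intros j E. apply Hj. now exists j.
      * intros [E|E]; [exfalso; apply Hj; now exists j|now apply H3].
      * intros E. right. now apply H3. }
destruct Hpre as [l' [H1 [H2 H3]]]. rewrite H2. apply H0; [exact H1|].
intros j Hj. apply H3, Hi, in_map, Hj.
Qed.

Lemma summable_inj {I J} (phi : J -> I) (g : I -> R) :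
  (forall j j', phi j = phi j' -> j = j') ->
  summable g -> summable (fun j => g (phi j)).
Proof.
intros Hinj [M HM]. exists M. intros l Hl.
replace (lsumR (fun j => g (phi j)) l) with (lsumR g (map phi l)).
- apply HM. now apply FinFun.Injective_map_NoDup.
- clear Hl. induction l as [|j l IH]; unfold lsumR in *; simpl; [easy|]. now rewrite IH.
Qed.

Lemma lsum_list_prod {I J} (f : I -> C) (g : J -> C) (A : list I) (B : list J) :
  lsum (fun x => f (fst x) * g (snd x)) (list_prod A B) = lsum f A * lsum g B.
Proof.
induction A as [|i A IH]; simpl; [unfold lsum; simpl; ring|].
rewrite lsum_app, IH.
replace (lsum (fun x => f (fst x) * g (snd x)) (map (fun y => (i, y)) B))
  with (f i * lsum g B).
- unfold lsum; simpl. ring.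
- clear IH. induction B as [|j B IH]; unfold lsum in *; simpl; [ring|].
  rewrite <- IH. ring.
Qed.

Lemma lsumR_list_prod {I J} (f : I -> R) (g : J -> R) (A : list I) (B : list J) :
  lsumR (fun x => f (fst x) * g (snd x))%R (list_prod A B) = (lsumR f A * lsumR g B)%R.
Proof.
induction A as [|i A IH]; simpl; [unfold lsumR; simpl; ring|].
rewrite lsumR_app, IH.
replace (lsumR (fun x => f (fst x) * g (snd x))%R (map (fun y => (i, y)) B))
  with (f i * lsumR g B)%R.
- unfold lsumR; simpl. ring.
- clear IH. induction B as [|j B IH]; unfold lsumR in *; simpl; [ring|].
  rewrite <- IH. ring.
Qed.

Lemma NoDup_list_prod {I J} (A : list I) (B : list J) :
  NoDup A -> NoDup B -> NoDup (list_prod A B).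
Proof.
intros HA HB. induction HA as [|i A Hi HA IH]; simpl; [constructor|].
apply NoDup_app; [|exact IH|].
- apply FinFun.Injective_map_NoDup; [|exact HB]. intros x y E. congruence.
- intros x Hx Hy. apply in_map_iff in Hx as [y [<- _]].
  now apply in_prod_iff in Hy.
Qed.

(** A finite set of pairs lies in the rectangle spanned by its two projections, and on a rectangle
    the sum factors. *)
Lemma asummable_prod {I J} (f : I -> C) (g : J -> C) :
  asummable f -> asummable g -> asummable (fun x : I * J => f (fst x) * g (snd x)).
Proof.
intros [M HM] [N HN]. exists (M * N)%R. intros l Hl.
set (A := nodup dec (map fst l)). set (B := nodup dec (map snd l)).
assert (HA : NoDup A) by apply NoDup_nodup.
assert (HB : NoDup B) by apply NoDup_nodup.
apply Rle_trans with (lsumR (fun x : I * J => Cmod (f (fst x)) * Cmod (g (snd x)))%R (list_prod A B)).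
- eapply Rle_trans; [apply (lsumR_le _ (fun x : I * J => Cmod (f (fst x)) * Cmod (g (snd x)))%R)|].
  + intros x. rewrite Cmod_mult. lra.
  + apply lsumR_incl; [|exact Hl|now apply NoDup_list_prod|].
    * intros x. apply Rmult_le_pos; apply Cmod_ge_0.
    * intros [i j] Hx. apply in_prod_iff. unfold A, B. rewrite !nodup_In.
      split; apply in_map_iff; now exists (i, j).
- rewrite (lsumR_list_prod (fun i => Cmod (f i)) (fun j => Cmod (g j))).
  apply Rmult_le_compat; auto; apply lsumR_ge0; intros; apply Cmod_ge_0.
Qed.

(** Absolute summability already yields some sum [U]; testing it on large rectangles, where the
    double sum factors, identifies it as [S * T]. *)
Lemma has_sum_prod {I J} (f : I -> C) (g : J -> C) (S T : C) :
  asummable f -> asummable g -> has_sum f S -> has_sum g T ->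
  has_sum (fun x : I * J => f (fst x) * g (snd x)) (S * T).
Proof.
intros Hf Hg HS HT.
destruct (asummable_has_sum _ (asummable_prod f g Hf Hg)) as [U HU].
replace (S * T) with U; [exact HU|].
apply eq_of_Cmod_small. intros eps He.
destruct (HU (eps / 2)%R ltac:(lra)) as [l0 H0].
set (K := (Cmod S + Cmod T + 1)%R).
assert (Hs := Cmod_ge_0 S). assert (Ht := Cmod_ge_0 T).
assert (HK : (0 < K)%R) by (unfold K; lra).
assert (HeK : (0 < eps / 2 / K)%R) by (apply Rdiv_lt_0_compat; lra).
destruct (fin_filter_ex _ (fin_filter_and _ _ (fin_filter_incl (map fst l0)) (HS _ HeK)))
  as [A [HA [IA EA]]].
destruct (fin_filter_ex _ (fin_filter_and _ _ (fin_filter_incl (map snd l0))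
  (HT (Rmin 1 (eps / 2 / K)) ltac:(apply Rmin_glb_lt; lra)))) as [B [HB [IB EB]]].
specialize (H0 (list_prod A B) (NoDup_list_prod A B HA HB)).
rewrite lsum_list_prod in H0.
assert (Hincl : incl l0 (list_prod A B)).
{ intros [i j] Hx. apply in_prod_iff. split;
  [apply IA|apply IB]; apply in_map_iff; now exists (i, j). }
specialize (H0 Hincl).
set (a := lsum f A) in *. set (b := lsum g B) in *.
assert (H1 := Rmin_l 1 (eps / 2 / K)). assert (H2 := Rmin_r 1 (eps / 2 / K)).
eapply Rle_lt_trans; [apply (Cmod_sub_triangle _ (a * b))|].
rewrite Cmod_sub_sym in H0.
replace (a * b - S * T) with ((a - S) * b + S * (b - T)) by ring.
assert (H3 : (Cmod b <= Cmod T + 1)%R).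
{ replace b with ((b - T) + T) by ring. eapply Rle_trans; [apply Cmod_triangle|]. lra. }
assert (H4 : (Cmod ((a - S) * b + S * (b - T)) <= eps / 2)%R); [|lra].
eapply Rle_trans; [apply Cmod_triangle|]. rewrite !Cmod_mult.
assert (Hc := Cmod_ge_0 (a - S)). assert (Hb := Cmod_ge_0 b).
apply Rle_trans with (eps / 2 / K * (Cmod T + 1) + Cmod S * (eps / 2 / K))%R.
{ apply Rplus_le_compat; [apply Rmult_le_compat; lra|apply Rmult_le_compat_l; lra]. }
right. unfold K. field. unfold K in HK. lra.
Qed.

(** * Sums over the integers and q-shifted factorials *)

Fixpoint zlist (n : nat) : list Z :=
  match n with
  | O => [0%Z]
  | S m => Z.of_nat (S m) :: (- Z.of_nat (S m))%Z :: zlist m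
  end.

Lemma in_zlist (n : nat) (k : Z) : In k (zlist n) <-> (Z.abs k <= Z.of_nat n)%Z.
Proof.
induction n as [|n IH].
- simpl. lia.
- change (zlist (S n)) with (Z.of_nat (S n) :: (- Z.of_nat (S n))%Z :: zlist n).
  cbn [In]. rewrite IH. lia.
Qed.

Lemma NoDup_zlist (n : nat) : NoDup (zlist n).
Proof.
induction n as [|n IH].
- repeat constructor. easy.
- change (zlist (S n)) with (Z.of_nat (S n) :: (- Z.of_nat (S n))%Z :: zlist n).
  constructor; [|constructor; [|exact IH]]; cbn [In]; rewrite in_zlist; lia.
Qed.

Lemma lsumR_le_mem {I} (g : I -> R) (l : list I) (i : I) :
  (forall j, 0 <= g j)%R -> In i l -> (g i <= lsumR g l)%R.
Proof.
intros Hg. induction l as [|j l IH]; [easy|].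
assert (H := lsumR_ge0 g l Hg). assert (Hj := Hg j).
intros [<-|Hi]; unfold lsumR in *; simpl; [lra|]. specialize (IH Hi). lra.
Qed.

Lemma summable_geom (rho : R) :
  (0 <= rho < 1)%R -> summable (fun k : Z => (rho ^ Z.abs_nat k)%R).
Proof.
intros Hr. exists (2 / (1 - rho))%R. intros l Hl.
assert (Hpos : forall k : Z, (0 <= rho ^ Z.abs_nat k)%R) by (intros; apply pow_le; lra).
assert (HN : exists N, incl l (zlist N)).
{ clear Hl. induction l as [|k l [N IH]].
  - exists 0%nat. intros i [].
  - exists (Z.to_nat (Z.abs k) + N)%nat. intros i [<-|Hi]; apply in_zlist; [lia|].
    apply IH, in_zlist in Hi. lia. }
destruct HN as [N HN].
eapply Rle_trans; [apply (lsumR_incl _ l (zlist N) Hpos Hl (NoDup_zlist N) HN)|].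
assert (E : lsumR (fun k : Z => (rho ^ Z.abs_nat k)%R) (zlist N)
            = ((1 + rho - 2 * rho ^ S N) / (1 - rho))%R).
{ clear - Hr. induction N as [|n IH].
  - unfold lsumR; simpl. field. lra.
  - change (zlist (S n)) with (Z.of_nat (S n) :: (- Z.of_nat (S n))%Z :: zlist n).
    unfold lsumR in *. cbn [fold_right]. rewrite IH.
    replace (Z.abs_nat (Z.of_nat (S n))) with (S n) by lia.
    replace (Z.abs_nat (- Z.of_nat (S n))) with (S n) by lia.
    simpl. field. lra. }
rewrite E. assert (H := pow_le rho (S N) ltac:(lra)).
apply Rmult_le_compat_r; [left; apply Rinv_0_lt_compat; lra|lra].
Qed.

(** A ratio test at both ends, by comparison with a multiple of [rho^|k|]. The multiple is chosen to
    dominate on the window [|k| <= K], from which the ratios propagate the bound. *)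
Lemma summable_ratio (g : Z -> R) (rho : R) (K : nat) :
  (forall k, 0 <= g k)%R -> (0 < rho < 1)%R ->
  (forall k, (Z.of_nat K <= k)%Z -> (g (k + 1)%Z <= rho * g k)%R) ->
  (forall k, (k <= - Z.of_nat K)%Z -> (g (k - 1)%Z <= rho * g k)%R) ->
  summable g.
Proof.
intros Hg Hr Hp Hn.
set (M := lsumR (fun k => (g k / rho ^ Z.abs_nat k)%R) (zlist K)).
assert (Hrk : forall n, (0 < rho ^ n)%R) by (intros; apply pow_lt; lra).
assert (HM : forall k, (Z.abs k <= Z.of_nat K)%Z -> (g k <= M * rho ^ Z.abs_nat k)%R).
{ intros k Hk.
  assert (H : (g k / rho ^ Z.abs_nat k <= M)%R).
  { apply (lsumR_le_mem (fun k => (g k / rho ^ Z.abs_nat k)%R)); [|now apply in_zlist].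
    intros j. apply Rdiv_le_0_compat; auto. }
  apply (Rmult_le_compat_r (rho ^ Z.abs_nat k)) in H; [|left; apply Hrk].
  replace (g k) with (g k / rho ^ Z.abs_nat k * rho ^ Z.abs_nat k)%R; [exact H|].
  field. apply Rgt_not_eq, Hrk. }
assert (Hall : forall n : nat, (g (Z.of_nat K + Z.of_nat n)%Z <= M * rho ^ (K + n))%R /\
                        (g (- Z.of_nat K - Z.of_nat n)%Z <= M * rho ^ (K + n))%R).
{ induction n as [|n [IH1 IH2]].
  - split.
    + replace (K + 0)%nat with (Z.abs_nat (Z.of_nat K + Z.of_nat 0)) by lia. apply HM. lia.
    + replace (K + 0)%nat with (Z.abs_nat (- Z.of_nat K - Z.of_nat 0)) by lia. apply HM. lia.
  - replace (K + S n)%nat with (S (K + n)) by lia. simpl pow.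
    replace (M * (rho * rho ^ (K + n)))%R with (rho * (M * rho ^ (K + n)))%R by ring.
    split.
    + replace (Z.of_nat K + Z.of_nat (S n))%Z with (Z.of_nat K + Z.of_nat n + 1)%Z by lia.
      eapply Rle_trans; [apply Hp; lia|]. apply Rmult_le_compat_l; lra.
    + replace (- Z.of_nat K - Z.of_nat (S n))%Z with (- Z.of_nat K - Z.of_nat n - 1)%Z by lia.
      eapply Rle_trans; [apply Hn; lia|]. apply Rmult_le_compat_l; lra. }
apply (summable_le _ (fun k => M * rho ^ Z.abs_nat k)%R).
- intros k. destruct (Z_le_gt_dec (Z.abs k) (Z.of_nat K)) as [H|H]; [now apply HM|].
  destruct (Hall (Z.abs_nat k - K)%nat) as [H1 H2].
  replace (K + (Z.abs_nat k - K))%nat with (Z.abs_nat k) in * by lia.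
  destruct (Z_le_gt_dec 0 k).
  + replace (Z.of_nat K + Z.of_nat (Z.abs_nat k - K))%Z with k in H1 by lia. exact H1.
  + replace (- Z.of_nat K - Z.of_nat (Z.abs_nat k - K))%Z with k in H2 by lia. exact H2.
- apply summable_scal; [|apply summable_geom; lra].
  apply lsumR_ge0. intros k. apply Rdiv_le_0_compat; auto.
Qed.

Lemma has_sum_shift (f : Z -> C) (S : C) (m : Z) :
  has_sum f S -> has_sum (fun k => f (k + m)%Z) S.
Proof.
intros H. apply (has_sum_inj (fun k => (k - m)%Z)).
- intros. lia.
- intros i Hi. exfalso. apply (Hi (i + m)%Z). lia.
- apply (has_sum_ext f); [|exact H]. intros k. f_equal. lia.
Qed.

Lemma has_sum_neg (f : Z -> C) (S : C) :
  has_sum f S -> has_sum (fun k => f (- k)%Z) S.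
Proof.
intros H. apply (has_sum_inj (fun k => (- k)%Z)).
- intros. lia.
- intros i Hi. exfalso. apply (Hi (- i)%Z). lia.
- apply (has_sum_ext f); [|exact H]. intros k. f_equal. lia.
Qed.

Lemma sum_n_lsum (f : nat -> C) (n : nat) :
  @sum_n C_AbelianMonoid f n = lsum f (seq 0 (S n)).
Proof.
induction n as [|n IH].
- rewrite sum_O. unfold lsum; simpl. ring.
- rewrite sum_Sn, IH, (seq_S (S n)), lsum_app.
  unfold lsum at 3; simpl. unfold plus; simpl. ring.
Qed.

Lemma has_sum_series (f : nat -> C) (S : C) :
  has_sum f S -> @is_series C_AbsRing C_NormedModule f S.
Proof.
intros H. apply Clim_filterlim. intros eps He. destruct (H eps He) as [l0 H0].
exists (list_max l0). intros n Hn. rewrite sum_n_lsum. apply H0.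
- apply seq_NoDup.
- intros i Hi. apply in_seq.
  assert (Hm := proj1 (list_max_le l0 (list_max l0)) (le_n _)).
  rewrite Forall_forall in Hm. specialize (Hm i Hi). lia.
Qed.

(** The bridge from unconditional sums to the bilateral series of the statement: [f] is the sum of
    its two halves, each extended by zero. *)
Lemma has_sum_CSeriesZ (f : Z -> C) (S : C) :
  asummable f -> has_sum f S -> ex_CSeriesZ f /\ CSeriesZ f = S.
Proof.
intros Hf HS.
assert (I1 : forall j j' : nat, Z.of_nat j = Z.of_nat j' -> j = j') by (intros; lia).
assert (I2 : forall j j' : nat, (- Z.of_nat (Datatypes.S j) = - Z.of_nat (Datatypes.S j'))%Z -> j = j')
  by (intros; lia).
assert (A1 : asummable (fun n : nat => f (Z.of_nat n)))
  by exact (summable_inj _ (fun k => Cmod (f k)) I1 Hf).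
assert (A2 : asummable (fun n : nat => f (- Z.of_nat (Datatypes.S n))%Z))
  by exact (summable_inj _ (fun k => Cmod (f k)) I2 Hf).
destruct (asummable_has_sum _ A1) as [S1 H1].
destruct (asummable_has_sum _ A2) as [S2 H2].
assert (E : S1 + S2 = S).
{ apply (has_sum_unique f); [|exact HS].
  apply (has_sum_ext (fun k => (if Z_le_gt_dec 0 k then f k else 0) +
                               (if Z_le_gt_dec 0 k then 0 else f k))).
  { intros k. destruct (Z_le_gt_dec 0 k); ring. }
  apply has_sum_plus.
  - apply (has_sum_inj Z.of_nat _ _ I1).
    + intros i Hi. destruct (Z_le_gt_dec 0 i); [|easy].
      exfalso. apply (Hi (Z.to_nat i)). lia.
    + apply (has_sum_ext (fun n : nat => f (Z.of_nat n))); [|exact H1].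
      intros n. destruct (Z_le_gt_dec 0 (Z.of_nat n)); [easy|lia].
  - apply (has_sum_inj (fun n : nat => (- Z.of_nat (Datatypes.S n))%Z) _ _ I2).
    + intros i Hi. destruct (Z_le_gt_dec 0 i); [easy|].
      exfalso. apply (Hi (Z.to_nat (- i - 1))). lia.
    + apply (has_sum_ext (fun n : nat => f (- Z.of_nat (Datatypes.S n))%Z)); [|exact H2].
      intros n. destruct (Z_le_gt_dec 0 (- Z.of_nat (Datatypes.S n))); [lia|easy]. }
apply has_sum_series in H1. apply has_sum_series in H2.
split; [split; [now exists S1|now exists S2]|].
unfold CSeriesZ. now rewrite (CSeries_correct _ _ H1), (CSeries_correct _ _ H2).
Qed.

(** * Integer powers *)

Lemma C1_nz : RtoC 1 <> 0.
Proof. intros E. apply RtoC_inj in E. lra. Qed.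

Lemma CpowZ_nonneg (x : C) (k : Z) : (0 <= k)%Z -> CpowZ x k = x ^ Z.to_nat k.
Proof. destruct k; [reflexivity|reflexivity|lia]. Qed.

Lemma CpowZ_neg (x : C) (k : Z) : (k < 0)%Z -> CpowZ x k = / x ^ Z.to_nat (- k).
Proof. destruct k; [lia|lia|reflexivity]. Qed.

Lemma CpowZ_of_nat (x : C) (n : nat) : CpowZ x (Z.of_nat n) = x ^ n.
Proof. rewrite CpowZ_nonneg by lia. now rewrite Nat2Z.id. Qed.

Lemma CpowZ_succ (x : C) (k : Z) : x <> 0 -> CpowZ x (k + 1) = CpowZ x k * x.
Proof.
intros Hx. destruct (Z_lt_le_dec k (-1)) as [H|H].
- rewrite !CpowZ_neg by lia.
  replace (Z.to_nat (- k)) with (S (Z.to_nat (- (k + 1)))) by lia.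
  rewrite Cpow_S. field. split; [now apply Cpow_nz|exact Hx].
- destruct (Z.eq_dec k (-1)) as [->|H'].
  + simpl. field. exact Hx.
  + rewrite !CpowZ_nonneg by lia.
    replace (Z.to_nat (k + 1)) with (S (Z.to_nat k)) by lia.
    rewrite Cpow_S. ring.
Qed.

Lemma CpowZ_pred (x : C) (k : Z) : x <> 0 -> CpowZ x (k - 1) = CpowZ x k / x.
Proof.
intros Hx. replace k with (k - 1 + 1)%Z at 2 by lia. rewrite CpowZ_succ by exact Hx.
now field.
Qed.

Lemma Z_bi_ind (P : Z -> Prop) :
  P 0%Z -> (forall k, P k <-> P (k + 1)%Z) -> forall k, P k.
Proof.
intros H0 HS k. apply Z.bi_induction with (P := P); [|exact H0|].
- intros x y ->. reflexivity.
- intros n. rewrite HS. now rewrite Z.add_1_r.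
Qed.

Lemma CpowZ_nz (x : C) (k : Z) : x <> 0 -> CpowZ x k <> 0.
Proof.
intros Hx. destruct (Z_lt_le_dec k 0) as [H|H].
- rewrite CpowZ_neg by lia. intros E.
  apply (Cpow_nz x (Z.to_nat (- k)) Hx).
  set (y := x ^ Z.to_nat (- k)) in *.
  destruct (classic (y = 0)) as [|Hy]; [easy|].
  exfalso. assert (H1 := Cinv_r y Hy). rewrite E in H1.
  replace (y * 0) with (RtoC 0) in H1 by ring. apply RtoC_inj in H1. lra.
- rewrite CpowZ_nonneg by lia. now apply Cpow_nz.
Qed.

Lemma CpowZ_add (x : C) (k m : Z) : x <> 0 -> CpowZ x (k + m) = CpowZ x k * CpowZ x m.
Proof.
intros Hx. revert m. apply Z_bi_ind.
- rewrite Z.add_0_r. simpl. ring.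
- intros m. rewrite Z.add_assoc, !CpowZ_succ by exact Hx. split; intros H.
  + rewrite H. ring.
  + assert (E : CpowZ x (k + m) * x / x = CpowZ x k * (CpowZ x m * x) / x) by now rewrite H.
    replace (CpowZ x (k + m)) with (CpowZ x (k + m) * x / x) by now field.
    rewrite E. now field.
Qed.

Lemma CpowZ_opp (x : C) (k : Z) : x <> 0 -> CpowZ x (- k) = / CpowZ x k.
Proof.
intros Hx.
assert (H : CpowZ x (- k) * CpowZ x k = 1).
{ rewrite <- CpowZ_add by exact Hx. now replace (- k + k)%Z with 0%Z by lia. }
assert (Hk := CpowZ_nz x k Hx).
replace (CpowZ x (- k)) with (CpowZ x (- k) * CpowZ x k / CpowZ x k) by now field.
rewrite H. now field.
Qed.

Lemma CpowZ_sub (x : C) (k m : Z) : x <> 0 -> CpowZ x (k - m) = CpowZ x k / CpowZ x m.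
Proof.
intros Hx. unfold Z.sub. rewrite CpowZ_add, CpowZ_opp by exact Hx. reflexivity.
Qed.

Lemma CpowZ_mult_l (x y : C) (k : Z) :
  x <> 0 -> y <> 0 -> CpowZ (x * y) k = CpowZ x k * CpowZ y k.
Proof.
intros Hx Hy. assert (Hxy := Cmult_neq_0 _ _ Hx Hy).
destruct (Z_lt_le_dec k 0) as [H|H].
- rewrite !CpowZ_neg by lia. rewrite Cpow_mult_l. field.
  split; now apply Cpow_nz.
- rewrite !CpowZ_nonneg by lia. apply Cpow_mult_l.
Qed.

Lemma CpowZ_mult_r (x : C) (n : nat) (k : Z) :
  x <> 0 -> CpowZ (x ^ n) k = CpowZ x (Z.of_nat n * k).
Proof.
intros Hx. assert (Hn := Cpow_nz x n Hx). revert k. apply Z_bi_ind.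
- now rewrite Z.mul_0_r.
- intros k. rewrite Z.mul_add_distr_l, Z.mul_1_r, CpowZ_succ, (CpowZ_add x), CpowZ_of_nat by assumption.
  split; [now intros ->|]. intros H.
  assert (E : CpowZ (x ^ n) k * x ^ n / x ^ n = CpowZ x (Z.of_nat n * k) * x ^ n / x ^ n)
    by now rewrite H.
  replace (CpowZ (x ^ n) k) with (CpowZ (x ^ n) k * x ^ n / x ^ n) by now field.
  rewrite E. now field.
Qed.

Lemma Clim_Cpow (p : C) : (Cmod p < 1)%R -> Clim (fun n => p ^ n) 0.
Proof.
intros Hp eps He.
destruct (pow_lt_1_zero (Cmod p)) with (y := eps) as [N HN].
- rewrite Rabs_pos_eq; [exact Hp|apply Cmod_ge_0].
- exact He.
- exists N. intros n Hn. replace (p ^ n - 0) with (p ^ n) by ring.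
  rewrite Cmod_pow. specialize (HN n ltac:(lia)).
  now rewrite Rabs_pos_eq in HN by (apply pow_le, Cmod_ge_0).
Qed.

(** * Infinite products: limits, nonvanishing, majorants *)

Lemma qpochN_Clim (x p : C) :
  (Cmod p < 1)%R -> Clim (qpochN x p) (qpoch_inf x p).
Proof. intros Hp. apply Clim_filterlim. now apply qpochN_cvg. Qed.

Lemma qinf_step (x p : C) :
  (Cmod p < 1)%R -> qpoch_inf x p = (1 - x) * qpoch_inf (x * p) p.
Proof.
intros Hp. rewrite (qpoch_inf_shift x p 1 Hp). simpl.
replace (p * 1) with p by ring. ring.
Qed.

Lemma qinf_0 (p : C) : qpoch_inf 0 p = 1.
Proof.
unfold qpoch_inf. apply CLim_seq_correct, Clim_filterlim.
apply (Clim_ext (fun _ => 1)); [|apply Clim_const].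
intros n. induction n as [|n IH]; [reflexivity|].
cbn [qpochN]. rewrite <- IH. ring.
Qed.

(** Consecutive partial products differ by at most [M |y| |p|^n]. The geometric partial sum is kept
    exactly so that the induction closes. *)
Lemma qpochN_near_1 (y p : C) (n : nat) :
  (Cmod p < 1)%R -> (Cmod y <= 1)%R ->
  (Cmod (qpochN y p n - 1)
     <= exp (1 / (1 - Cmod p)) * Cmod y * ((1 - Cmod p ^ n) / (1 - Cmod p)))%R.
Proof.
intros Hp Hy. assert (Hr := Cmod_ge_0 p). assert (Hy0 := Cmod_ge_0 y).
set (M := exp (1 / (1 - Cmod p))).
assert (HM : forall m, (Cmod (qpochN y p m) <= M)%R).
{ intros m. eapply Rle_trans; [now apply qpochN_bound|].
  assert (exp_mono : forall u v, (u <= v)%R -> (exp u <= exp v)%R).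
  { intros u v [Huv|Huv]; [left; now apply exp_increasing|right; now f_equal]. }
  apply exp_mono. assert (Hm := pow_le (Cmod p) m Hr).
  assert (H1 : (0 < / (1 - Cmod p))%R) by (apply Rinv_0_lt_compat; lra).
  apply Rle_trans with (1 * ((1 - Cmod p ^ m) / (1 - Cmod p)))%R.
  - apply Rmult_le_compat_r; [|exact Hy].
    apply Rmult_le_pos; [|lra]. assert (H2 := pow_incr (Cmod p) 1 m ltac:(lra)).
    rewrite pow1 in H2. lra.
  - rewrite Rmult_1_l. apply Rmult_le_compat_r; lra. }
induction n as [|n IH].
- simpl. replace (1 - 1) with (RtoC 0) by ring. rewrite Cmod_0. right. field. lra.
- cbn [qpochN].
  replace (qpochN y p n * (1 - y * p ^ n) - 1)
    with ((qpochN y p n - 1) + - (qpochN y p n * (y * p ^ n))) by ring.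
  eapply Rle_trans; [apply Cmod_triangle|].
  rewrite Cmod_opp, !Cmod_mult, Cmod_pow.
  replace (M * Cmod y * ((1 - Cmod p ^ S n) / (1 - Cmod p)))%R
    with (M * Cmod y * ((1 - Cmod p ^ n) / (1 - Cmod p)) + M * (Cmod y * Cmod p ^ n))%R
    by (simpl; field; lra).
  apply Rplus_le_compat; [exact IH|].
  apply Rmult_le_compat_r; [|apply HM].
  apply Rmult_le_pos; [exact Hy0|now apply pow_le].
Qed.

Lemma qinf_near_1 (y p : C) :
  (Cmod p < 1)%R -> (Cmod y <= 1)%R ->
  (Cmod (qpoch_inf y p - 1) <= exp (1 / (1 - Cmod p)) / (1 - Cmod p) * Cmod y)%R.
Proof.
intros Hp Hy.
apply (Clim_bound (fun n => qpochN y p n + - (1))).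
- apply Clim_plus; [now apply qpochN_Clim|apply Clim_const].
- intros n. eapply Rle_trans; [now apply (qpochN_near_1 y p n)|].
  assert (Hr := Cmod_ge_0 p). assert (H := pow_le (Cmod p) n Hr).
  assert (H1 : (0 < / (1 - Cmod p))%R) by (apply Rinv_0_lt_compat; lra).
  assert (H2 := exp_pos (1 / (1 - Cmod p))). assert (Hy0 := Cmod_ge_0 y).
  unfold Rdiv in *. set (e := exp (1 * / (1 - Cmod p))) in *.
  set (i := (/ (1 - Cmod p))%R) in *.
  replace (e * i * Cmod y)%R with (e * Cmod y * (1 * i))%R by ring.
  apply Rmult_le_compat_l; [apply Rmult_le_pos; lra|].
  apply Rmult_le_compat_r; lra.
Qed.

Lemma qinf_Clim_1 (y : nat -> C) (p : C) :
  (Cmod p < 1)%R -> Clim y 0 -> Clim (fun n => qpoch_inf (y n) p) 1.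
Proof.
intros Hp Hy eps He.
set (K := (exp (1 / (1 - Cmod p)) / (1 - Cmod p))%R).
assert (HK : (0 < K)%R).
{ apply Rdiv_lt_0_compat; [apply exp_pos|lra]. }
destruct (Hy (Rmin 1 (eps / K))) as [N HN].
{ apply Rmin_glb_lt; [lra|now apply Rdiv_lt_0_compat]. }
exists N. intros n Hn. specialize (HN n Hn).
replace (y n - 0) with (y n) in HN by ring.
assert (H1 := Rmin_l 1 (eps / K)). assert (H2 := Rmin_r 1 (eps / K)).
eapply Rle_lt_trans; [apply qinf_near_1; [exact Hp|lra]|]. fold K.
apply Rlt_le_trans with (K * (eps / K))%R; [apply Rmult_lt_compat_l; lra|].
right. field. lra.
Qed.

Lemma qinf_shift_Clim (x p : C) :
  (Cmod p < 1)%R -> Clim (fun n => qpoch_inf (x * p ^ n) p) 1.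
Proof.
intros Hp. apply qinf_Clim_1; [exact Hp|].
replace (RtoC 0) with (x * 0) by ring.
apply Clim_mult; [apply Clim_const|now apply Clim_Cpow].
Qed.

Lemma qpochN_nz (x p : C) (n : nat) :
  (Cmod p <= 1)%R -> (Cmod x < 1)%R -> qpochN x p n <> 0.
Proof.
intros Hp Hx. induction n as [|n IH]; simpl.
- apply C1_nz.
- apply Cmult_neq_0; [exact IH|]. intros E.
  assert (E1 : x * p ^ n = 1) by (replace (x * p ^ n) with (1 - (1 - x * p ^ n)) by ring;
    rewrite E; ring).
  assert (H : (Cmod (x * p ^ n) < 1)%R).
  { rewrite Cmod_mult, Cmod_pow. assert (H0 := Cmod_ge_0 x). assert (H1 := Cmod_ge_0 p).
    assert (H2 := pow_incr (Cmod p) 1 n ltac:(lra)). rewrite pow1 in H2.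
    assert (H3 := pow_le (Cmod p) n H1).
    apply Rle_lt_trans with (Cmod x * 1)%R; [apply Rmult_le_compat_l; lra|lra]. }
  rewrite E1, Cmod_1 in H. lra.
Qed.

(** Some tail of the product is within 1/2 of 1, and the finitely many factors in front of it do not
    vanish. *)
Lemma qinf_nz (x p : C) :
  (Cmod p < 1)%R -> (Cmod x < 1)%R -> qpoch_inf x p <> 0.
Proof.
intros Hp Hx.
destruct (qinf_shift_Clim x p Hp (1 / 2)%R ltac:(lra)) as [N HN].
specialize (HN N (le_n N)).
rewrite (qpoch_inf_shift x p N Hp). apply Cmult_neq_0; [apply qpochN_nz; lra|].
intros E. rewrite E in HN.
replace (0 - 1) with (- (1)) in HN by ring. rewrite Cmod_m1 in HN. lra.
Qed.

(* [Qr r y] is the real product [(-y; r)_oo], used as a majorant. *)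
Definition Qr (r y : R) : R := Cmod (qpoch_inf (- RtoC y) (RtoC r)).

Lemma Qr_ge0 (r y : R) : (0 <= Qr r y)%R.
Proof. apply Cmod_ge_0. Qed.

Lemma Qr_0 (r : R) : Qr r 0 = 1%R.
Proof.
unfold Qr. replace (- RtoC 0) with (RtoC 0) by ring. now rewrite qinf_0, Cmod_1.
Qed.

Lemma Qr_step (r y : R) :
  (0 <= r < 1)%R -> (0 <= y)%R -> Qr r y = ((1 + y) * Qr r (y * r))%R.
Proof.
intros Hr Hy. unfold Qr.
rewrite (qinf_step (- RtoC y)) by (rewrite Cmod_R, Rabs_pos_eq; lra).
rewrite Cmod_mult. f_equal.
- replace (1 - - RtoC y) with (RtoC (1 + y)) by (rewrite RtoC_plus; ring).
  rewrite Cmod_R, Rabs_pos_eq; lra.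
- f_equal. f_equal. rewrite RtoC_mult. ring.
Qed.

Lemma Clim_Cmod_le (u v : nat -> C) (l m : C) :
  Clim u l -> Clim v m -> (forall n, Cmod (u n) <= Cmod (v n))%R -> (Cmod l <= Cmod m)%R.
Proof.
intros Hu Hv H. apply Rnot_lt_le. intros Hlt.
destruct (Hu ((Cmod l - Cmod m) / 2)%R ltac:(lra)) as [N HN].
destruct (Hv ((Cmod l - Cmod m) / 2)%R ltac:(lra)) as [N' HN'].
specialize (HN (N + N')%nat ltac:(lia)). specialize (HN' (N + N')%nat ltac:(lia)).
specialize (H (N + N')%nat). set (a := u (N + N')%nat) in *. set (b := v (N + N')%nat) in *.
assert (H1 := Cmod_triangle (l - a) a). replace (l - a + a) with l in H1 by ring.
assert (H2 := Cmod_triangle (b - m) m). replace (b - m + m) with b in H2 by ring.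
rewrite Cmod_sub_sym in HN. lra.
Qed.

Lemma Cmod_qinf_le (x p : C) (y : R) :
  (Cmod p < 1)%R -> (Cmod x <= y)%R -> (Cmod (qpoch_inf x p) <= Qr (Cmod p) y)%R.
Proof.
intros Hp Hx. assert (Hr := Cmod_ge_0 p). assert (Hx0 := Cmod_ge_0 x).
assert (Hp' : (Cmod (RtoC (Cmod p)) < 1)%R) by (rewrite Cmod_R, Rabs_pos_eq; lra).
apply (Clim_Cmod_le _ _ _ _ (qpochN_Clim x p Hp) (qpochN_Clim (- RtoC y) _ Hp')).
intros n. induction n as [|n IH]; [simpl; lra|].
cbn [qpochN]. rewrite !Cmod_mult.
apply Rmult_le_compat; try apply Cmod_ge_0; [exact IH|].
replace (1 - - RtoC y * RtoC (Cmod p) ^ n) with (RtoC (1 + y * Cmod p ^ n)).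
- rewrite Cmod_R, Rabs_pos_eq.
  + eapply Rle_trans; [apply Cmod_triangle|].
    rewrite Cmod_1, Cmod_opp, Cmod_mult, Cmod_pow.
    apply Rplus_le_compat_l, Rmult_le_compat_r; [now apply pow_le|exact Hx].
  + assert (H := pow_le (Cmod p) n Hr). assert (0 <= y * Cmod p ^ n)%R; [|lra].
    apply Rmult_le_pos; lra.
- rewrite RtoC_plus, RtoC_mult, RtoC_pow. ring.
Qed.

Lemma Qr_le (r y z : R) :
  (0 <= r < 1)%R -> (0 <= y <= z)%R -> (Qr r y <= Qr r z)%R.
Proof.
intros Hr Hy.
assert (E : r = Cmod (RtoC r)) by (rewrite Cmod_R, Rabs_pos_eq; lra).
unfold Qr at 1. rewrite E at 2. apply Cmod_qinf_le; [lra|].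
rewrite Cmod_opp, Cmod_R, Rabs_pos_eq; lra.
Qed.

(** * Ramanujan's 1psi1 sum and the Jacobi triple product *)

(** A total choice of the sum, so that sequences of sums can be named and related before they are
    evaluated. *)
Definition tsum {I : Type} (f : I -> C) : C := epsilon (inhabits (RtoC 0)) (has_sum f).

Lemma tsum_correct {I} (f : I -> C) : asummable f -> has_sum f (tsum f).
Proof. intros H. unfold tsum. apply epsilon_spec. now apply asummable_has_sum. Qed.

Lemma has_sum_fin {I} (f : I -> C) (l : list I) :
  NoDup l -> (forall i, ~ In i l -> f i = 0) -> has_sum f (lsum f l).
Proof.
intros Hl Hz eps He. exists l. intros l' Hl' Hi.
destruct (incl_split l l' Hl Hl' Hi) as [l1 [HP [_ Hd]]].
rewrite (lsum_perm f _ _ HP), lsum_app.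
replace (lsum f l1) with (RtoC 0).
- replace (lsum f l + 0 - lsum f l) with (RtoC 0) by ring. now rewrite Cmod_0.
- clear HP. induction l1 as [|i l1 IH]; unfold lsum in *; simpl; [easy|].
  rewrite <- IH by (intros j Hj; apply Hd; now right).
  rewrite Hz by (apply Hd; now left). ring.
Qed.

(** The general term of Jacobi's theta series, and also the multiplier of [theta] under [A -> A p^k]
    (see [theta_gauss]). *)
Definition gauss (p A : C) (k : Z) : C := CpowZ (- A) k * CpowZ p (k * (k - 1) / 2).

(* For [A] outside [p^Z] this is [theta(A;p) (D p^k;p)_oo / (A p^k;p)_oo]; the
   form below needs no such restriction on [A]. *)
Definition wfac (p A D : C) (k : Z) : C :=
  gauss p A k * qpoch_inf (CpowZ p (1 - k) / A) p * qpoch_inf (D * CpowZ p k) p.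

Lemma Copp_nz (x : C) : x <> 0 -> - x <> 0.
Proof. intros H E. apply H. replace x with (- - x) by ring. rewrite E. ring. Qed.

Lemma gauss_0 (p A : C) : gauss p A 0 = 1.
Proof. unfold gauss. simpl. ring. Qed.

Lemma gauss_succ (p A : C) (k : Z) :
  p <> 0 -> A <> 0 -> gauss p A (k + 1) = gauss p A k * (- A * CpowZ p k).
Proof.
intros Hp HA. unfold gauss.
replace ((k + 1) * (k + 1 - 1))%Z with (k * (k - 1) + k * 2)%Z by ring.
rewrite Z.div_add by lia.
rewrite CpowZ_succ, CpowZ_add by auto using Copp_nz. ring.
Qed.

Lemma gauss_scal (p A z : C) (k : Z) :
  p <> 0 -> A <> 0 -> z <> 0 -> CpowZ z k * gauss p A k = gauss p (A * z) k.
Proof.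
intros Hp HA Hz. unfold gauss. replace (- (A * z)) with (z * - A) by ring.
rewrite (CpowZ_mult_l z (- A)) by auto using Copp_nz. ring.
Qed.

Lemma wfac_D (p A D : C) (k : Z) :
  (Cmod p < 1)%R -> wfac p A D k = (1 - D * CpowZ p k) * wfac p A (p * D) k.
Proof.
intros Hp. unfold wfac. rewrite (qinf_step (D * CpowZ p k)) by exact Hp.
replace (D * CpowZ p k * p) with (p * D * CpowZ p k) by ring. ring.
Qed.

Lemma wfac_succ (p A D : C) (k : Z) :
  (Cmod p < 1)%R -> p <> 0 -> A <> 0 ->
  wfac p A D (k + 1) = (1 - A * CpowZ p k) * wfac p A (p * D) k.
Proof.
intros Hp Hp0 HA. unfold wfac. rewrite gauss_succ by assumption.
rewrite (qinf_step (CpowZ p (1 - (k + 1)) / A)) by exact Hp.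
replace (CpowZ p (1 - (k + 1)) / A * p) with (CpowZ p (1 - k) / A).
- replace (1 - (k + 1))%Z with (- k)%Z by lia.
  rewrite CpowZ_opp, (CpowZ_succ p k) by exact Hp0.
  replace (p * D * CpowZ p k) with (D * (CpowZ p k * p)) by ring.
  assert (Hk := CpowZ_nz p k Hp0). field. now split.
- replace (1 - k)%Z with (1 - (k + 1) + 1)%Z by lia.
  rewrite (CpowZ_succ p (1 - (k + 1))) by exact Hp0. now field.
Qed.

Lemma Cmod_nz (x : C) : x <> 0 -> (0 < Cmod x)%R.
Proof. apply Cmod_gt_0. Qed.

Lemma nz_Cmod (x : C) : (0 < Cmod x)%R -> x <> 0.
Proof. apply Cmod_gt_0. Qed.

(** Bounds [z^k wfac p A D k] for all [|D| <= gam] at once. Being built from real infinite products,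
    it obeys an exact first-order recursion in [k], from which its summability is read off. *)
Definition maj (p A z : C) (gam : R) (k : Z) : R :=
  (Cmod (CpowZ z k * gauss p A k) * Qr (Cmod p) (Cmod (CpowZ p (1 - k) / A))
   * Qr (Cmod p) (gam * Cmod (CpowZ p k)))%R.

Lemma maj_ge0 (p A z : C) (gam : R) (k : Z) : (0 <= maj p A z gam k)%R.
Proof.
unfold maj. apply Rmult_le_pos; [apply Rmult_le_pos|]; try apply Qr_ge0. apply Cmod_ge_0.
Qed.

Lemma maj_succ (p A z : C) (gam : R) (k : Z) :
  (0 < Cmod p < 1)%R -> A <> 0 -> z <> 0 -> (0 <= gam)%R ->
  (maj p A z gam (k + 1) * (1 + gam * Cmod (CpowZ p k))
   = Cmod z * (1 + Cmod A * Cmod (CpowZ p k)) * maj p A z gam k)%R.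
Proof.
intros [Hp0 Hp] HA Hz Hg. apply nz_Cmod in Hp0 as Hpn. unfold maj.
assert (Hk := Cmod_ge_0 (CpowZ p k)).
rewrite (Qr_step (Cmod p) (gam * Cmod (CpowZ p k))) by (try lra; now apply Rmult_le_pos).
rewrite (Qr_step (Cmod p) (Cmod (CpowZ p (1 - (k + 1)) / A))) by (try lra; apply Cmod_ge_0).
rewrite <- Cmod_mult.
replace (CpowZ p (1 - (k + 1)) / A * p) with (CpowZ p (1 - k) / A).
2:{ replace (1 - k)%Z with (1 - (k + 1) + 1)%Z by lia.
    rewrite (CpowZ_succ p (1 - (k + 1))) by exact Hpn. now field. }
replace (1 - (k + 1))%Z with (- k)%Z by lia.
rewrite CpowZ_opp, !CpowZ_succ, gauss_succ by assumption.
rewrite !Cmod_mult, Cmod_div, Cmod_inv, Cmod_opp by (try exact HA; now apply CpowZ_nz).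
assert (Hkp := Cmod_nz _ (CpowZ_nz p k Hpn)). assert (HAp := Cmod_nz _ HA).
rewrite <- (Rmult_assoc gam). field. lra.
Qed.

Lemma CpowZ_small (p : C) (d : R) :
  (Cmod p < 1)%R -> (0 < d)%R ->
  exists K : nat, forall k, (Z.of_nat K <= k)%Z -> (Cmod (CpowZ p k) < d)%R.
Proof.
intros Hp Hd. destruct (Clim_Cpow p Hp d Hd) as [N HN]. exists N. intros k Hk.
specialize (HN (Z.to_nat k) ltac:(lia)).
rewrite CpowZ_nonneg by lia.
now replace (p ^ Z.to_nat k - 0) with (p ^ Z.to_nat k) in HN by ring.
Qed.

(** By [maj_succ] consecutive terms have ratio [|z| (1 + |A| s) / (1 + gam s)] with [s = |p^k|]. It
    tends to [|z|] at [+oo], and its inverse tends to [gam / |A z|] at [-oo]; the last two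
    hypotheses put both limits below 1. *)
Lemma maj_summable (p A z : C) (gam : R) :
  (0 < Cmod p < 1)%R -> A <> 0 -> z <> 0 -> (0 <= gam)%R ->
  (Cmod z < 1)%R -> (gam < Cmod A * Cmod z)%R -> summable (maj p A z gam).
Proof.
intros Hp HA Hz Hg Hz1 HgA.
assert (HAp := Cmod_nz _ HA). assert (Hzp := Cmod_nz _ Hz).
destruct Hp as [Hp0 Hp]. apply nz_Cmod in Hp0 as Hpn.
set (a := (Cmod A * Cmod z)%R) in *.
(* Midpoints between 1 and the limiting ratios [|z|] at [+oo] and [gam / a] at [-oo]. *)
set (rho1 := ((1 + Cmod z) / 2)%R). set (rho2 := ((gam + a) / (2 * a))%R).
assert (Ha : (0 < a)%R) by lra.
assert (Hr2 : (rho2 * a = (gam + a) / 2)%R) by (unfold rho2; field; lra).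
assert (Hr2' : (rho2 < 1)%R).
{ unfold rho2. apply Rmult_lt_reg_r with (2 * a)%R; [lra|].
  unfold Rdiv. rewrite Rmult_assoc, Rinv_l; lra. }
destruct (CpowZ_small p ((1 - Cmod z) / (2 * a))%R Hp) as [K1 HK1].
{ apply Rdiv_lt_0_compat; lra. }
destruct (CpowZ_small p ((a - gam) / 2)%R Hp ltac:(lra)) as [K2 HK2].
set (rho := Rmax rho1 rho2).
assert (R1 := Rmax_l rho1 rho2). assert (R2 := Rmax_r rho1 rho2). fold rho in R1, R2.
assert (Hrho : (0 < rho < 1)%R).
{ split; [unfold rho1 in R1; lra|]. unfold rho. apply Rmax_lub_lt; [unfold rho1; lra|exact Hr2']. }
apply (summable_ratio _ rho (K1 + K2)).
- intros; apply maj_ge0.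
- exact Hrho.
- intros k Hk. specialize (HK1 k ltac:(lia)).
  assert (E := maj_succ p A z gam k (conj Hp0 Hp) HA Hz Hg).
  assert (Hs := Cmod_ge_0 (CpowZ p k)). set (s := Cmod (CpowZ p k)) in *.
  assert (Hm := maj_ge0 p A z gam k). assert (Hm1 := maj_ge0 p A z gam (k + 1)).
  set (m := maj p A z gam k) in *. set (m1 := maj p A z gam (k + 1)) in *.
  assert (H1 : (a * s <= (1 - Cmod z) / 2)%R).
  { replace ((1 - Cmod z) / 2)%R with (a * ((1 - Cmod z) / (2 * a)))%R by (field; lra).
    apply Rmult_le_compat_l; lra. }
  assert (H2 : (Cmod z * (1 + Cmod A * s) <= rho)%R).
  { replace (Cmod z * (1 + Cmod A * s))%R with (Cmod z + a * s)%R by (unfold a; ring).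
    unfold rho1 in R1. lra. }
  assert (H3 : (0 <= gam * s)%R) by now apply Rmult_le_pos.
  apply Rle_trans with (m1 * (1 + gam * s))%R.
  + rewrite <- (Rmult_1_r m1) at 1. apply Rmult_le_compat_l; lra.
  + rewrite E. apply Rmult_le_compat_r; lra.
- intros k Hk.
  assert (E := maj_succ p A z gam (k - 1) (conj Hp0 Hp) HA Hz Hg).
  replace (k - 1 + 1)%Z with k in E by lia.
  specialize (HK2 (- (k - 1))%Z ltac:(lia)).
  rewrite CpowZ_opp, Cmod_inv in HK2 by (try exact Hpn; now apply CpowZ_nz).
  assert (Hs := Cmod_nz _ (CpowZ_nz p (k - 1) Hpn)).
  set (s := Cmod (CpowZ p (k - 1))) in *.
  assert (Hm := maj_ge0 p A z gam k). assert (Hm1 := maj_ge0 p A z gam (k - 1)).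
  set (m := maj p A z gam k) in *. set (m1 := maj p A z gam (k - 1)) in *.
  assert (H1 : (1 <= (a - gam) / 2 * s)%R).
  { apply (Rmult_lt_compat_r s) in HK2; [|exact Hs]. rewrite Rinv_l in HK2; lra. }
  assert (H2 : (1 + gam * s <= rho * (Cmod z * (1 + Cmod A * s)))%R).
  { apply Rle_trans with (rho2 * (a * s))%R.
    - rewrite <- Rmult_assoc, Hr2. lra.
    - apply Rle_trans with (rho * (a * s))%R.
      + apply Rmult_le_compat_r; [apply Rmult_le_pos; lra|exact R2].
      + apply Rmult_le_compat_l; [lra|]. unfold a. lra. }
  assert (H3 : (0 < Cmod z * (1 + Cmod A * s))%R).
  { apply Rmult_lt_0_compat; [exact Hzp|]. assert (0 < Cmod A * s)%R by now apply Rmult_lt_0_compat. lra. }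
  apply Rmult_le_reg_l with (Cmod z * (1 + Cmod A * s))%R; [exact H3|].
  rewrite <- E.
  apply Rle_trans with (m * (rho * (Cmod z * (1 + Cmod A * s))))%R.
  + now apply Rmult_le_compat_l.
  + right. ring.
Qed.

(** The factor [s] leaves room for [p^n], so that a whole sequence of series shares one majorant. *)
Lemma Cmod_le_maj (p A D z s : C) (gam : R) (k : Z) :
  (Cmod p < 1)%R -> (Cmod s <= 1)%R -> (Cmod D <= gam)%R ->
  (Cmod (CpowZ z k * gauss p A k * qpoch_inf (s * (CpowZ p (1 - k) / A)) p
         * qpoch_inf (D * CpowZ p k) p) <= maj p A z gam k)%R.
Proof.
intros Hp Hs HD. unfold maj.
rewrite (Cmod_mult _ (qpoch_inf (D * CpowZ p k) p)),
        (Cmod_mult _ (qpoch_inf (s * (CpowZ p (1 - k) / A)) p)).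
apply Rmult_le_compat; [| |apply Rmult_le_compat|]; try apply Cmod_ge_0; try lra.
- apply Rmult_le_pos; apply Cmod_ge_0.
- apply Cmod_qinf_le; [exact Hp|]. rewrite Cmod_mult.
  rewrite <- (Rmult_1_l (Cmod (CpowZ p (1 - k) / A))) at 2.
  apply Rmult_le_compat_r; [apply Cmod_ge_0|exact Hs].
- apply Cmod_qinf_le; [exact Hp|]. rewrite Cmod_mult.
  apply Rmult_le_compat_r; [apply Cmod_ge_0|exact HD].
Qed.

Lemma wfac_maj (p A D z : C) (gam : R) (k : Z) :
  (Cmod p < 1)%R -> (Cmod D <= gam)%R ->
  (Cmod (CpowZ z k * wfac p A D k) <= maj p A z gam k)%R.
Proof.
intros Hp HD.
assert (H1 : (Cmod 1 <= 1)%R) by (rewrite Cmod_1; lra).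
assert (H := Cmod_le_maj p A D z 1 gam k Hp H1 HD).
unfold wfac. replace (1 * (CpowZ p (1 - k) / A)) with (CpowZ p (1 - k) / A) in H by ring.
now rewrite !Cmult_assoc.
Qed.

Lemma wfac_summable (p A D z : C) :
  (0 < Cmod p < 1)%R -> A <> 0 -> z <> 0 ->
  (Cmod z < 1)%R -> (Cmod D < Cmod A * Cmod z)%R ->
  asummable (fun k => CpowZ z k * wfac p A D k).
Proof.
intros Hp HA Hz Hz1 HD.
apply (summable_le _ (maj p A z (Cmod D))).
- intros k. apply wfac_maj; lra.
- apply maj_summable; auto. apply Cmod_ge_0.
Qed.

Definition jacobi (p x : C) : C := tsum (gauss p x).

Lemma gauss_le_maj (p A z : C) (k : Z) :
  (0 < Cmod p < 1)%R -> A <> 0 -> z <> 0 ->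
  (Cmod (gauss p (A * z) k) <= maj p A z 0 k)%R.
Proof.
intros Hp HA Hz. unfold maj. rewrite Rmult_0_l, Qr_0, Rmult_1_r.
rewrite <- gauss_scal by (try assumption; apply nz_Cmod; lra).
rewrite <- (Rmult_1_r (Cmod (CpowZ z k * gauss p A k))) at 1.
apply Rmult_le_compat_l; [apply Cmod_ge_0|].
rewrite <- (Qr_0 (Cmod p)). apply Qr_le; [lra|]. split; [lra|apply Cmod_ge_0].
Qed.

Lemma gauss_summable (p x : C) :
  (0 < Cmod p < 1)%R -> x <> 0 -> asummable (gauss p x).
Proof.
intros Hp Hx.
(* With [gam = 0] the majorant only requires [x = A z] with [0 < |z| < 1]; the choice is
   [z = 1/2]. *)
assert (Hz : RtoC (1 / 2) <> 0) by (intros E; apply RtoC_inj in E; lra).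
assert (HA : x / RtoC (1 / 2) <> 0).
{ apply Cmult_neq_0; [exact Hx|]. intros E.
  assert (H := Cinv_r _ Hz). rewrite E in H. apply C1_nz. rewrite <- H. ring. }
apply (summable_le _ (maj p (x / RtoC (1 / 2)) (RtoC (1 / 2)) 0)).
- intros k. replace (gauss p x k) with (gauss p (x / RtoC (1 / 2) * RtoC (1 / 2)) k).
  + now apply gauss_le_maj.
  + f_equal. field. exact Hz.
- apply maj_summable; try assumption; try lra.
  + rewrite Cmod_R, Rabs_pos_eq; lra.
  + apply Rmult_lt_0_compat; now apply Cmod_nz.
Qed.

Lemma jacobi_has_sum (p x : C) :
  (0 < Cmod p < 1)%R -> x <> 0 -> has_sum (gauss p x) (jacobi p x).
Proof. intros Hp Hx. now apply tsum_correct, gauss_summable. Qed.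

(** Replacing [p^n] by [p^(n+1)] in the argument of the infinite product multiplies the sum by
    [1 - z p^n]. In the limit that product becomes 1 and only the theta series remains. *)
Lemma wfac_0_sum (p A z X : C) :
  (0 < Cmod p < 1)%R -> A <> 0 -> z <> 0 -> (Cmod z < 1)%R ->
  has_sum (fun k => CpowZ z k * wfac p A 0 k) X ->
  X * qpoch_inf z p = jacobi p (A * z).
Proof.
intros Hp HA Hz Hz1 HX. assert (Hpn : p <> 0) by (apply nz_Cmod; lra).
set (F := fun (n : nat) (k : Z) =>
  CpowZ z k * gauss p A k * qpoch_inf (p ^ n * (CpowZ p (1 - k) / A)) p).
assert (HF : forall n, has_sum (F n) (X * qpochN z p n)).
{ induction n as [|n IH].
  - cbn [qpochN]. rewrite Cmult_1_r. revert HX. apply has_sum_ext. intros k.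
    unfold F, wfac.
    replace (0 * CpowZ p k) with (RtoC 0) by ring. rewrite qinf_0.
    replace (p ^ 0 * (CpowZ p (1 - k) / A)) with (CpowZ p (1 - k) / A) by (simpl; ring). ring.
  - cbn [qpochN].
    replace (X * (qpochN z p n * (1 - z * p ^ n)))
      with (1 * (X * qpochN z p n) + (- (z * p ^ n)) * (X * qpochN z p n)) by ring.
    assert (H := has_sum_lin _ _ 1 (- (z * p ^ n)) _ _ IH (has_sum_shift _ _ (-1)%Z IH)).
    revert H. apply has_sum_ext. intros k. unfold F. cbv beta.
    replace (k + -1)%Z with (k - 1)%Z by lia.
    rewrite (qinf_step (p ^ n * (CpowZ p (1 - k) / A))) by apply Hp.
    replace (p ^ n * (CpowZ p (1 - k) / A) * p) with (p ^ S n * (CpowZ p (1 - k) / A))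
      by (simpl; ring).
    replace (p ^ n * (CpowZ p (1 - (k - 1)) / A)) with (p ^ S n * (CpowZ p (1 - k) / A)).
    2:{ replace (1 - (k - 1))%Z with (1 - k + 1)%Z by lia.
        rewrite (CpowZ_succ p (1 - k)) by exact Hpn. simpl. field. exact HA. }
    replace (gauss p A k) with (gauss p A (k - 1) * (- A * CpowZ p (k - 1))).
    2:{ rewrite <- gauss_succ by assumption. f_equal. lia. }
    rewrite (CpowZ_pred z) by exact Hz.
    replace (1 - k)%Z with (- (k - 1))%Z by lia.
    rewrite CpowZ_opp by exact Hpn.
    assert (Hk := CpowZ_nz p (k - 1) Hpn). field. repeat split; assumption. }
apply (Clim_unique (fun n => X * qpochN z p n)).
- apply Clim_mult; [apply Clim_const|apply qpochN_Clim, Hp].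
- apply (tannery F (gauss p (A * z)) (maj p A z 0)).
  + apply maj_summable; try assumption; try lra.
    apply Rmult_lt_0_compat; now apply Cmod_nz.
  + intros n k. unfold F.
    assert (H := Cmod_le_maj p A 0 z (p ^ n) 0 k (proj2 Hp)).
    replace (0 * CpowZ p k) with (RtoC 0) in H by ring. rewrite qinf_0, Cmult_1_r in H.
    apply H.
    * rewrite Cmod_pow, <- (pow1 n). apply pow_incr. lra.
    * rewrite Cmod_0. lra.
  + intros k. unfold F. rewrite <- gauss_scal by assumption.
    replace (CpowZ z k * gauss p A k) with (CpowZ z k * gauss p A k * 1) at 1 by ring.
    apply Clim_mult; [apply Clim_const|].
    apply (Clim_ext (fun n => qpoch_inf (CpowZ p (1 - k) / A * p ^ n) p)).
    * intros n. f_equal. ring.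
    * apply qinf_shift_Clim, Hp.
  + exact HF.
  + apply jacobi_has_sum; [exact Hp|now apply Cmult_neq_0].
Qed.

(* Ramanujan's 1psi1 sum.  With [a_k = z^k wfac A (pD) k] one has
   [(A - D) a_k = A f_k - (D/z) f_(k+1)] for [f_k = z^k wfac A D k], which
   relates the sums for [D] and [pD]; iterating reduces to [D = 0]. *)
Lemma wfac_sum_jacobi (p A D z X : C) :
  (0 < Cmod p < 1)%R -> A <> 0 -> z <> 0 ->
  (Cmod z < 1)%R -> (Cmod D < Cmod A * Cmod z)%R ->
  has_sum (fun k => CpowZ z k * wfac p A D k) X ->
  X * qpoch_inf z p * qpoch_inf (D / (A * z)) p
    = qpoch_inf (D / A) p * jacobi p (A * z).
Proof.
intros Hp HA Hz Hz1 HD HX. assert (Hpn : p <> 0) by (apply nz_Cmod; lra).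
set (F := fun (n : nat) (k : Z) => CpowZ z k * wfac p A (p ^ n * D) k).
assert (HDn : forall n, (Cmod (p ^ n * D) <= Cmod D)%R).
{ intros n. rewrite Cmod_mult, Cmod_pow. rewrite <- (Rmult_1_l (Cmod D)) at 2.
  apply Rmult_le_compat_r; [apply Cmod_ge_0|]. rewrite <- (pow1 n). apply pow_incr. lra. }
assert (HF : forall n, has_sum (F n) (tsum (F n))).
{ intros n. apply tsum_correct. apply wfac_summable; try assumption.
  eapply Rle_lt_trans; [apply HDn|exact HD]. }
assert (Hrec : forall n, tsum (F n) * (1 - D / (A * z) * p ^ n)
                         = (1 - D / A * p ^ n) * tsum (F (S n))).
{ intros n.
  assert (H1 := has_sum_lin _ _ 1 (- (D / (A * z) * p ^ n)) _ _ (HF n) (has_sum_shift _ _ 1 (HF n))).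
  assert (H2 := has_sum_scal _ (1 - D / A * p ^ n) _ (HF (S n))).
  replace (tsum (F n) * (1 - D / (A * z) * p ^ n))
    with (1 * tsum (F n) + (- (D / (A * z) * p ^ n)) * tsum (F n)) by ring.
  apply (has_sum_unique _ _ _ H1). revert H2. apply has_sum_ext. intros k. unfold F. cbv beta.
  rewrite (wfac_D p A (p ^ n * D) k), (wfac_succ p A (p ^ n * D) k) by (try assumption; lra).
  replace (p ^ S n * D) with (p * (p ^ n * D)) by (simpl; ring).
  rewrite CpowZ_succ by exact Hz. field. now split. }
assert (Hit : forall n, tsum (F 0%nat) * qpochN (D / (A * z)) p n
                        = qpochN (D / A) p n * tsum (F n)).
{ induction n as [|n IH]; cbn [qpochN]; [ring|].
  replace (tsum (F 0%nat) * (qpochN (D / (A * z)) p n * (1 - D / (A * z) * p ^ n)))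
    with ((tsum (F 0%nat) * qpochN (D / (A * z)) p n) * (1 - D / (A * z) * p ^ n)) by ring.
  rewrite IH. rewrite <- (Cmult_assoc (qpochN (D / A) p n)), Hrec. ring. }
assert (EX : X = tsum (F 0%nat)).
{ apply (has_sum_unique _ _ _ HX). apply (has_sum_ext (F 0%nat)); [|apply HF].
  intros k. unfold F. f_equal. f_equal. simpl. ring. }
set (G := fun k => CpowZ z k * wfac p A 0 k).
assert (HG : has_sum G (tsum G)).
{ apply tsum_correct, wfac_summable; try assumption. rewrite Cmod_0.
  apply Rmult_lt_0_compat; now apply Cmod_nz. }
assert (Hlim : Clim (fun n => tsum (F n)) (tsum G)).
{ apply (tannery F G (maj p A z (Cmod D))).
  - apply maj_summable; auto. apply Cmod_ge_0.
  - intros n k. unfold F. apply wfac_maj; [lra|apply HDn].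
  - intros k. unfold F, G, wfac.
    rewrite !Cmult_assoc. replace (0 * CpowZ p k) with (RtoC 0) by ring. rewrite qinf_0.
    apply (Clim_ext (fun n => CpowZ z k * (gauss p A k * qpoch_inf (CpowZ p (1 - k) / A) p)
                              * qpoch_inf (D * CpowZ p k * p ^ n) p)).
    + intros n. rewrite !Cmult_assoc. f_equal. f_equal. ring.
    + rewrite !Cmult_assoc. apply Clim_mult; [apply Clim_const|apply qinf_shift_Clim, Hp].
  - exact HF.
  - exact HG. }
assert (E : X * qpoch_inf (D / (A * z)) p = qpoch_inf (D / A) p * tsum G).
{ apply (Clim_unique (fun n => tsum (F 0%nat) * qpochN (D / (A * z)) p n)).
  - rewrite EX. apply Clim_mult; [apply Clim_const|apply qpochN_Clim, Hp].
  - apply (Clim_ext (fun n => qpochN (D / A) p n * tsum (F n))); [intros n; now rewrite Hit|].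
    apply Clim_mult; [apply qpochN_Clim, Hp|exact Hlim]. }
rewrite <- (wfac_0_sum p A z (tsum G) Hp HA Hz Hz1 HG).
replace (X * qpoch_inf z p * qpoch_inf (D / (A * z)) p)
  with (X * qpoch_inf (D / (A * z)) p * qpoch_inf z p) by ring.
rewrite E. ring.
Qed.

(** * Functional equations of theta and the triple product *)

Lemma theta_eq (z p : C) : theta z p = qpoch_inf z p * qpoch_inf (p / z) p.
Proof. unfold theta, qpochs_inf. simpl. ring. Qed.

Lemma theta_step (z p : C) :
  (Cmod p < 1)%R -> p <> 0 -> z <> 0 -> theta z p = - z * theta (p * z) p.
Proof.
intros Hp Hpn Hz. rewrite !theta_eq.
rewrite (qinf_step z) by exact Hp.
replace (p / (p * z)) with (/ z) by (field; now split).
rewrite (qinf_step (/ z)) by exact Hp.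
replace (/ z * p) with (p / z) by (field; exact Hz).
replace (z * p) with (p * z) by ring. field. exact Hz.
Qed.

Lemma theta_sym (z p : C) : p <> 0 -> z <> 0 -> theta (p / z) p = theta z p.
Proof.
intros Hpn Hz. rewrite !theta_eq. replace (p / (p / z)) with z; [ring|].
field. now split.
Qed.

Lemma theta_inv (z p : C) :
  (Cmod p < 1)%R -> p <> 0 -> z <> 0 -> theta (/ z) p = - theta z p / z.
Proof.
intros Hp Hpn Hz. rewrite (theta_step z) by assumption.
rewrite <- (theta_sym (p * z)) by (try assumption; now apply Cmult_neq_0).
replace (p / (p * z)) with (/ z) by (field; now split). field. exact Hz.
Qed.

Lemma jacobi_step (p x : C) :
  (0 < Cmod p < 1)%R -> x <> 0 -> jacobi p x = - x * jacobi p (p * x).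
Proof.
intros Hp Hx. assert (Hpn : p <> 0) by (apply nz_Cmod; lra).
assert (Hpx := Cmult_neq_0 _ _ Hpn Hx).
apply (has_sum_unique _ _ _ (has_sum_shift _ _ 1 (jacobi_has_sum p x Hp Hx))).
assert (H := has_sum_scal _ (- x) _ (jacobi_has_sum p (p * x) Hp Hpx)).
revert H. apply has_sum_ext. intros k. cbv beta.
rewrite gauss_succ by assumption.
replace (p * x) with (x * p) by ring.
rewrite <- gauss_scal by assumption. ring.
Qed.

Lemma qinf_zero (p : C) (m : nat) :
  (0 < Cmod p < 1)%R -> qpoch_inf (CpowZ p (- Z.of_nat m)) p = 0.
Proof.
intros Hp. assert (Hpn : p <> 0) by (apply nz_Cmod; lra).
rewrite (qpoch_inf_shift _ p (S m)) by apply Hp. cbn [qpochN].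
rewrite CpowZ_opp, CpowZ_of_nat by exact Hpn.
replace (1 - / p ^ m * p ^ m) with (RtoC 0); [ring|].
field. now apply Cpow_nz.
Qed.

Lemma Cmod_sq_lt (p : C) : (0 < Cmod p < 1)%R -> (Cmod (p ^ 2) < 1)%R.
Proof. intros Hp. rewrite Cmod_pow. simpl. nra. Qed.

(* The case [A = 1], [D = p^2] of the 1psi1 sum has only two nonzero terms. *)
Lemma jacobi_annulus (p z : C) :
  (0 < Cmod p < 1)%R -> (Cmod p ^ 2 < Cmod z < 1)%R ->
  jacobi p z = qpoch_inf p p * theta z p.
Proof.
intros Hp Hz. assert (Hpn : p <> 0) by (apply nz_Cmod; lra).
assert (Hz0 : z <> 0) by (apply nz_Cmod; assert (H := pow2_ge_0 (Cmod p)); lra).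
assert (HD : (Cmod (p ^ 2) < Cmod 1 * Cmod z)%R) by (rewrite Cmod_pow, Cmod_1; lra).
set (f := fun k => CpowZ z k * wfac p 1 (p ^ 2) k).
(* The product [(p^(1-k);p)_oo] vanishes for [k >= 1], and [(p^(k+2);p)_oo] for [k <= -2]. *)
assert (Hf : has_sum f (lsum f [0; -1]%Z)).
{ apply has_sum_fin.
  - repeat constructor; simpl; lia.
  - intros k Hk. simpl in Hk. unfold f, wfac.
    destruct (Z_le_gt_dec 1 k) as [H|H].
    + replace (CpowZ p (1 - k) / 1) with (CpowZ p (- Z.of_nat (Z.to_nat (k - 1)))).
      * rewrite qinf_zero by exact Hp. ring.
      * replace (- Z.of_nat (Z.to_nat (k - 1)))%Z with (1 - k)%Z by lia. field.
    + replace (p ^ 2 * CpowZ p k) with (CpowZ p (- Z.of_nat (Z.to_nat (- k - 2)))).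
      * rewrite qinf_zero by exact Hp. ring.
      * replace (- Z.of_nat (Z.to_nat (- k - 2)))%Z with (Z.of_nat 2 + k)%Z by lia.
        rewrite CpowZ_add, CpowZ_of_nat by exact Hpn. reflexivity. }
assert (H := wfac_sum_jacobi p 1 (p ^ 2) z _ Hp C1_nz Hz0 (proj2 Hz) HD Hf).
assert (E : lsum f [0; -1]%Z = qpoch_inf p p * qpoch_inf (p ^ 2) p * (1 - p / z)).
{ unfold lsum, f, wfac, gauss. simpl.
  replace (p * 1 / 1) with p by field.
  replace (p * (p * 1) / 1) with (p * (p * 1)) by field.
  replace (p * (p * 1) * 1) with (p * (p * 1)) by ring.
  replace (p * (p * 1) * / (p * 1)) with p by (field; exact Hpn).
  field. exact Hz0. }
rewrite E in H.
replace (p ^ 2 / (1 * z)) with (p / z * p) in H by (simpl; field; exact Hz0).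
replace (p ^ 2 / 1) with (p ^ 2) in H by field.
replace (1 * z) with z in H by ring.
assert (Hn : qpoch_inf (p ^ 2) p <> 0) by (apply qinf_nz; [lra|now apply Cmod_sq_lt]).
replace (jacobi p z) with (qpoch_inf (p ^ 2) p * jacobi p z / qpoch_inf (p ^ 2) p)
  by (field; exact Hn).
rewrite <- H, theta_eq, (qinf_step (p / z)) by lra. field. now split.
Qed.

(** Both sides satisfy [f(z) = - z f(p z)]. The annulus [|p|^2 < |z| < 1] is wider than a period, so
    the equation carries the identity inwards to [0 < |z| < 1] and then outwards to every nonzero
    [z]. *)
Lemma jacobi_triple (p z : C) :
  (0 < Cmod p < 1)%R -> z <> 0 -> jacobi p z = qpoch_inf p p * theta z p.
Proof.
intros Hp Hz. assert (Hpn : p <> 0) by (apply nz_Cmod; lra).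
set (P := fun z : C => jacobi p z = qpoch_inf p p * theta z p).
assert (Hdown : forall z : C, z <> 0 -> P (p * z) -> P z).
{ intros w Hw H. unfold P in *. rewrite jacobi_step, theta_step, H by (try assumption; lra). ring. }
assert (Hup : forall z : C, z <> 0 -> P z -> P (p * z)).
{ intros w Hw H. unfold P in *. rewrite jacobi_step, theta_step in H by (try assumption; lra).
  assert (Hw' := Copp_nz w Hw).
  replace (jacobi p (p * w)) with (- w * jacobi p (p * w) / - w) by (field; exact Hw).
  rewrite H. field. exact Hw. }
assert (H1 : forall (n : nat) (z : C), (Cmod p ^ (n + 2) < Cmod z < 1)%R -> P z).
{ induction n as [|n IH]; intros w Hw.
  - apply jacobi_annulus; [exact Hp|exact Hw].
  - assert (Hw0 : w <> 0).
    { apply nz_Cmod. assert (H := pow_le (Cmod p) (S n + 2) ltac:(lra)). lra. }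
    destruct (Rlt_le_dec (Cmod p ^ 2) (Cmod w)) as [H|H].
    + apply jacobi_annulus; [exact Hp|lra].
    + replace w with (p * (w / p)) by (field; exact Hpn).
      apply Hup.
      * apply Cmult_neq_0; [exact Hw0|]. intros E. apply C1_nz.
        rewrite <- (Cinv_r p Hpn), E. ring.
      * apply IH. rewrite Cmod_div by exact Hpn.
        destruct Hw as [Hw1 Hw2]. simpl in Hw1, H.
        assert (Hi : (0 < / Cmod p)%R) by (apply Rinv_0_lt_compat; lra).
        split.
        -- apply Rmult_lt_reg_r with (Cmod p); [lra|].
           unfold Rdiv. rewrite Rmult_assoc, Rinv_l by lra. lra.
        -- apply Rmult_lt_reg_r with (Cmod p); [lra|].
           unfold Rdiv. rewrite Rmult_assoc, Rinv_l by lra. nra. }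
assert (H2 : forall z : C, z <> 0 -> (Cmod z < 1)%R -> P z).
{ intros w Hw Hw1. apply Cmod_nz in Hw.
  destruct (pow_lt_1_zero (Cmod p)) with (y := Cmod w) as [N HN].
  - rewrite Rabs_pos_eq; lra.
  - exact Hw.
  - apply (H1 N). split; [|exact Hw1].
    specialize (HN (N + 2)%nat ltac:(lia)).
    rewrite Rabs_pos_eq in HN by (apply pow_le; lra). exact HN. }
assert (H3 : forall (n : nat) (z : C), z <> 0 -> (Cmod z * Cmod p ^ n < 1)%R -> P z).
{ induction n as [|n IH]; intros w Hw H.
  - apply H2; [exact Hw|]. simpl in H. lra.
  - apply Hdown; [exact Hw|]. apply IH; [now apply Cmult_neq_0|].
    rewrite Cmod_mult. simpl in H. lra. }
apply Cmod_nz in Hz as Hz'.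
destruct (pow_lt_1_zero (Cmod p)) with (y := (/ Cmod z)%R) as [N HN].
- rewrite Rabs_pos_eq; lra.
- now apply Rinv_0_lt_compat.
- apply (H3 N); [exact Hz|]. specialize (HN N (le_n N)).
  rewrite Rabs_pos_eq in HN by (apply pow_le; lra).
  apply (Rmult_lt_compat_l (Cmod z)) in HN; [|exact Hz'].
  rewrite Rinv_r in HN; lra.
Qed.

(** The convergence conditions [|z| < 1] and [|D/(A z)| < 1] also make both denominators nonzero, so
    the 1psi1 sum can be solved for its value. *)
Lemma wfac_has_sum (p A D z : C) :
  (0 < Cmod p < 1)%R -> A <> 0 -> z <> 0 ->
  (Cmod z < 1)%R -> (Cmod D < Cmod A * Cmod z)%R ->
  has_sum (fun k => CpowZ z k * wfac p A D k)
    (qpoch_inf p p * qpoch_inf (D / A) p * theta (A * z) p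
     / (qpoch_inf z p * qpoch_inf (D / (A * z)) p)).
Proof.
intros Hp HA Hz Hz1 HD. assert (HAz := Cmult_neq_0 _ _ HA Hz).
assert (HS := tsum_correct _ (wfac_summable p A D z Hp HA Hz Hz1 HD)).
assert (H := wfac_sum_jacobi p A D z _ Hp HA Hz Hz1 HD HS).
rewrite jacobi_triple in H by assumption.
assert (N1 : qpoch_inf z p <> 0) by (apply qinf_nz; lra).
assert (N2 : qpoch_inf (D / (A * z)) p <> 0).
{ apply qinf_nz; [lra|]. rewrite Cmod_div, Cmod_mult by exact HAz.
  assert (Hpos : (0 < Cmod A * Cmod z)%R) by (apply Rmult_lt_0_compat; now apply Cmod_nz).
  apply Rmult_lt_reg_r with (Cmod A * Cmod z)%R; [exact Hpos|].
  unfold Rdiv. rewrite Rmult_assoc, Rinv_l; lra. }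
replace (qpoch_inf p p * qpoch_inf (D / A) p * theta (A * z) p
     / (qpoch_inf z p * qpoch_inf (D / (A * z)) p))
  with (tsum (fun k => CpowZ z k * wfac p A D k)); [exact HS|].
set (X := tsum _) in *. set (a := qpoch_inf z p) in *. set (b := qpoch_inf (D / (A * z)) p) in *.
replace (qpoch_inf p p * qpoch_inf (D / A) p * theta (A * z) p / (a * b))
  with (qpoch_inf (D / A) p * (qpoch_inf p p * theta (A * z) p) / (a * b))
  by (field; now split).
rewrite <- H. field. now split.
Qed.

(** * Constant terms of Laurent series *)

Definition cis (t : R) : C := (cos t, sin t).

Lemma cis_add (s t : R) : cis (s + t) = cis s * cis t.
Proof.
unfold cis. rewrite cos_plus, sin_plus. apply injective_projections; simpl; ring.
Qed.

Lemma cis_pow (t : R) (n : nat) : cis t ^ n = cis (INR n * t).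
Proof.
induction n as [|n IH].
- simpl. unfold cis. rewrite Rmult_0_l, cos_0, sin_0. reflexivity.
- rewrite Cpow_S, IH, <- cis_add. f_equal. rewrite S_INR. ring.
Qed.

Lemma Cmod_cis (t : R) : Cmod (cis t) = 1%R.
Proof.
unfold Cmod, cis. cbn [fst snd].
replace (cos t ^ 2 + sin t ^ 2)%R with (Rsqr (sin t) + Rsqr (cos t))%R
  by (unfold Rsqr; ring).
now rewrite sin2_cos2, sqrt_1.
Qed.

Lemma cis_pow_m1 (n : nat) : cis (PI / 2 ^ n) ^ (2 ^ n) = - (1).
Proof.
rewrite cis_pow, pow_INR. replace (INR 2) with 2%R by (simpl; ring).
replace (2 ^ n * (PI / 2 ^ n))%R with PI by (field; apply pow_nonzero; lra).
unfold cis. rewrite cos_PI, sin_PI. apply injective_projections; simpl; ring.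
Qed.

Lemma CpowZ_1 (k : Z) : CpowZ 1 k = 1.
Proof.
revert k. apply Z_bi_ind; [reflexivity|]. intros k.
rewrite CpowZ_succ by exact C1_nz. now rewrite Cmult_1_r.
Qed.

Lemma CpowZ_m1_even (m : Z) : CpowZ (- (1)) (2 * m) = 1.
Proof.
change 2%Z with (Z.of_nat 2). rewrite <- CpowZ_mult_r by apply Copp_nz, C1_nz.
replace ((- (1)) ^ 2) with (RtoC 1) by (simpl; ring). apply CpowZ_1.
Qed.

Lemma CpowZ_m1_odd (m : Z) : CpowZ (- (1)) (2 * m + 1) = - (1).
Proof. rewrite CpowZ_succ, CpowZ_m1_even by apply Copp_nz, C1_nz. ring. Qed.

(** The mean of [Phi] over the points [w zeta] with [zeta^(2^n) = 1]: adjoining [e^(i pi / 2^m)]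
    doubles the group of roots of unity. It stands in for a contour integral. *)
Fixpoint dyadic_mean (Phi : C -> C) (n : nat) (w : C) : C :=
  match n with
  | O => Phi w
  | S m => RtoC (1 / 2) * dyadic_mean Phi m w
           + RtoC (1 / 2) * dyadic_mean Phi m (w * cis (PI / 2 ^ m))
  end.

Lemma Chalf : RtoC (1 / 2) + RtoC (1 / 2) = 1.
Proof. rewrite <- RtoC_plus. f_equal. lra. Qed.

(* Averaging over [w] and [w e^(i pi / 2^n)] keeps exactly the terms whose
   degree is divisible by [2^(n+1)] among those divisible by [2^n]. *)
Lemma dyadic_mean_sum {I : Type} (g : I -> C) (d : I -> Z) (Phi : C -> C) :
  (forall w : C, Cmod w = 1%R -> has_sum (fun i => g i * CpowZ w (d i)) (Phi w)) ->
  forall (n : nat) (w : C), Cmod w = 1%R ->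
  has_sum (fun i => (if Z.eqb (d i mod 2 ^ Z.of_nat n) 0 then g i else 0) * CpowZ w (d i))
    (dyadic_mean Phi n w).
Proof.
intros H. induction n as [|n IH]; intros w Hw.
- generalize (H w Hw). apply has_sum_ext. intros i.
  change (2 ^ Z.of_nat 0)%Z with 1%Z. now rewrite Z.mod_1_r.
- set (s := cis (PI / 2 ^ n)).
  assert (Hws : Cmod (w * s) = 1%R).
  { rewrite Cmod_mult, Hw. unfold s. rewrite Cmod_cis. ring. }
  assert (Hw0 : w <> 0) by (apply nz_Cmod; lra).
  assert (Hs0 : s <> 0) by (apply nz_Cmod; unfold s; rewrite Cmod_cis; lra).
  cbn [dyadic_mean]. fold s.
  generalize (has_sum_lin _ _ (RtoC (1 / 2)) (RtoC (1 / 2)) _ _ (IH w Hw) (IH (w * s) Hws)).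
  apply has_sum_ext. intros i. cbv beta.
  rewrite CpowZ_mult_l by assumption.
  assert (Hpow : (0 < 2 ^ Z.of_nat n)%Z) by (apply Z.pow_pos_nonneg; lia).
  replace (2 ^ Z.of_nat (S n))%Z with (2 ^ Z.of_nat n * 2)%Z
    by (rewrite Nat2Z.inj_succ, Z.pow_succ_r by lia; ring).
  destruct (Z.eqb_spec (d i mod 2 ^ Z.of_nat n) 0) as [E|E].
  + apply Z.mod_divide in E; [|lia]. destruct E as [m Em].
    assert (Es : CpowZ s (d i) = CpowZ (- (1)) m).
    { rewrite Em. rewrite <- (cis_pow_m1 n). fold s.
      rewrite CpowZ_mult_r by exact Hs0. f_equal.
      rewrite Nat2Z.inj_pow. change (Z.of_nat 2) with 2%Z. ring. }
    rewrite Es.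
    destruct (Z.Even_or_Odd m) as [[j Ej]|[j Ej]].
    * rewrite Ej, CpowZ_m1_even.
      replace (d i mod (2 ^ Z.of_nat n * 2))%Z with 0%Z.
      -- simpl. rewrite Cmult_1_r, <- Cmult_plus_distr_r, Chalf. ring.
      -- symmetry. apply Z.mod_divide; [lia|]. exists j. rewrite Em, Ej. ring.
    * rewrite Ej, CpowZ_m1_odd.
      destruct (Z.eqb_spec (d i mod (2 ^ Z.of_nat n * 2)) 0) as [E2|E2]; [|ring].
      exfalso. apply Z.mod_divide in E2; [|lia]. destruct E2 as [j' Ej'].
      rewrite Em, Ej in Ej'.
      assert (Ec : (2 * j + 1 = 2 * j')%Z); [|lia].
      apply (Z.mul_reg_r _ _ (2 ^ Z.of_nat n)); [lia|]. rewrite Ej'. ring.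
  + destruct (Z.eqb_spec (d i mod (2 ^ Z.of_nat n * 2)) 0) as [E2|E2]; [|ring].
    exfalso. apply E. apply Z.mod_divide in E2; [|lia]. destruct E2 as [j' Ej'].
    apply Z.mod_divide; [lia|]. exists (j' * 2)%Z. rewrite Ej'. ring.
Qed.

(** A term of nonzero degree survives the [n]-th mean only if [2^n] divides its degree, hence for
    finitely many [n]; dominated convergence does the rest. *)
Lemma const_term_Clim {I : Type} (g : I -> C) (d : I -> Z) (Phi : C -> C) (S : C) :
  asummable g ->
  (forall w : C, Cmod w = 1%R -> has_sum (fun i => g i * CpowZ w (d i)) (Phi w)) ->
  has_sum (fun i => if Z.eqb (d i) 0 then g i else 0) S ->
  Clim (fun n => dyadic_mean Phi n 1) S.
Proof.
intros Hg HPhi HS.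
apply (tannery
  (fun n i => if Z.eqb (d i mod 2 ^ Z.of_nat n) 0 then g i else 0)
  (fun i => if Z.eqb (d i) 0 then g i else 0) (fun i => Cmod (g i))).
- exact Hg.
- intros n i. destruct (Z.eqb _ 0); [lra|]. rewrite Cmod_0. apply Cmod_ge_0.
- intros i. destruct (Z.eqb_spec (d i) 0) as [E|E].
  + apply (Clim_ext (fun _ => g i)); [|apply Clim_const].
    intros n. now rewrite E, Zmod_0_l.
  + intros eps He. exists (Z.abs_nat (d i)). intros n Hn.
    destruct (Z.eqb_spec (d i mod 2 ^ Z.of_nat n) 0) as [E2|E2].
    * exfalso. assert (Hb : (Z.of_nat n < 2 ^ Z.of_nat n)%Z) by (apply Z.pow_gt_lin_r; lia).
      apply Z.mod_divide in E2; [|lia]. apply Z.divide_abs_r, Z.divide_pos_le in E2; lia.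
    * replace (0 - 0) with (RtoC 0) by ring. now rewrite Cmod_0.
- intros n.
  generalize (dyadic_mean_sum g d Phi HPhi n 1 Cmod_1). apply has_sum_ext.
  intros i. rewrite CpowZ_1. ring.
- exact HS.
Qed.

Lemma has_sum_diag (g : Z * Z -> C) (S : C) :
  has_sum (fun k => g (k, k)) S ->
  has_sum (fun x => if Z.eqb (fst x - snd x) 0 then g x else 0) S.
Proof.
intros H. apply (has_sum_inj (fun k : Z => (k, k))).
- intros j j' E. congruence.
- intros [k l] Hkl. simpl. destruct (Z.eqb_spec (k - l) 0); [|reflexivity].
  exfalso. apply (Hkl k). f_equal. lia.
- revert H. apply has_sum_ext. intros k. simpl. now rewrite Z.sub_diag.
Qed.

(** Equality of the two products on one circle makes their dyadic means equal, and each sequence of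
    means tends to a constant term. In a series in [z] times one in [s/z] this is the diagonal,
    where the powers of [z] cancel to [s^k]. *)
Lemma laurent_const_term (c1 c2 c3 c4 : Z -> C) (F1 F2 F3 F4 : C -> C) (rho s t S T : C) :
  rho <> 0 -> s <> 0 -> t <> 0 ->
  (forall z, Cmod z = Cmod rho -> asummable (fun k => CpowZ z k * c1 k) /\
     has_sum (fun k => CpowZ z k * c1 k) (F1 z)) ->
  (forall z, Cmod z = Cmod rho -> asummable (fun k => CpowZ (s / z) k * c2 k) /\
     has_sum (fun k => CpowZ (s / z) k * c2 k) (F2 (s / z))) ->
  (forall z, Cmod z = Cmod rho -> asummable (fun k => CpowZ z k * c3 k) /\
     has_sum (fun k => CpowZ z k * c3 k) (F3 z)) ->
  (forall z, Cmod z = Cmod rho -> asummable (fun k => CpowZ (t / z) k * c4 k) /\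
     has_sum (fun k => CpowZ (t / z) k * c4 k) (F4 (t / z))) ->
  (forall z, Cmod z = Cmod rho -> F1 z * F2 (s / z) = F3 z * F4 (t / z)) ->
  has_sum (fun k => CpowZ s k * (c1 k * c2 k)) S ->
  has_sum (fun k => CpowZ t k * (c3 k * c4 k)) T -> S = T.
Proof.
intros Hr Hs Ht H1 H2 H3 H4 HF HS HT.
assert (Hgen : forall (c c' : Z -> C) (F F' : C -> C) (v U : C), v <> 0 ->
  (forall z, Cmod z = Cmod rho -> asummable (fun k => CpowZ z k * c k) /\
     has_sum (fun k => CpowZ z k * c k) (F z)) ->
  (forall z, Cmod z = Cmod rho -> asummable (fun k => CpowZ (v / z) k * c' k) /\
     has_sum (fun k => CpowZ (v / z) k * c' k) (F' (v / z))) ->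
  has_sum (fun k => CpowZ v k * (c k * c' k)) U ->
  Clim (fun n => dyadic_mean (fun w => F (rho * w) * F' (v / (rho * w))) n 1) U).
{ clear - Hr. intros c c' F F' v U Hv Hc Hc' HU.
  (* With [z = rho w] one has [v / z = (v / rho) / w], so the pair [(k, l)] has degree [k - l] in
     [w]. *)
  set (g := fun x : Z * Z => (CpowZ rho (fst x) * c (fst x)) * (CpowZ (v / rho) (snd x) * c' (snd x))).
  assert (Hvr : v / rho <> 0).
  { apply Cmult_neq_0; [exact Hv|]. intros E. apply C1_nz. rewrite <- (Cinv_r rho Hr), E. ring. }
  apply (const_term_Clim g (fun x => (fst x - snd x)%Z)).
  - apply (asummable_prod (fun k => CpowZ rho k * c k) (fun k => CpowZ (v / rho) k * c' k));
      [now apply Hc|now apply Hc'].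
  - intros w Hw. assert (Hw0 : w <> 0) by (apply nz_Cmod; lra).
    assert (Hrw : Cmod (rho * w) = Cmod rho) by (rewrite Cmod_mult, Hw; ring).
    destruct (Hc _ Hrw) as [A1 S1]. destruct (Hc' _ Hrw) as [A2 S2].
    generalize (has_sum_prod _ _ _ _ A1 A2 S1 S2). apply has_sum_ext.
    intros [k l]. unfold g. simpl.
    rewrite CpowZ_sub by exact Hw0.
    replace (v / rho) with (v / (rho * w) * w) by (field; now split).
    rewrite !CpowZ_mult_l; try assumption.
    + field. now apply CpowZ_nz.
    + replace (v / (rho * w)) with (v / rho * / w) by (field; now split).
      apply Cmult_neq_0; [exact Hvr|]. intros E. apply C1_nz. rewrite <- (Cinv_r w Hw0), E. ring.
  - apply has_sum_diag. revert HU. apply has_sum_ext. intros k. unfold g. simpl.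
    replace v with (rho * (v / rho)) at 1 by (field; exact Hr).
    rewrite CpowZ_mult_l by assumption. ring. }
apply (Clim_unique (fun n => dyadic_mean (fun w => F1 (rho * w) * F2 (s / (rho * w))) n 1)).
- now apply (Hgen c1 c2).
- apply (Clim_ext (fun n => dyadic_mean (fun w => F3 (rho * w) * F4 (t / (rho * w))) n 1)).
  + assert (Hd : forall n w, Cmod w = 1%R ->
      dyadic_mean (fun w => F3 (rho * w) * F4 (t / (rho * w))) n w
      = dyadic_mean (fun w => F1 (rho * w) * F2 (s / (rho * w))) n w).
    { induction n as [|n IH]; intros w Hw; cbn [dyadic_mean].
      - symmetry. apply HF. rewrite Cmod_mult, Hw. ring.
      - rewrite !IH; [reflexivity| |exact Hw]. rewrite Cmod_mult, Hw, Cmod_cis. ring. }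
    intros n. apply Hd, Cmod_1.
  + now apply (Hgen c3 c4).
Qed.

Lemma Cdiv_nz (x y : C) : x <> 0 -> y <> 0 -> x / y <> 0.
Proof.
intros Hx Hy. apply Cmult_neq_0; [exact Hx|]. intros E. apply C1_nz.
rewrite <- (Cinv_r y Hy), E. ring.
Qed.

(* Both sides are the constant term in [z] of the same function, factored in two
   ways into a product of 1psi1 sums, one in [z] and one in [q/z] or [q^2/z]. *)
Lemma bailey_transform (q u v T W : C) :
  (0 < Cmod q < 1)%R -> u <> 0 -> v <> 0 ->
  has_sum (fun k => CpowZ q k *
    (wfac (q ^ 3) u (q ^ 2 * u) k * wfac (q ^ 3) v (q ^ 2 * v) k)) T ->
  has_sum (fun k => CpowZ (q ^ 2) k *
    (wfac (q ^ 3) u (q * u) k * wfac (q ^ 3) (v / q) (q ^ 3 * (v / q)) k)) W ->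
  T * (qpoch_inf q (q ^ 3) * qpoch_inf (q ^ 3) (q ^ 3))
  = qpoch_inf (q ^ 2) (q ^ 3) ^ 2 * W.
Proof.
intros Hq Hu Hv HT HW.
assert (Hq0 : q <> 0) by (apply nz_Cmod; lra).
set (p := q ^ 3) in *.
assert (Hp : (0 < Cmod p < 1)%R).
{ unfold p. rewrite Cmod_pow. split; [apply pow_lt; lra|]. simpl. nra. }
assert (Hp0 : p <> 0) by (apply nz_Cmod; lra).
assert (Hq2 : (Cmod (q ^ 2) < 1)%R) by now apply Cmod_sq_lt.
assert (N1 : qpoch_inf q p <> 0) by (apply qinf_nz; lra).
assert (N2 : qpoch_inf (q ^ 2) p <> 0) by (apply qinf_nz; lra).
assert (N3 : qpoch_inf p p <> 0) by (apply qinf_nz; lra).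
(* All four 1psi1 sums converge in the annulus [|q| < |z| < 1]; the circle runs through its
   middle. *)
set (rho := RtoC ((1 + Cmod q) / 2)).
assert (Er : Cmod rho = ((1 + Cmod q) / 2)%R) by (unfold rho; rewrite Cmod_R, Rabs_pos_eq; lra).
set (cst := qpoch_inf (q ^ 2) p ^ 2 / (qpoch_inf q p * qpoch_inf p p)).
assert (Hv' := Cdiv_nz v q Hv Hq0).
assert (Haux : forall A D z c : C, A <> 0 -> z <> 0 -> (Cmod z < 1)%R ->
  D = c * A -> (Cmod c < Cmod z)%R ->
  asummable (fun k => CpowZ z k * wfac p A D k) /\
  has_sum (fun k => CpowZ z k * wfac p A D k)
    (qpoch_inf p p * qpoch_inf c p * theta (A * z) p / (qpoch_inf z p * qpoch_inf (c / z) p))).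
{ intros A D z c HA Hz Hz1 -> Hc.
  assert (HD : (Cmod (c * A) < Cmod A * Cmod z)%R).
  { rewrite Cmod_mult, Rmult_comm. apply Rmult_lt_compat_l; [now apply Cmod_nz|exact Hc]. }
  split; [now apply wfac_summable|].
  replace (c / z) with (c * A / (A * z)) by (field; now split).
  replace (qpoch_inf c p) with (qpoch_inf (c * A / A) p) by (f_equal; field; exact HA).
  now apply wfac_has_sum. }
assert (Hzf : forall z : C, Cmod z = Cmod rho -> z <> 0 /\ (Cmod q < Cmod z < 1)%R).
{ intros z E. rewrite Er in E. split; [apply nz_Cmod|]; lra. }
assert (E : T = cst * W).
{ apply (laurent_const_term
    (wfac p u (q ^ 2 * u)) (wfac p v (q ^ 2 * v))
    (fun k => cst * wfac p u (q * u) k) (wfac p (v / q) (p * (v / q)))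
    (fun z => qpoch_inf p p * qpoch_inf (q ^ 2) p * theta (u * z) p / (qpoch_inf z p * qpoch_inf (q ^ 2 / z) p))
    (fun z => qpoch_inf p p * qpoch_inf (q ^ 2) p * theta (v * z) p / (qpoch_inf z p * qpoch_inf (q ^ 2 / z) p))
    (fun z => cst * (qpoch_inf p p * qpoch_inf q p * theta (u * z) p / (qpoch_inf z p * qpoch_inf (q / z) p)))
    (fun z => qpoch_inf p p * qpoch_inf p p * theta (v / q * z) p / (qpoch_inf z p * qpoch_inf (p / z) p))
    rho q (q ^ 2)).
  - apply nz_Cmod. lra.
  - exact Hq0.
  - now apply Cpow_nz.
  - intros z Ez. destruct (Hzf z Ez) as [Hz Hz1]. apply Haux; try assumption; try tauto.
    rewrite Cmod_pow. simpl. nra.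
  - intros z Ez. destruct (Hzf z Ez) as [Hz Hz1].
    assert (Hb : (Cmod (q / z) < 1)%R).
    { rewrite Cmod_div by exact Hz. apply Rmult_lt_reg_r with (Cmod z); [lra|].
      unfold Rdiv. rewrite Rmult_assoc, Rinv_l; lra. }
    apply Haux; try assumption; try reflexivity.
    + now apply Cdiv_nz.
    + rewrite Cmod_div by exact Hz. rewrite Cmod_pow.
      apply Rmult_lt_reg_r with (Cmod z); [lra|].
      unfold Rdiv. rewrite Rmult_assoc, Rinv_l by lra. simpl. nra.
  - intros z Ez. destruct (Hzf z Ez) as [Hz Hz1].
    destruct (Haux u (q * u) z q Hu Hz (proj2 Hz1) eq_refl (proj1 Hz1)) as [H1 H2].
    split.
    + generalize (asummable_scal _ cst H1). apply asummable_ext. intros k. ring.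
    + generalize (has_sum_scal _ cst _ H2). apply has_sum_ext. intros k. ring.
  - intros z Ez. destruct (Hzf z Ez) as [Hz Hz1].
    assert (Hb : (Cmod (q ^ 2 / z) < 1)%R).
    { rewrite Cmod_div by exact Hz. rewrite Cmod_pow. apply Rmult_lt_reg_r with (Cmod z); [lra|].
      unfold Rdiv. rewrite Rmult_assoc, Rinv_l by lra. simpl. nra. }
    apply Haux; try assumption; try reflexivity.
    + apply Cdiv_nz; [now apply Cpow_nz|exact Hz].
    + rewrite Cmod_div by exact Hz. unfold p. rewrite !Cmod_pow.
      apply Rmult_lt_reg_r with (Cmod z); [lra|].
      unfold Rdiv. rewrite Rmult_assoc, Rinv_l by lra. simpl.
      assert (H2 : (0 < Cmod q * Cmod q)%R) by nra.
      assert (H3 : (Cmod q * Cmod z < 1)%R) by nra.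
      apply (Rmult_lt_compat_l _ _ _ H2) in H3. lra.
  - intros z Ez. destruct (Hzf z Ez) as [Hz Hz1].
    (* The theta numerators agree because [v (q/z) = (v/q) (q^2/z)]; this is the origin of the
       parameter [v/q]. *)
    replace (q ^ 2 / (q / z)) with (q * z) by (simpl; field; now split).
    replace (p / (q ^ 2 / z)) with (q * z) by (unfold p; simpl; field; now split).
    replace (v * (q / z)) with (v / q * (q ^ 2 / z)) by (simpl; field; now split).
    assert (M1 : qpoch_inf z p <> 0) by (apply qinf_nz; lra).
    assert (M2 : qpoch_inf (q / z) p <> 0).
    { apply qinf_nz; [lra|]. rewrite Cmod_div by exact Hz. apply Rmult_lt_reg_r with (Cmod z); [lra|].
      unfold Rdiv. rewrite Rmult_assoc, Rinv_l; lra. }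
    assert (M3 : qpoch_inf (q ^ 2 / z) p <> 0).
    { apply qinf_nz; [lra|]. rewrite Cmod_div by exact Hz. rewrite Cmod_pow.
      apply Rmult_lt_reg_r with (Cmod z); [lra|].
      unfold Rdiv. rewrite Rmult_assoc, Rinv_l by lra. simpl. nra. }
    assert (M4 : qpoch_inf (q * z) p <> 0).
    { apply qinf_nz; [lra|]. rewrite Cmod_mult.
      apply Rle_lt_trans with (Cmod q * 1)%R; [apply Rmult_le_compat_l|]; lra. }
    unfold cst. field. repeat split; assumption.
  - exact HT.
  - generalize (has_sum_scal _ cst _ HW). apply has_sum_ext. intros k. ring. }
rewrite E. unfold cst. field. now split.
Qed.

(** * The shifted sums *)

Lemma theta_gauss (p A : C) (k : Z) :
  (Cmod p < 1)%R -> p <> 0 -> A <> 0 ->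
  gauss p A k * theta (A * CpowZ p k) p = theta A p.
Proof.
intros Hp Hp0 HA. revert k. apply Z_bi_ind.
- rewrite gauss_0. simpl. replace (A * 1) with A by ring. ring.
- intros k. rewrite gauss_succ, CpowZ_succ by assumption.
  assert (Hk := CpowZ_nz p k Hp0).
  rewrite (theta_step (A * CpowZ p k)) by (try assumption; now apply Cmult_neq_0).
  replace (p * (A * CpowZ p k)) with (A * (CpowZ p k * p)) by ring.
  split; intros H; rewrite <- H; ring.
Qed.

(** For [D = A] the two infinite products form [theta(A p^k;p)], and quasi-periodicity removes [k].
    Thus for [D = p A] the factor is [theta(A;p) / (1 - A p^k)], in a form that survives
    [A p^k = 1]. *)
Lemma wfac_kronecker (p A : C) (k : Z) :
  (Cmod p < 1)%R -> p <> 0 -> A <> 0 ->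
  (1 - A * CpowZ p k) * wfac p A (p * A) k = theta A p.
Proof.
intros Hp Hp0 HA. rewrite <- wfac_D by exact Hp.
rewrite <- (theta_gauss p A k) by assumption. unfold wfac. rewrite theta_eq.
assert (Hk := CpowZ_nz p k Hp0).
replace (p / (A * CpowZ p k)) with (CpowZ p (1 - k) / A).
- ring.
- rewrite CpowZ_sub by exact Hp0. simpl. field. now split.
Qed.

Lemma wfac_0_add (p A : C) (k : Z) (n : nat) :
  (Cmod p < 1)%R -> p <> 0 -> A <> 0 ->
  wfac p A 0 (k + Z.of_nat n) = wfac p A 0 k * qpochN (A * CpowZ p k) p n.
Proof.
intros Hp Hp0 HA. induction n as [|n IH].
- rewrite Z.add_0_r. simpl. ring.
- replace (k + Z.of_nat (S n))%Z with (k + Z.of_nat n + 1)%Z by lia.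
  rewrite wfac_succ by assumption. replace (p * 0) with (RtoC 0) by ring.
  rewrite IH, CpowZ_add, CpowZ_of_nat by exact Hp0. cbn [qpochN]. ring.
Qed.

Lemma wfac_0_0 (p A : C) : A <> 0 -> wfac p A 0 0 = qpoch_inf (p / A) p.
Proof.
intros HA. unfold wfac. rewrite gauss_0. simpl.
replace (0 * 1) with (RtoC 0) by ring. rewrite qinf_0.
replace (p * 1 / A) with (p / A) by (field; exact HA). ring.
Qed.

Lemma wfac_split (p A D : C) (k : Z) :
  wfac p A D k = wfac p A 0 k * qpoch_inf (D * CpowZ p k) p.
Proof.
unfold wfac. replace (0 * CpowZ p k) with (RtoC 0) by ring. rewrite qinf_0. ring.
Qed.

Lemma wfac_Clim (p A D : C) (k : Z) :
  (0 < Cmod p < 1)%R -> A <> 0 ->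
  Clim (fun n => wfac p A D (k + Z.of_nat n)) (theta A p).
Proof.
intros Hp HA. assert (Hp0 : p <> 0) by (apply nz_Cmod; lra).
assert (H : Clim (fun n => wfac p A D (Z.of_nat n)) (theta A p)).
{ apply (Clim_ext (fun n => qpoch_inf (p / A) p * qpochN A p n * qpoch_inf (D * p ^ n) p)).
  - intros n. rewrite wfac_split, CpowZ_of_nat.
    replace (Z.of_nat n) with (0 + Z.of_nat n)%Z by lia.
    rewrite wfac_0_add, wfac_0_0 by (try assumption; lra). simpl.
    replace (A * 1) with A by ring. reflexivity.
  - rewrite theta_eq.
    replace (qpoch_inf A p * qpoch_inf (p / A) p)
      with (qpoch_inf (p / A) p * qpoch_inf A p * 1) by ring.
    apply Clim_mult; [apply Clim_mult; [apply Clim_const|apply qpochN_Clim, Hp]|].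
    apply qinf_shift_Clim, Hp. }
intros eps He. destruct (H eps He) as [N HN].
exists (N + Z.abs_nat k)%nat. intros n Hn.
replace (k + Z.of_nat n)%Z with (Z.of_nat (Z.to_nat (k + Z.of_nat n))) by lia.
apply HN. lia.
Qed.

Lemma Clim_bounded (u : nat -> C) (l : C) :
  Clim u l -> exists M : R, forall n, (Cmod (u n) <= M)%R.
Proof.
intros H. destruct (H 1%R ltac:(lra)) as [N HN].
assert (Hfin : forall m, exists M : R, forall n, (n < m)%nat -> (Cmod (u n) <= M)%R).
{ induction m as [|m [M HM]]; [exists 0%R; lia|].
  exists (Rmax M (Cmod (u m))). intros n Hn.
  destruct (Nat.eq_dec n m) as [->|]; [apply Rmax_r|].
  eapply Rle_trans; [apply HM; lia|apply Rmax_l]. }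
destruct (Hfin N) as [M HM]. exists (Rmax M (Cmod l + 1)). intros n.
destruct (Nat.lt_ge_cases n N) as [Hn|Hn].
- eapply Rle_trans; [now apply HM|apply Rmax_l].
- eapply Rle_trans; [|apply Rmax_r]. specialize (HN n Hn).
  replace (u n) with ((u n - l) + l) by ring.
  eapply Rle_trans; [apply Cmod_triangle|]. lra.
Qed.

Lemma asummable_bounded {I} (f : I -> C) :
  asummable f -> exists M : R, forall i, (Cmod (f i) <= M)%R.
Proof.
intros [M HM]. exists M. intros i.
assert (H := HM [i] ltac:(repeat constructor; easy)). unfold lsumR in H. simpl in H. lra.
Qed.

(** At [+oo] the factor converges. At [-oo] it is bounded because [z^k] times it is summable for
    some [|c| < |z| < 1], and [|z|^k >= 1] there. *)
Lemma wfac_bounded (p A c : C) :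
  (0 < Cmod p < 1)%R -> A <> 0 -> (Cmod c < 1)%R ->
  exists M : R, forall k, (Cmod (wfac p A (c * A) k) <= M)%R.
Proof.
intros Hp HA Hc. assert (Hc0 := Cmod_ge_0 c).
destruct (Clim_bounded _ _ (wfac_Clim p A (c * A) 0 Hp HA)) as [M1 HM1].
set (z := RtoC ((1 + Cmod c) / 2)).
assert (Ez : Cmod z = ((1 + Cmod c) / 2)%R) by (unfold z; rewrite Cmod_R, Rabs_pos_eq; lra).
assert (Hz : z <> 0) by (apply nz_Cmod; lra).
assert (Hs : asummable (fun k => CpowZ z k * wfac p A (c * A) k)).
{ apply wfac_summable; try assumption; [lra|].
  rewrite Cmod_mult, Rmult_comm. apply Rmult_lt_compat_l; [now apply Cmod_nz|lra]. }
destruct (asummable_bounded _ Hs) as [M2 HM2].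
exists (Rmax M1 M2). intros k. destruct (Z_le_gt_dec 0 k) as [Hk|Hk].
- eapply Rle_trans; [|apply Rmax_l]. specialize (HM1 (Z.to_nat k)).
  now replace (0 + Z.of_nat (Z.to_nat k))%Z with k in HM1 by lia.
- eapply Rle_trans; [|apply Rmax_r]. eapply Rle_trans; [|apply (HM2 k)].
  rewrite Cmod_mult. rewrite <- (Rmult_1_l (Cmod (wfac p A (c * A) k))) at 1.
  apply Rmult_le_compat_r; [apply Cmod_ge_0|].
  rewrite CpowZ_neg by lia. rewrite Cmod_inv, Cmod_pow by now apply Cpow_nz.
  set (n := Z.to_nat (- k)).
  assert (H1 : (Cmod z ^ n <= 1)%R) by (rewrite <- (pow1 n); apply pow_incr; lra).
  assert (H2 : (0 < Cmod z ^ n)%R) by (apply pow_lt; lra).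
  apply Rmult_le_reg_l with (Cmod z ^ n)%R; [exact H2|]. rewrite Rinv_r; lra.
Qed.

Lemma asummable_bounded_mult {I} (f g : I -> C) (M : R) :
  (forall i, Cmod (f i) <= M)%R -> asummable g -> asummable (fun i => f i * g i).
Proof.
intros HM Hg. apply (summable_le _ (fun i => Rmax 0 M * Cmod (g i))%R).
- intros i. rewrite Cmod_mult. apply Rmult_le_compat_r; [apply Cmod_ge_0|].
  eapply Rle_trans; [apply HM|apply Rmax_r].
- apply summable_scal; [apply Rmax_l|exact Hg].
Qed.

Lemma cube_Cmod (q : C) : (0 < Cmod q < 1)%R -> (0 < Cmod (q ^ 3) < 1)%R.
Proof. intros Hq. rewrite Cmod_pow. split; [apply pow_lt; lra|]. simpl. nra. Qed.

Lemma qpochN_inf_nz (x p : C) (n : nat) :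
  (Cmod p < 1)%R -> qpoch_inf x p <> 0 -> qpochN x p n <> 0.
Proof.
intros Hp H E. apply H. rewrite (qpoch_inf_shift x p n Hp), E. ring.
Qed.

(* In the proof [Sn n] is the sum with the first factor shifted by [n].  It satisfies a
   first-order recursion in [n] whose inhomogeneous part produces the 2phi1
   series and whose limit as [n -> oo] is a Kronecker-type 1psi1 sum. *)
Lemma shifted_sum_eval (q u B W phi : C) :
  (0 < Cmod q < 1)%R -> u <> 0 -> B <> 0 -> qpoch_inf B (q ^ 3) <> 0 ->
  has_sum (fun k => CpowZ (q ^ 2) k *
    (wfac (q ^ 3) u (q * u) k * wfac (q ^ 3) (u / B) (q ^ 3 * (u / B)) k)) W ->
  Clim (fun n => lsum (fun m => q ^ m * qpochN (q * B) (q ^ 3) m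
                                / qpochN B (q ^ 3) (S m)) (seq 0 n)) phi ->
  W * qpoch_inf B (q ^ 3)
  = qpoch_inf (q * B) (q ^ 3) * theta u (q ^ 3) *
      (qpoch_inf (q ^ 3) (q ^ 3) ^ 2 * theta (q ^ 2 * u / B) (q ^ 3)
       / (qpoch_inf (q ^ 2) (q ^ 3) * qpoch_inf q (q ^ 3)))
    - B * theta (u / B) (q ^ 3) *
      (qpoch_inf (q ^ 3) (q ^ 3) * qpoch_inf q (q ^ 3) * theta (q ^ 2 * u) (q ^ 3)
       / qpoch_inf (q ^ 2) (q ^ 3) ^ 2) * qpoch_inf B (q ^ 3) * phi.
Proof.
intros Hq Hu HB HBi HW Hphi.
assert (Hq0 : q <> 0) by (apply nz_Cmod; lra).
assert (Hp := cube_Cmod q Hq). assert (Hq2 := Cmod_sq_lt q Hq).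
assert (HA := Cdiv_nz u B Hu HB).
assert (Hq20 : q ^ 2 <> 0) by now apply Cpow_nz.
assert (Ep : Cmod (q ^ 3) = (Cmod q * Cmod (q ^ 2))%R) by (rewrite <- Cmod_mult; f_equal; simpl; ring).
assert (Hq2p : (0 < Cmod (q ^ 2))%R) by now apply Cmod_nz.
set (p := q ^ 3) in *. set (A := u / B) in *.
assert (Hp0 : p <> 0) by (apply nz_Cmod; lra).
assert (N1 : qpoch_inf q p <> 0) by (apply qinf_nz; lra).
assert (N2 : qpoch_inf (q ^ 2) p <> 0) by (apply qinf_nz; lra).
set (F := fun (n : nat) (k : Z) => CpowZ (q ^ 2) k *
    (wfac p u (q * u) (k + Z.of_nat n) * wfac p A (p * A) k)).
assert (HpA : (Cmod (p * A) < Cmod A * Cmod (q ^ 2))%R).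
{ rewrite Cmod_mult, Ep. assert (H := Cmod_nz _ HA).
  replace (Cmod A * Cmod (q ^ 2))%R with (1 * Cmod (q ^ 2) * Cmod A)%R by ring.
  apply Rmult_lt_compat_r; [exact H|]. apply Rmult_lt_compat_r; lra. }
assert (Hker : asummable (fun k => CpowZ (q ^ 2) k * wfac p A (p * A) k))
  by now apply wfac_summable.
destruct (wfac_bounded p u q Hp Hu (proj2 Hq)) as [M HM].
assert (HFa : forall n, asummable (F n)).
{ intros n.
  apply (asummable_ext (fun k => wfac p u (q * u) (k + Z.of_nat n) *
           (CpowZ (q ^ 2) k * wfac p A (p * A) k))); [intros k; unfold F; ring|].
  apply (asummable_bounded_mult _ _ M); [intros k; apply HM|exact Hker]. }
set (Sn := fun n => tsum (F n)).
assert (HF : forall n, has_sum (F n) (Sn n)) by (intros n; now apply tsum_correct).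
assert (E0 : Sn 0%nat = W).
{ apply (has_sum_unique _ _ _ (HF 0%nat)). revert HW. apply has_sum_ext.
  intros k. unfold F. now rewrite Z.add_0_r. }
(* The 1psi1 sum left over in the inhomogeneous term once the simple fraction has cancelled. *)
set (E := qpoch_inf p p * qpoch_inf (p * q) p * theta (u * q ^ 2) p
          / (qpoch_inf (q ^ 2) p * qpoch_inf (q ^ 2) p)).
assert (HE : has_sum (fun k => CpowZ (q ^ 2) k * wfac p u (p * (q * u)) k) E).
{ assert (H := wfac_has_sum p u (p * (q * u)) (q ^ 2) Hp Hu Hq20 Hq2).
  replace (p * (q * u) / u) with (p * q) in H by (field; exact Hu).
  replace (p * (q * u) / (u * q ^ 2)) with (q ^ 2) in H by (unfold p; simpl; field; now split).
  apply H. rewrite !Cmod_mult, Ep. assert (H1 := Cmod_nz _ Hu).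
  replace (Cmod q * Cmod (q ^ 2) * (Cmod q * Cmod u))%R
    with (Cmod q * Cmod q * (Cmod u * Cmod (q ^ 2)))%R by ring.
  rewrite <- (Rmult_1_l (Cmod u * Cmod (q ^ 2))) at 2.
  apply Rmult_lt_compat_r; [now apply Rmult_lt_0_compat|]. nra. }
assert (HEn : forall n, has_sum (fun k => CpowZ (q ^ 2) k * wfac p u (p * (q * u)) (k + Z.of_nat n))
                          (E / (q ^ 2) ^ n)).
{ intros n. assert (H := has_sum_scal _ (/ (q ^ 2) ^ n) _ (has_sum_shift _ _ (Z.of_nat n) HE)).
  replace (E / (q ^ 2) ^ n) with (/ (q ^ 2) ^ n * E) by (unfold Cdiv; ring).
  revert H. apply has_sum_ext. intros k. cbv beta.
  rewrite CpowZ_add, CpowZ_of_nat by exact Hq20. field. now apply Cpow_nz. }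
assert (Hrec : forall n, (1 - q * B * p ^ n) * Sn (S n)
   = (1 - B * p ^ n) * Sn n + (1 - q) * B * q ^ n * theta A p * E).
{ intros n.
  assert (H1 := has_sum_lin _ _ (1 - q * B * p ^ n) (- (1 - B * p ^ n)) _ _ (HF (S n)) (HF n)).
  assert (H2 := has_sum_scal _ ((1 - q) * B * p ^ n * theta A p) _ (HEn n)).
  assert (H3 : (1 - q * B * p ^ n) * Sn (S n) + - (1 - B * p ^ n) * Sn n
               = (1 - q) * B * p ^ n * theta A p * (E / (q ^ 2) ^ n)).
  (* Over the common factor [wfac p u (p * (q * u)) (k + n)] the weights give [(1 - q B p^n)(1 - u
     p^(k+n)) - (1 - B p^n)(1 - q u p^(k+n)) = (1 - q) B p^n (1 - A p^k)]. The last factor cancels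
     the simple fraction. *)
  { apply (has_sum_unique _ _ _ H1). revert H2. apply has_sum_ext. intros k. cbv beta.
    unfold F. replace (k + Z.of_nat (S n))%Z with (k + Z.of_nat n + 1)%Z by lia.
    rewrite (wfac_succ p u (q * u)), (wfac_D p u (q * u)) by (try assumption; lra).
    rewrite <- (wfac_kronecker p A k) by (try assumption; lra).
    rewrite (CpowZ_add p), CpowZ_of_nat by exact Hp0. unfold A. field. exact HB. }
  replace ((1 - q * B * p ^ n) * Sn (S n))
    with ((1 - B * p ^ n) * Sn n + ((1 - q * B * p ^ n) * Sn (S n) + - (1 - B * p ^ n) * Sn n)) by ring.
  (* The powers combine as [p^n / q^(2n) = q^n], which becomes the argument [q] of the 2phi1. *)
  rewrite H3. unfold p. rewrite <- !Cpow_mult_r.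
  replace (3 * n)%nat with (n + 2 * n)%nat by lia. rewrite Cpow_add_r.
  field. now apply Cpow_nz. }
assert (Ha : forall n, qpochN B p n <> 0) by (intros n; apply qpochN_inf_nz; [lra|exact HBi]).
set (cst := (1 - q) * B * theta A p * E).
set (Phi := fun n => lsum (fun m => q ^ m * qpochN (q * B) p m / qpochN B p (S m)) (seq 0 n)) in *.
assert (Hit : forall n, W * qpochN B p n
   = qpochN (q * B) p n * Sn n - cst * qpochN B p n * Phi n).
{ induction n as [|n IH].
  - unfold Phi. simpl. rewrite E0. unfold lsum; simpl. ring.
  - assert (Hs : Phi (S n) = Phi n + q ^ n * qpochN (q * B) p n / qpochN B p (S n)).
    { unfold Phi. rewrite seq_S, lsum_app. unfold lsum at 2. simpl. ring. }
    rewrite Hs.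
    replace (W * qpochN B p (S n)) with (W * qpochN B p n * (1 - B * p ^ n)) by (cbn [qpochN]; ring).
    rewrite IH.
    replace (qpochN (q * B) p (S n) * Sn (S n))
      with (qpochN (q * B) p n * ((1 - q * B * p ^ n) * Sn (S n))) by (cbn [qpochN]; ring).
    rewrite Hrec.
    assert (Hn := Ha (S n)).
    replace (cst * qpochN B p (S n) * (Phi n + q ^ n * qpochN (q * B) p n / qpochN B p (S n)))
      with (cst * qpochN B p (S n) * Phi n + cst * (q ^ n * qpochN (q * B) p n))
      by (field; exact Hn).
    cbn [qpochN]. unfold cst. ring. }
assert (Hlim : Clim Sn (theta u p * (qpoch_inf p p ^ 2 * theta (q ^ 2 * u / B) p
                                     / (qpoch_inf (q ^ 2) p * qpoch_inf q p)))).
{ apply (tannery F (fun k => theta u p * (CpowZ (q ^ 2) k * wfac p A (p * A) k))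
     (fun k => Rmax 0 M * Cmod (CpowZ (q ^ 2) k * wfac p A (p * A) k))%R).
  - apply summable_scal; [apply Rmax_l|exact Hker].
  - intros n k. unfold F.
    replace (CpowZ (q ^ 2) k * (wfac p u (q * u) (k + Z.of_nat n) * wfac p A (p * A) k))
      with (wfac p u (q * u) (k + Z.of_nat n) * (CpowZ (q ^ 2) k * wfac p A (p * A) k)) by ring.
    rewrite Cmod_mult. apply Rmult_le_compat_r; [apply Cmod_ge_0|].
    eapply Rle_trans; [apply HM|apply Rmax_r].
  - intros k.
    apply (Clim_ext (fun n => wfac p u (q * u) (k + Z.of_nat n)
       * (CpowZ (q ^ 2) k * wfac p A (p * A) k))); [intros n; unfold F; ring|].
    apply Clim_mult; [now apply wfac_Clim|apply Clim_const].
  - exact HF.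
  - apply has_sum_scal.
    assert (H := wfac_has_sum p A (p * A) (q ^ 2) Hp HA Hq20 Hq2 HpA).
    replace (p * A / A) with p in H by (field; exact HA).
    replace (p * A / (A * q ^ 2)) with q in H by (unfold p; simpl; field; now split).
    replace (A * q ^ 2) with (q ^ 2 * u / B) in H by (unfold A; field; exact HB).
    replace (qpoch_inf p p ^ 2) with (qpoch_inf p p * qpoch_inf p p) by (simpl; ring).
    exact H. }
apply (Clim_unique (fun n => W * qpochN B p n)).
- apply Clim_mult; [apply Clim_const|apply qpochN_Clim; lra].
- apply (Clim_ext (fun n => qpochN (q * B) p n * Sn n + (- cst) * qpochN B p n * Phi n)).
  + intros n. rewrite Hit. ring.
  + assert (Ecst : cst = B * theta A p * (qpoch_inf p p * qpoch_inf q p * theta (q ^ 2 * u) p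
                           / qpoch_inf (q ^ 2) p ^ 2)).
    { unfold cst, E. rewrite (qinf_step q) by lra.
      replace (q * p) with (p * q) by ring. replace (u * q ^ 2) with (q ^ 2 * u) by ring.
      field. exact N2. }
    rewrite <- Ecst.
    replace (qpoch_inf (q * B) p * theta u p * (qpoch_inf p p ^ 2 * theta (q ^ 2 * u / B) p /
               (qpoch_inf (q ^ 2) p * qpoch_inf q p)) - cst * qpoch_inf B p * phi)
      with (qpoch_inf (q * B) p * (theta u p * (qpoch_inf p p ^ 2 * theta (q ^ 2 * u / B) p /
               (qpoch_inf (q ^ 2) p * qpoch_inf q p))) + (- cst) * qpoch_inf B p * phi) by ring.
    apply Clim_plus.
    * apply Clim_mult; [apply qpochN_Clim; lra|exact Hlim].
    * apply Clim_mult; [|exact Hphi].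
      apply Clim_mult; [apply Clim_const|apply qpochN_Clim; lra].
Qed.

(** * Theta function identities *)

Lemma triangular_double (k : Z) : (2 * (k * (k - 1) / 2) = k * (k - 1))%Z.
Proof.
destruct (Z.Even_or_Odd k) as [[j ->]|[j ->]].
- replace (2 * j * (2 * j - 1))%Z with (j * (2 * j - 1) * 2)%Z by ring.
  rewrite Z.div_mul by lia. ring.
- replace ((2 * j + 1) * (2 * j + 1 - 1))%Z with ((2 * j + 1) * j * 2)%Z by ring.
  rewrite Z.div_mul by lia. ring.
Qed.

Lemma gauss_eq (p A : C) (k : Z) : A <> 0 ->
  gauss p A k = CpowZ (- (1)) k * CpowZ A k * CpowZ p (k * (k - 1) / 2).
Proof.
intros HA. unfold gauss. replace (- A) with (- (1) * A) by ring.
rewrite CpowZ_mult_l by (try exact HA; apply Copp_nz, C1_nz). ring.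
Qed.

Lemma gauss_sq_neg (q A : C) (k : Z) : q <> 0 -> A <> 0 ->
  gauss (q ^ 2) (- A) k = CpowZ A k * CpowZ q (k * (k - 1)).
Proof.
intros Hq HA. unfold gauss. replace (- - A) with A by ring.
rewrite CpowZ_mult_r by exact Hq. change (Z.of_nat 2) with 2%Z.
now rewrite triangular_double.
Qed.

Lemma gauss_pair (q x y : C) (k l : Z) : q <> 0 -> x <> 0 -> y <> 0 ->
  gauss q (x * y) k * gauss q (x / y) l
  = CpowZ (- (1)) (k + l) * CpowZ x (k + l) * CpowZ y (k - l)
    * CpowZ q (k * (k - 1) / 2 + l * (l - 1) / 2).
Proof.
intros Hq Hx Hy. rewrite !gauss_eq by (auto using Cmult_neq_0, Cdiv_nz).
assert (Hm : - (1) <> 0) by apply Copp_nz, C1_nz.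
assert (Hyi : / y <> 0).
{ intros E. apply C1_nz. rewrite <- (Cinv_r y Hy), E. ring. }
unfold Cdiv. rewrite !CpowZ_mult_l, !CpowZ_add, CpowZ_sub by assumption.
replace (CpowZ (/ y) l) with (/ CpowZ y l).
- field. now apply CpowZ_nz.
- assert (H : CpowZ (/ y) l * CpowZ y l = 1).
  { rewrite <- CpowZ_mult_l by assumption. now rewrite Cinv_l, CpowZ_1. }
  assert (Hl := CpowZ_nz y l Hy).
  replace (CpowZ (/ y) l) with (CpowZ (/ y) l * CpowZ y l / CpowZ y l) by (field; exact Hl).
  rewrite H. field. exact Hl.
Qed.

(** The exponents of [q] add up to [t(t-1) + m^2], and [m^2 = m + m(m-1)] moves a factor [q] into
    the parameter with [y^2]. *)
Lemma gauss_pair_even (q x y : C) (t m : Z) : q <> 0 -> x <> 0 -> y <> 0 ->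
  gauss q (x * y) (t + m) * gauss q (x / y) (t - m)
  = gauss (q ^ 2) (- x ^ 2) t * gauss (q ^ 2) (- (q * y ^ 2)) m.
Proof.
intros Hq Hx Hy. assert (Hx2 := Cpow_nz x 2 Hx). assert (Hy2 := Cpow_nz y 2 Hy).
rewrite gauss_pair, !gauss_sq_neg by (auto using Cmult_neq_0).
replace (t + m + (t - m))%Z with (2 * t)%Z by ring.
replace (t + m - (t - m))%Z with (2 * m)%Z by ring.
rewrite CpowZ_m1_even, (CpowZ_mult_l q) by assumption.
rewrite !CpowZ_mult_r by assumption. change (Z.of_nat 2) with 2%Z.
replace ((t + m) * (t + m - 1) / 2 + (t - m) * (t - m - 1) / 2)%Z
  with (t * (t - 1) + (m + m * (m - 1)))%Z
  by (assert (H1 := triangular_double (t + m)); assert (H2 := triangular_double (t - m)); nia).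
rewrite !CpowZ_add by exact Hq. ring.
Qed.

(** Here the exponents add up to [t^2 + m(m-1)], so the extra [q] joins [x^2] instead. *)
Lemma gauss_pair_odd (q x y : C) (t m : Z) : q <> 0 -> x <> 0 -> y <> 0 ->
  gauss q (x * y) (t + m) * gauss q (x / y) (t + 1 - m)
  = - (x / y) * (gauss (q ^ 2) (- (q * x ^ 2)) t * gauss (q ^ 2) (- y ^ 2) m).
Proof.
intros Hq Hx Hy. assert (Hx2 := Cpow_nz x 2 Hx). assert (Hy2 := Cpow_nz y 2 Hy).
rewrite gauss_pair, !gauss_sq_neg by (auto using Cmult_neq_0).
replace (t + m + (t + 1 - m))%Z with (2 * t + 1)%Z by ring.
replace (t + m - (t + 1 - m))%Z with (2 * m - 1)%Z by ring.
rewrite CpowZ_m1_odd, (CpowZ_mult_l q) by assumption.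
rewrite !CpowZ_mult_r by assumption. change (Z.of_nat 2) with 2%Z.
replace ((t + m) * (t + m - 1) / 2 + (t + 1 - m) * (t + 1 - m - 1) / 2)%Z
  with ((t + t * (t - 1)) + m * (m - 1))%Z
  by (assert (H1 := triangular_double (t + m)); assert (H2 := triangular_double (t + 1 - m)); nia).
rewrite CpowZ_succ, CpowZ_pred by assumption.
rewrite !CpowZ_add by exact Hq. field. exact Hy.
Qed.

(* Split the double sum over [(k, l)] by the parity of [k + l]. *)
Lemma jacobi_product (q x y : C) :
  (0 < Cmod q < 1)%R -> x <> 0 -> y <> 0 ->
  jacobi q (x * y) * jacobi q (x / y)
  = jacobi (q ^ 2) (- x ^ 2) * jacobi (q ^ 2) (- (q * y ^ 2))
    - x / y * (jacobi (q ^ 2) (- (q * x ^ 2)) * jacobi (q ^ 2) (- y ^ 2)).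
Proof.
intros Hq Hx Hy. assert (Hq0 : q <> 0) by (apply nz_Cmod; lra).
assert (Hx2 := Cpow_nz x 2 Hx). assert (Hy2 := Cpow_nz y 2 Hy).
assert (Hqq : (0 < Cmod (q ^ 2) < 1)%R).
{ split; [apply Cmod_nz; now apply Cpow_nz|now apply Cmod_sq_lt]. }
assert (Hxy := Cmult_neq_0 _ _ Hx Hy). assert (Hxdy := Cdiv_nz _ _ Hx Hy).
assert (Hg : forall A : C, A <> 0 -> asummable (gauss (q ^ 2) (- A)) /\
             has_sum (gauss (q ^ 2) (- A)) (jacobi (q ^ 2) (- A))).
{ intros A HA. apply Copp_nz in HA. split; [now apply gauss_summable|now apply jacobi_has_sum]. }
destruct (Hg _ Hx2) as [A1 S1]. destruct (Hg _ Hy2) as [A2 S2].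
destruct (Hg _ (Cmult_neq_0 _ _ Hq0 Hx2)) as [A3 S3].
destruct (Hg _ (Cmult_neq_0 _ _ Hq0 Hy2)) as [A4 S4].
set (f := fun z : Z * Z => gauss q (x * y) (fst z) * gauss q (x / y) (snd z)).
assert (HL : has_sum f (jacobi q (x * y) * jacobi q (x / y))).
{ apply has_sum_prod; try now apply gauss_summable. all: now apply jacobi_has_sum. }
apply (has_sum_unique f _ _ HL).
apply (has_sum_ext (fun z => (if Z.even (fst z + snd z) then f z else 0)
                           + (if Z.even (fst z + snd z) then 0 else f z))).
{ intros z. destruct (Z.even _); ring. }
unfold Cminus. apply has_sum_plus.
- apply (has_sum_inj (fun z : Z * Z => (fst z + snd z, fst z - snd z)%Z)).
  + intros [t m] [t' m'] E. simpl in E. injection E as E1 E2. f_equal; lia.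
  + intros [k l] Hz. cbn [fst snd].
    destruct (Z.even (k + l)) eqn:E; [|reflexivity].
    exfalso. apply Z.even_spec in E as [j Ej]. apply (Hz (j, k - j)%Z). cbn [fst snd]. f_equal; lia.
  + generalize (has_sum_prod _ _ _ _ A1 A4 S1 S4). apply has_sum_ext.
    intros [t m]. cbn [fst snd].
    replace (t + m + (t - m))%Z with (2 * t)%Z by ring.
    rewrite Z.even_mul. cbn [Z.even orb]. unfold f. cbn [fst snd].
    symmetry. now apply gauss_pair_even.
- apply (has_sum_inj (fun z : Z * Z => (fst z + snd z, fst z + 1 - snd z)%Z)).
  + intros [t m] [t' m'] E. simpl in E. injection E as E1 E2. f_equal; lia.
  + intros [k l] Hz. cbn [fst snd].
    destruct (Z.even (k + l)) eqn:E; [reflexivity|].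
    exfalso. rewrite <- Z.negb_odd in E. apply Bool.negb_false_iff, Z.odd_spec in E as [j Ej].
    apply (Hz (j, k - j)%Z). cbn [fst snd]. f_equal; lia.
  + replace (- (x / y * (jacobi (q ^ 2) (- (q * x ^ 2)) * jacobi (q ^ 2) (- y ^ 2))))
      with (- (x / y) * (jacobi (q ^ 2) (- (q * x ^ 2)) * jacobi (q ^ 2) (- y ^ 2))) by ring.
    generalize (has_sum_scal _ (- (x / y)) _ (has_sum_prod _ _ _ _ A3 A2 S3 S2)).
    apply has_sum_ext. intros [t m]. cbn [fst snd].
    replace (t + m + (t + 1 - m))%Z with (2 * t + 1)%Z by ring.
    rewrite Z.even_add, Z.even_mul. cbn [Z.even orb Bool.eqb]. unfold f. cbn [fst snd].
    symmetry. now apply gauss_pair_odd.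
Qed.

(* By [jacobi_product] each pair of factors is a 2x2 minor, and the identity is the
   Pluecker relation between them. *)
Lemma theta_weierstrass (q x y u v : C) :
  (0 < Cmod q < 1)%R -> x <> 0 -> y <> 0 -> u <> 0 -> v <> 0 ->
  theta (x * y) q * theta (x / y) q * (theta (u * v) q * theta (u / v) q)
  - theta (x * v) q * theta (x / v) q * (theta (u * y) q * theta (u / y) q)
  = u / y * (theta (y * v) q * theta (y / v) q * (theta (x * u) q * theta (x / u) q)).
Proof.
intros Hq Hx Hy Hu Hv. assert (Hq0 : q <> 0) by (apply nz_Cmod; lra).
assert (N : qpoch_inf q q <> 0) by (apply qinf_nz; lra).
assert (H : forall s t : C, s <> 0 -> t <> 0 -> theta (s * t) q * theta (s / t) q
  = (jacobi (q ^ 2) (- s ^ 2) * jacobi (q ^ 2) (- (q * t ^ 2))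
    - s / t * (jacobi (q ^ 2) (- (q * s ^ 2)) * jacobi (q ^ 2) (- t ^ 2))) / qpoch_inf q q ^ 2).
{ intros s t Hs Ht. rewrite <- jacobi_product by assumption.
  rewrite !jacobi_triple by (try assumption; auto using Cmult_neq_0, Cdiv_nz).
  field. exact N. }
rewrite !H by assumption. field. repeat split; assumption.
Qed.

(** * Cube roots of unity: from base q to base q^3 *)

Lemma omega_sum (w : C) : primitive_root 3 w -> 1 + w + w ^ 2 = 0.
Proof.
intros [H3 H1]. assert (Hw : 1 - w <> 0).
{ intros E. apply (H1 1%nat ltac:(lia)). simpl. replace (w * 1) with (1 - (1 - w)) by ring.
  rewrite E. ring. }
replace (1 + w + w ^ 2) with ((1 - w ^ 3) / (1 - w)) by (field; exact Hw).
rewrite H3. field. exact Hw.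
Qed.

Lemma cube_factor (w x : C) : primitive_root 3 w ->
  (1 - x) * (1 - w * x) * (1 - w ^ 2 * x) = 1 - x ^ 3.
Proof.
intros Hw. assert (H := omega_sum w Hw). destruct Hw as [H3 _].
replace ((1 - x) * (1 - w * x) * (1 - w ^ 2 * x))
  with (1 - x * (1 + w + w ^ 2) + x ^ 2 * (w * (1 + w + w ^ 2)) - w ^ 3 * x ^ 3
        + x ^ 2 * (w ^ 3 - w ^ 3)) by ring.
rewrite H, H3. ring.
Qed.

Lemma qpochN_cube (w x q : C) (n : nat) : primitive_root 3 w ->
  qpochN x q n * qpochN (w * x) q n * qpochN (w ^ 2 * x) q n = qpochN (x ^ 3) (q ^ 3) n.
Proof.
intros Hw. induction n as [|n IH]; cbn [qpochN]; [ring|].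
rewrite <- IH. replace (x ^ 3 * (q ^ 3) ^ n) with ((x * q ^ n) ^ 3).
- rewrite <- (cube_factor w) by exact Hw. ring.
- rewrite Cpow_mult_l, <- !Cpow_mult_r. do 2 f_equal. lia.
Qed.

Lemma qinf_cube (w x q : C) : (0 < Cmod q < 1)%R -> primitive_root 3 w ->
  qpoch_inf x q * qpoch_inf (w * x) q * qpoch_inf (w ^ 2 * x) q = qpoch_inf (x ^ 3) (q ^ 3).
Proof.
intros Hq Hw. apply (Clim_unique (qpochN (x ^ 3) (q ^ 3))).
- apply (Clim_ext (fun n => qpochN x q n * qpochN (w * x) q n * qpochN (w ^ 2 * x) q n)).
  + intros n. now apply qpochN_cube.
  + apply Clim_mult; [apply Clim_mult|]; apply qpochN_Clim; lra.
- apply qpochN_Clim. apply (cube_Cmod q Hq).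
Qed.

Lemma root_nz (w : C) : primitive_root 3 w -> w <> 0.
Proof.
intros [H _] E. apply C1_nz. rewrite <- H, E. simpl. ring.
Qed.

Lemma theta_cube (w x q : C) : (0 < Cmod q < 1)%R -> primitive_root 3 w -> x <> 0 ->
  theta (x ^ 3) (q ^ 3) = theta x q * theta (w * x) q * theta (w ^ 2 * x) q.
Proof.
intros Hq Hw Hx. assert (Hw0 := root_nz w Hw). rewrite !theta_eq.
replace (q ^ 3 / x ^ 3) with ((q / x) ^ 3) by (field; exact Hx).
rewrite <- !(qinf_cube w) by assumption.
destruct Hw as [H3 _].
replace (q / (w * x)) with (w ^ 2 * (q / x)).
- replace (q / (w ^ 2 * x)) with (w * (q / x)); [ring|].
  replace (w * (q / x)) with (w ^ 3 * q / (w ^ 2 * x)) by (field; now split).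
  rewrite H3. field. now split.
- replace (w ^ 2 * (q / x)) with (w ^ 3 * q / (w * x)) by (field; now split).
  rewrite H3. field. now split.
Qed.

(* Weierstrass' relation at [(x, y, u, v) = (W, w, Z W, Z)]. *)
Lemma theta_cubic (w Z W q : C) :
  (0 < Cmod q < 1)%R -> primitive_root 3 w -> Z <> 0 -> W <> 0 ->
  theta (W ^ 3) (q ^ 3) * theta (Z ^ 2 * W) q
  - theta (Z ^ 3 * W ^ 3) (q ^ 3) * theta (W / Z) q
  = W / Z * (theta (Z ^ 3) (q ^ 3) * theta (Z * W ^ 2) q).
Proof.
intros Hq Hw HZ HW. assert (Hq0 : q <> 0) by (apply nz_Cmod; lra).
assert (Hw0 := root_nz w Hw). assert (HZW := Cmult_neq_0 _ _ HZ HW).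
rewrite <- Cpow_mult_l. rewrite !(theta_cube w) by assumption.
assert (H := theta_weierstrass q W w (Z * W) Z Hq HW Hw0 HZW HZ).
destruct Hw as [H3 _].
assert (Ei : / w = w ^ 2).
{ replace (w ^ 2) with (w ^ 3 / w) by (field; exact Hw0). rewrite H3. field. exact Hw0. }
replace (W * w) with (w * W) in H by ring.
replace (W / w) with (w ^ 2 * W) in H by (rewrite <- Ei; field; exact Hw0).
replace (Z * W * Z) with (Z ^ 2 * W) in H by ring.
replace (Z * W / Z) with W in H by (field; exact HZ).
replace (W * Z) with (Z * W) in H by ring.
replace (Z * W * w) with (w * (Z * W)) in H by ring.
replace (Z * W / w) with (w ^ 2 * (Z * W)) in H by (rewrite <- Ei; field; exact Hw0).
replace (W * (Z * W)) with (Z * W ^ 2) in H by ring.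
replace (W / (Z * W)) with (/ Z) in H by (field; now split).
replace (w / Z) with (/ (w ^ 2 * Z)) in H.
2:{ replace (w / Z) with (w ^ 3 / (w ^ 2 * Z)) by (field; now split).
    rewrite H3. field. now split. }
rewrite !theta_inv in H by (try assumption; try lra; auto using Cmult_neq_0, Cpow_nz).
replace (theta W q * theta (w * W) q * theta (w ^ 2 * W) q * theta (Z ^ 2 * W) q)
  with (theta (w * W) q * theta (w ^ 2 * W) q * (theta (Z ^ 2 * W) q * theta W q)) by ring.
replace (theta (Z * W) q * theta (w * (Z * W)) q * theta (w ^ 2 * (Z * W)) q * theta (W / Z) q)
  with (theta (Z * W) q * theta (W / Z) q * (theta (w * (Z * W)) q * theta (w ^ 2 * (Z * W)) q)) by ring.
rewrite H. field. now split.
Qed.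

(* Eliminating [theta (Z W^2; q)] between [theta_cubic] at [(Z, W)] and
   at [(r Z, r W)]. *)
Lemma theta_exchange (w r Z W q : C) :
  (0 < Cmod q < 1)%R -> primitive_root 3 w -> r ^ 3 = q -> Z <> 0 -> W <> 0 ->
  (theta (W ^ 3) (q ^ 3) * theta (q * Z ^ 3) (q ^ 3)
   - W / Z * (theta (Z ^ 3) (q ^ 3) * theta (q * W ^ 3) (q ^ 3))) * theta (Z ^ 2 * W) q
  = theta (W / Z) q *
    (theta (q * Z ^ 3) (q ^ 3) * theta (Z ^ 3 * W ^ 3) (q ^ 3)
     + Z * W ^ 2 * (theta (Z ^ 3) (q ^ 3) * theta (q ^ 2 * (Z ^ 3 * W ^ 3)) (q ^ 3))).
Proof.
intros Hq Hw Hr HZ HW. assert (Hq0 : q <> 0) by (apply nz_Cmod; lra).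
assert (Hr0 : r <> 0).
{ intros E. apply Hq0. rewrite <- Hr, E. simpl. ring. }
assert (H1 := theta_cubic w Z W q Hq Hw HZ HW).
(* Scaling by [r] fixes [W/Z] and inserts [r^3 = q] once into [Z^3], [W^3], [Z^2 W], [Z W^2] and
   twice into [Z^3 W^3]. *)
assert (H2 := theta_cubic w (r * Z) (r * W) q Hq Hw
                (Cmult_neq_0 _ _ Hr0 HZ) (Cmult_neq_0 _ _ Hr0 HW)).
replace (r * W / (r * Z)) with (W / Z) in H2 by (field; now split).
replace ((r * Z) ^ 2 * (r * W)) with (r ^ 3 * (Z ^ 2 * W)) in H2 by ring.
replace (r * Z * (r * W) ^ 2) with (r ^ 3 * (Z * W ^ 2)) in H2 by ring.
replace ((r * Z) ^ 3 * (r * W) ^ 3) with ((r ^ 3) ^ 2 * (Z ^ 3 * W ^ 3)) in H2 by ring.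
rewrite !Cpow_mult_l, Hr in H2.
rewrite (theta_step (Z ^ 2 * W)) in H1 |- * by (try assumption; try lra; auto using Cmult_neq_0, Cpow_nz).
rewrite (theta_step (Z * W ^ 2)) in H1 by (try assumption; try lra; auto using Cmult_neq_0, Cpow_nz).
set (t1 := theta (q * (Z ^ 2 * W)) q) in *. set (t2 := theta (q * (Z * W ^ 2)) q) in *.
set (t0 := theta (W / Z) q) in *.
set (eW := theta (W ^ 3) (q ^ 3)) in *. set (eZ := theta (Z ^ 3) (q ^ 3)) in *.
set (fW := theta (q * W ^ 3) (q ^ 3)) in *. set (fZ := theta (q * Z ^ 3) (q ^ 3)) in *.
set (eZW := theta (Z ^ 3 * W ^ 3) (q ^ 3)) in *.
set (gZW := theta (q ^ 2 * (Z ^ 3 * W ^ 3)) (q ^ 3)) in *.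
(* [fZ] times the first relation plus [Z W^2 eZ] times the second: their [t2] terms cancel. *)
replace ((eW * fZ - W / Z * (eZ * fW)) * (- (Z ^ 2 * W) * t1))
  with (fZ * (eW * (- (Z ^ 2 * W) * t1) - eZW * t0)
        + Z * W ^ 2 * eZ * (fW * t1 - gZW * t0)
        + t0 * (fZ * eZW + Z * W ^ 2 * (eZ * gZW))) by (field; exact HZ).
rewrite H1, H2. field. exact HZ.
Qed.

(** * The 2psi2 series *)

(** One factor is bounded and the other summable against [z^k]. The range contains [z = q] but not
    [z = q^3], the other argument in the bilateral sum; reversal brings that one back to [q]. *)
Lemma wfac_prod_summable (q z u v : C) :
  (0 < Cmod q < 1)%R -> u <> 0 -> v <> 0 -> z <> 0 ->
  (Cmod (q ^ 2) < Cmod z < 1)%R ->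
  asummable (fun k => CpowZ z k *
    (wfac (q ^ 3) u (q ^ 2 * u) k * wfac (q ^ 3) v (q ^ 2 * v) k)).
Proof.
intros Hq Hu Hv Hz0 Hz. assert (Hp := cube_Cmod q Hq). assert (Hq2 := Cmod_sq_lt q Hq).
destruct (wfac_bounded (q ^ 3) u (q ^ 2) Hp Hu Hq2) as [M HM].
apply (asummable_ext (fun k => wfac (q ^ 3) u (q ^ 2 * u) k
                               * (CpowZ z k * wfac (q ^ 3) v (q ^ 2 * v) k))).
{ intros k. ring. }
apply (asummable_bounded_mult _ _ M HM).
apply wfac_summable; try assumption; [lra|].
rewrite Cmod_mult, Rmult_comm. apply Rmult_lt_compat_l; [now apply Cmod_nz|lra].
Qed.

Lemma one_sub_nz (x p : C) : (Cmod p < 1)%R -> qpoch_inf x p <> 0 -> 1 - x <> 0.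
Proof. intros Hp H E. apply H. rewrite qinf_step, E by exact Hp. ring. Qed.

Lemma qinf_step_nz (x p : C) :
  (Cmod p < 1)%R -> qpoch_inf x p <> 0 -> qpoch_inf (p * x) p <> 0.
Proof.
intros Hp H E. apply H. rewrite qinf_step by exact Hp.
replace (x * p) with (p * x) by ring. rewrite E. ring.
Qed.

(** Eliminates the intermediate sum [W] between [bailey_transform] and [shifted_sum_eval]. The
    factor [phi / (1 - / B)] arises from [(B;p)_(m+1) = (1 - B) (p B;p)_m] and
    [- B / (1 - B) = 1 / (1 - 1/B)]. *)
Lemma psi22_eval (q u B phi : C) :
  (0 < Cmod q < 1)%R -> u <> 0 -> B <> 0 -> qpoch_inf B (q ^ 3) <> 0 ->
  Clim (fun n => lsum (fun m => qpochN (q * B) (q ^ 3) m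
                  / qpochN (q ^ 3 * B) (q ^ 3) m * q ^ m) (seq 0 n)) phi ->
  has_sum (fun k => CpowZ q k *
    (wfac (q ^ 3) u (q ^ 2 * u) k * wfac (q ^ 3) (q * u / B) (q ^ 2 * (q * u / B)) k))
    (phi / (1 - / B) * (theta (u / B) (q ^ 3) * theta (q ^ 2 * u) (q ^ 3))
     + qpoch_inf (q ^ 2) (q ^ 3) * qpoch_inf (q ^ 3) (q ^ 3) * qpoch_inf (q * B) (q ^ 3)
       / (qpoch_inf q (q ^ 3) ^ 2 * qpoch_inf B (q ^ 3))
       * (theta u (q ^ 3) * theta (q ^ 2 * u / B) (q ^ 3))).
Proof.
intros Hq Hu HB HBi Hphi.
assert (Hq0 : q <> 0) by (apply nz_Cmod; lra).
assert (Hp := cube_Cmod q Hq). assert (Hq2 := Cmod_sq_lt q Hq).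
assert (Hv : q * u / B <> 0) by (apply Cdiv_nz; [now apply Cmult_neq_0|exact HB]).
assert (HuB := Cdiv_nz u B Hu HB).
assert (N1 : qpoch_inf q (q ^ 3) <> 0) by (apply qinf_nz; lra).
assert (N2 : qpoch_inf (q ^ 2) (q ^ 3) <> 0) by (apply qinf_nz; lra).
assert (N3 : qpoch_inf (q ^ 3) (q ^ 3) <> 0) by (apply qinf_nz; lra).
assert (NB : 1 - B <> 0) by (apply (one_sub_nz _ (q ^ 3)); [lra|exact HBi]).
assert (NB' : B - 1 <> 0) by (intros E; apply NB; replace (1 - B) with (- (B - 1)) by ring; rewrite E; ring).
assert (HpB := qinf_step_nz B (q ^ 3) (proj2 Hp) HBi).
assert (HT := tsum_correct _ (wfac_prod_summable q q u _ Hq Hu Hv Hq0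
  ltac:(split; [rewrite Cmod_pow; simpl; nra|lra]))).
set (T := tsum _) in HT.
assert (HWs : asummable (fun k => CpowZ (q ^ 2) k *
    (wfac (q ^ 3) u (q * u) k * wfac (q ^ 3) (u / B) (q ^ 3 * (u / B)) k))).
{ destruct (wfac_bounded (q ^ 3) u q Hp Hu (proj2 Hq)) as [M HM].
  apply (asummable_ext (fun k => wfac (q ^ 3) u (q * u) k
                         * (CpowZ (q ^ 2) k * wfac (q ^ 3) (u / B) (q ^ 3 * (u / B)) k))).
  { intros k. ring. }
  apply (asummable_bounded_mult _ _ M HM).
  apply wfac_summable; try assumption; [now apply Cpow_nz|].
  rewrite Cmod_mult, Rmult_comm. apply Rmult_lt_compat_l; [now apply Cmod_nz|].
  rewrite !Cmod_pow. simpl. assert (0 < Cmod q * Cmod q)%R by nra. nra. }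
assert (HW := tsum_correct _ HWs). set (W := tsum _) in HW.
assert (E1 : T * (qpoch_inf q (q ^ 3) * qpoch_inf (q ^ 3) (q ^ 3))
             = qpoch_inf (q ^ 2) (q ^ 3) ^ 2 * W).
{ apply (bailey_transform q u (q * u / B) T W Hq Hu Hv HT).
  replace (q * u / B / q) with (u / B) by (field; now split). exact HW. }
assert (E2 := shifted_sum_eval q u B W (phi / (1 - B)) Hq Hu HB HBi HW).
assert (Hphi' : Clim (fun n => lsum (fun m => q ^ m * qpochN (q * B) (q ^ 3) m
                   / qpochN B (q ^ 3) (S m)) (seq 0 n)) (phi / (1 - B))).
{ apply (Clim_ext (fun n => lsum (fun m => qpochN (q * B) (q ^ 3) m
                  / qpochN (q ^ 3 * B) (q ^ 3) m * q ^ m) (seq 0 n) * / (1 - B))).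
  - intros n. rewrite Cmult_comm.
    rewrite (lsum_ext (fun m => q ^ m * qpochN (q * B) (q ^ 3) m / qpochN B (q ^ 3) (S m))
      (fun m => / (1 - B) * (qpochN (q * B) (q ^ 3) m / qpochN (q ^ 3 * B) (q ^ 3) m * q ^ m)
                + 0 * 0)).
    + rewrite lsum_lin. ring.
    + intros m. rewrite (qpochN_add B (q ^ 3) 1 m : qpochN B (q ^ 3) (S m) = _).
      replace (B * (q ^ 3) ^ 1) with (q ^ 3 * B) by ring.
      assert (Hm := qpochN_inf_nz _ _ m (proj2 Hp) HpB).
      cbn [qpochN]. replace (B * (q ^ 3) ^ 0) with B by (simpl; ring).
      field. now split.
  - apply Clim_mult; [exact Hphi|apply Clim_const]. }
specialize (E2 Hphi').
match goal with |- has_sum _ ?R => replace R with T; [exact HT|] end.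
replace T with (T * (qpoch_inf q (q ^ 3) * qpoch_inf (q ^ 3) (q ^ 3))
                / (qpoch_inf q (q ^ 3) * qpoch_inf (q ^ 3) (q ^ 3))) by (field; now split).
rewrite E1.
replace W with (W * qpoch_inf B (q ^ 3) / qpoch_inf B (q ^ 3)) by (field; exact HBi).
rewrite E2. field. repeat split; assumption.
Qed.

(** * From q-shifted factorials to normalised factors *)

Lemma Cinv_0 : / (RtoC 0) = 0.
Proof. unfold Cinv. simpl. apply injective_projections; simpl; unfold Rdiv; ring. Qed.

(** Since [/ 0 = 0], quotients of symbols can be regrouped termwise even where a denominator
    vanishes. *)
Lemma Cinv_mult_total (x y : C) : / (x * y) = / x * / y.
Proof.
destruct (classic (x = 0)) as [->|Hx].
- replace (0 * y) with (RtoC 0) by ring. rewrite Cinv_0. ring.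
- destruct (classic (y = 0)) as [->|Hy].
  + replace (x * 0) with (RtoC 0) by ring. rewrite Cinv_0. ring.
  + field. now split.
Qed.

Lemma Cinv_inv_total (x : C) : / / x = x.
Proof.
destruct (classic (x = 0)) as [->|Hx].
- now rewrite !Cinv_0.
- field. exact Hx.
Qed.

(** The hypothesis rules out the poles of [(A;p)_k] at negative [k], while [A = p^(-m)] with
    [m >= 0], the terminating case, stays admissible. *)
Lemma qpoch_wfac (p A : C) (k : Z) :
  (0 < Cmod p < 1)%R -> A <> 0 -> qpoch_inf (p / A) p <> 0 ->
  qpoch A p k = wfac p A 0 k / qpoch_inf (p / A) p.
Proof.
intros Hp HA HN. assert (Hp0 : p <> 0) by (apply nz_Cmod; lra).
destruct (Z_lt_le_dec k 0) as [Hk|Hk].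
- assert (H := wfac_0_add p A k (Z.to_nat (- k)) (proj2 Hp) Hp0 HA).
  replace (k + Z.of_nat (Z.to_nat (- k)))%Z with 0%Z in H by lia.
  rewrite wfac_0_0 in H by exact HA.
  destruct k as [|n|n]; [lia|lia|]. cbn [qpoch]. simpl (Z.to_nat _) in H.
  set (y := qpochN (A * CpowZ p (Z.neg n)) p (Pos.to_nat n)) in *.
  assert (Hy : y <> 0) by (intros E; apply HN; rewrite H, E; ring).
  assert (Hw : wfac p A 0 (Z.neg n) <> 0) by (intros E; apply HN; rewrite H, E; ring).
  rewrite H. field. now split.
- assert (H := wfac_0_add p A 0 (Z.to_nat k) (proj2 Hp) Hp0 HA).
  rewrite wfac_0_0 in H by exact HA.
  replace (0 + Z.of_nat (Z.to_nat k))%Z with k in H by lia.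
  replace (A * CpowZ p 0) with A in H by (simpl; ring).
  assert (E : qpoch A p k = qpochN A p (Z.to_nat k)) by (destruct k; [reflexivity|reflexivity|lia]).
  rewrite E, H. field. exact HN.
Qed.

(** This includes the poles of [(D;p)_k]: there the symbol is 0 by convention, so is its inverse,
    and the infinite product on the right vanishes too. *)
Lemma qpoch_inv (p D : C) (k : Z) :
  (0 < Cmod p < 1)%R -> qpoch_inf D p <> 0 ->
  / qpoch D p k = qpoch_inf (D * CpowZ p k) p / qpoch_inf D p.
Proof.
intros Hp HN. assert (Hp0 : p <> 0) by (apply nz_Cmod; lra).
destruct (Z_lt_le_dec k 0) as [Hk|Hk].
- destruct k as [|n|n]; [lia|lia|]. cbn [qpoch]. rewrite Cinv_inv_total.
  rewrite (qpoch_inf_shift (D * CpowZ p (Z.neg n)) p (Pos.to_nat n)) by lra.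
  replace (D * CpowZ p (Z.neg n) * p ^ Pos.to_nat n) with D.
  + field. exact HN.
  + simpl. field. now apply Cpow_nz.
- assert (E : qpoch D p k = qpochN D p (Z.to_nat k)) by (destruct k; [reflexivity|reflexivity|lia]).
  rewrite E, CpowZ_nonneg by exact Hk.
  assert (H := qpoch_inf_shift D p (Z.to_nat k) (proj2 Hp)).
  assert (H1 := qpochN_inf_nz D p (Z.to_nat k) (proj2 Hp) HN).
  rewrite H. field. split; [|exact H1].
  intros E2. apply HN. rewrite H, E2. ring.
Qed.

Lemma qpoch_ratio (p A D : C) (k : Z) :
  (0 < Cmod p < 1)%R -> A <> 0 -> qpoch_inf (p / A) p <> 0 -> qpoch_inf D p <> 0 ->
  qpoch A p k / qpoch D p k = wfac p A D k / (qpoch_inf (p / A) p * qpoch_inf D p).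
Proof.
intros Hp HA H1 H2. unfold Cdiv at 1.
rewrite qpoch_wfac, qpoch_inv, (wfac_split p A D) by assumption. field. now split.
Qed.

Lemma CpowZ_inv (x : C) (k : Z) : x <> 0 -> CpowZ (/ x) k = / CpowZ x k.
Proof.
intros Hx.
assert (Hi : / x <> 0) by (intros E; apply C1_nz; rewrite <- (Cinv_r x Hx), E; ring).
assert (H : CpowZ (/ x) k * CpowZ x k = 1).
{ rewrite <- CpowZ_mult_l by assumption. now rewrite Cinv_l, CpowZ_1. }
assert (Hk := CpowZ_nz x k Hx).
replace (CpowZ (/ x) k) with (CpowZ (/ x) k * CpowZ x k / CpowZ x k) by (field; exact Hk).
rewrite H. field. exact Hk.
Qed.

(** Reversal exchanges the roles of the two infinite products; the power of [q^2] is what the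
    Gaussian factors leave behind. *)
Lemma wfac_reflect (q u : C) (k : Z) : q <> 0 -> u <> 0 ->
  wfac (q ^ 3) u (q ^ 2 * u) (- k)
  = CpowZ (q ^ 2) k * wfac (q ^ 3) (q / u) (q ^ 2 * (q / u)) k.
Proof.
intros Hq Hu. set (p := q ^ 3). assert (Hp : p <> 0) by now apply Cpow_nz.
assert (Hk := CpowZ_nz p k Hp).
unfold wfac.
replace (CpowZ p (1 - - k) / u) with (q ^ 2 * (q / u) * CpowZ p k).
2:{ replace (1 - - k)%Z with (k + 1)%Z by lia. rewrite CpowZ_succ by exact Hp.
    unfold p. field. exact Hu. }
replace (q ^ 2 * u * CpowZ p (- k)) with (CpowZ p (1 - k) / (q / u)).
2:{ rewrite CpowZ_opp, CpowZ_sub by exact Hp.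
    change (CpowZ p 1) with (p * 1). unfold p at 1. field. repeat split; assumption. }
assert (Hqi := Cpow_nz q 2 Hq).
replace (gauss p u (- k)) with (CpowZ (q ^ 2) k * gauss p (q / u) k); [ring|].
unfold gauss.
assert (Hnu := Copp_nz u Hu).
replace (- (q / u)) with (q * / (- u)) by (field; exact Hu).
assert (Hnui : / (- u) <> 0) by (intros E; apply C1_nz; rewrite <- (Cinv_r _ Hnu), E; ring).
rewrite (CpowZ_mult_l q (/ - u)), CpowZ_inv, CpowZ_opp by assumption.
replace (- k * (- k - 1) / 2)%Z with (k + k * (k - 1) / 2)%Z.
- rewrite (CpowZ_add p) by exact Hp.
  replace (CpowZ p k) with (CpowZ (q ^ 2) k * CpowZ q k).
  + ring.
  + rewrite <- CpowZ_mult_l by assumption. f_equal. unfold p. simpl. ring.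
- replace (- k * (- k - 1))%Z with (k * (k - 1) + k * 2)%Z by ring.
  rewrite Z.div_add by lia. ring.
Qed.

Lemma qpoch_cube (w x q : C) (k : Z) : q <> 0 -> primitive_root 3 w ->
  qpoch x q k * (qpoch (w * x) q k * qpoch (w ^ 2 * x) q k) = qpoch (x ^ 3) (q ^ 3) k.
Proof.
intros Hq Hw. destruct k as [|n|n]; cbn [qpoch].
- ring.
- rewrite Cmult_assoc. now apply qpochN_cube.
- rewrite <- !Cinv_mult_total, Cmult_assoc. f_equal.
  replace (w * x * CpowZ q (Z.neg n)) with (w * (x * CpowZ q (Z.neg n))) by ring.
  replace (w ^ 2 * x * CpowZ q (Z.neg n)) with (w ^ 2 * (x * CpowZ q (Z.neg n))) by ring.
  rewrite qpochN_cube by exact Hw. f_equal.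
  rewrite CpowZ_mult_r, Cpow_mult_l by exact Hq. f_equal.
  change (CpowZ q (Z.neg n) ^ 3) with
    (CpowZ q (Z.neg n) * (CpowZ q (Z.neg n) * (CpowZ q (Z.neg n) * 1))).
  rewrite Cmult_1_r, <- !CpowZ_add by exact Hq. f_equal. lia.
Qed.

(** The six parameters form two orbits under multiplication by [w], and so do the denominator
    parameters since [/ w = w ^ 2]. Each orbit merges into one symbol of base [q^3], where only the
    cubes of [r] and [c] remain. *)
Lemma Psi88_term_cubic (q a b r c w : C) (k : Z) :
  q <> 0 -> a <> 0 -> b <> 0 -> r ^ 3 = q -> c ^ 3 = b -> primitive_root 3 w ->
  Psi88_term a c (w * c) (w ^ 2 * c) (r * a / c) (w * r * a / c) (w ^ 2 * r * a / c) q q k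
  = (1 - a * CpowZ q (2 * k)) / (1 - a) *
    (qpochs [b; q * a ^ 3 / b] (q ^ 3) k / qpochs [q ^ 2 * b; q ^ 3 * a ^ 3 / b] (q ^ 3) k)
    * CpowZ q k.
Proof.
intros Hq Ha Hb Hr Hc Hw. assert (Hw0 := root_nz w Hw).
assert (Hc0 : c <> 0) by (intros E; apply Hb; rewrite <- Hc, E; simpl; ring).
assert (Hr0 : r <> 0) by (intros E; apply Hq; rewrite <- Hr, E; simpl; ring).
assert (H3 := proj1 Hw).
assert (Ei : / w = w ^ 2).
{ replace (w ^ 2) with (w ^ 3 / w) by (field; exact Hw0). rewrite H3. field. exact Hw0. }
assert (Ei2 : / w ^ 2 = w).
{ replace w with (w ^ 3 / w ^ 2) at 2 by (field; exact Hw0). rewrite H3. field. exact Hw0. }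
unfold Psi88_term. f_equal. f_equal. unfold qpochs. cbn [map Cprod fold_right].
replace (q * a / (w * c)) with (w ^ 2 * (q * a / c)) by (rewrite <- Ei; field; now split).
replace (q * a / (w ^ 2 * c)) with (w * (q * a / c)) by (rewrite <- Ei2 at 1; field; now split).
replace (q * a / (r * a / c)) with (q * c / r) by (field; repeat split; assumption).
replace (q * a / (w * r * a / c)) with (w ^ 2 * (q * c / r))
  by (rewrite <- Ei; field; repeat split; assumption).
replace (q * a / (w ^ 2 * r * a / c)) with (w * (q * c / r))
  by (rewrite <- Ei2 at 1; field; repeat split; assumption).
replace (w * r * a / c) with (w * (r * a / c)) by (field; exact Hc0).
replace (w ^ 2 * r * a / c) with (w ^ 2 * (r * a / c)) by (field; exact Hc0).
replace (qpoch b (q ^ 3) k) with (qpoch (c ^ 3) (q ^ 3) k) by now rewrite Hc.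
replace (qpoch (q * a ^ 3 / b) (q ^ 3) k) with (qpoch ((r * a / c) ^ 3) (q ^ 3) k).
2:{ f_equal. rewrite <- Hc, <- Hr at 1. field. exact Hc0. }
replace (qpoch (q ^ 2 * b) (q ^ 3) k) with (qpoch ((q * c / r) ^ 3) (q ^ 3) k).
2:{ f_equal. replace ((q * c / r) ^ 3) with (q ^ 3 * c ^ 3 / r ^ 3) by (field; exact Hr0).
    rewrite Hr, Hc. field. exact Hq. }
replace (qpoch (q ^ 3 * a ^ 3 / b) (q ^ 3) k) with (qpoch ((q * a / c) ^ 3) (q ^ 3) k).
2:{ f_equal. rewrite <- Hc. field. exact Hc0. }
rewrite <- !(qpoch_cube w) by assumption.
unfold Cdiv. rewrite !Cinv_mult_total. replace (/ RtoC 1) with (RtoC 1) by field.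
ring.
Qed.

Lemma qpoch_of_nat (x p : C) (n : nat) : qpoch x p (Z.of_nat n) = qpochN x p n.
Proof.
destruct n as [|n]; [reflexivity|].
change (Z.of_nat (S n)) with (Z.pos (Pos.of_succ_nat n)). cbn [qpoch].
now rewrite SuccNat2Pos.id_succ.
Qed.

(** The quotient equals [(A;p)_m (D p^m;p)_oo / (D;p)_oo], which converges and hence is bounded, so
    [q^m] makes the series geometric. *)
Lemma qratio_summable (q A D p : C) :
  (Cmod q < 1)%R -> (Cmod p < 1)%R -> qpoch_inf D p <> 0 ->
  asummable (fun m : nat => qpochN A p m / qpochN D p m * q ^ m).
Proof.
intros Hq Hp HD. assert (Hq0 := Cmod_ge_0 q).
assert (HC : Clim (fun m => / qpoch_inf D p * (qpochN A p m * qpoch_inf (D * p ^ m) p))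
               (/ qpoch_inf D p * (qpoch_inf A p * 1))).
{ apply Clim_mult; [apply Clim_const|].
  apply Clim_mult; [now apply qpochN_Clim|now apply qinf_shift_Clim]. }
destruct (Clim_bounded _ _ HC) as [M HM].
apply (asummable_bounded_mult _ _ M).
- intros m. eapply Rle_trans; [|apply (HM m)]. right. f_equal.
  assert (H := qpoch_inf_shift D p m Hp).
  assert (H1 := qpochN_inf_nz D p m Hp HD).
  rewrite H. field. split; [|exact H1]. intros E. apply HD. rewrite H, E. ring.
- apply (summable_le _ (fun m : nat => (Cmod q ^ Z.abs_nat (Z.of_nat m))%R)).
  + intros m. rewrite Cmod_pow, Zabs2Nat.id. lra.
  + apply (summable_inj Z.of_nat (fun k => (Cmod q ^ Z.abs_nat k)%R)); [intros; lia|].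
    apply summable_geom. lra.
Qed.

Lemma has_sum_seq (f : nat -> C) (S : C) :
  has_sum f S -> Clim (fun n => lsum f (seq 0 n)) S.
Proof.
intros H eps He. destruct (H eps He) as [l0 H0].
exists (Datatypes.S (list_max l0)). intros n Hn. apply H0.
- apply seq_NoDup.
- intros i Hi. apply in_seq.
  assert (Hm := proj1 (list_max_le l0 (list_max l0)) (le_n _)).
  rewrite Forall_forall in Hm. specialize (Hm i Hi). lia.
Qed.

Lemma Cmult_nz_inv (x y : C) : x * y <> 0 -> x <> 0 /\ y <> 0.
Proof. intros H. split; intros E; apply H; rewrite E; ring. Qed.

(* r and c are arbitrary choices of q^{1/3} and b^{1/3}.  The last four
   hypotheses are the nonvanishing of the denominators on the right-hand side;
   they entail that of 1 - a^3/b^2 and of the denominators of the terms of the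
   three series. *)
Theorem corollary3p8 :
  forall q a b r c omega : C,
    (0 < Cmod q < 1)%R ->
    a <> 0 -> b <> 0 ->
    r ^ 3 = q -> c ^ 3 = b ->
    primitive_root 3 omega ->
    1 - a <> 0 ->
    qpochs_inf [q ^ 3 / b; q ^ 2 * b] (q ^ 3) <> 0 ->
    theta (b / a ^ 2) q <> 0 ->
    qpochs_inf [q ^ 2 * b / a ^ 3; q ^ 3 * a ^ 3 / b] (q ^ 3) <> 0 ->
    qpoch_inf (b ^ 2 / a ^ 3) (q ^ 3) <> 0 ->
    let Psi_terms :=
      Psi88_term a c (omega * c) (omega ^ 2 * c)
        (r * a / c) (omega * r * a / c) (omega ^ 2 * r * a / c) q q in
    let sum_terms := fun k : Z =>
      (1 - a * CpowZ q (2 * k)) / (1 - a) *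
      (qpochs [b; q * a ^ 3 / b] (q ^ 3) k /
       qpochs [q ^ 2 * b; q ^ 3 * a ^ 3 / b] (q ^ 3) k) *
      CpowZ q k in
    ex_CSeriesZ Psi_terms /\
    ex_CSeriesZ sum_terms /\
    ex_CSeries
      (phi21_term (q * b ^ 2 / a ^ 3) (q ^ 3) (q ^ 3 * b ^ 2 / a ^ 3) (q ^ 3) q) /\
    Psi88 a c (omega * c) (omega ^ 2 * c)
      (r * a / c) (omega * r * a / c) (omega ^ 2 * r * a / c) q q
    = CSeriesZ sum_terms /\
    CSeriesZ sum_terms
    = qpochs_inf [q * a; q / a] q /
      (qpochs_inf [q ^ 3 / b; q ^ 2 * b] (q ^ 3) * theta (b / a ^ 2) q) *
      (qpochs_inf [q ^ 2; q ^ 3; q * b ^ 2 / a ^ 3] (q ^ 3) *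
         (thetas [b ^ 2 / a ^ 3; q * b / a ^ 3] (q ^ 3) +
          b / a * thetas [b / a ^ 3; q * a ^ 3 / b ^ 2] (q ^ 3)) /
         qpochs_inf
           [q; q; q ^ 2 * b / a ^ 3; q ^ 3 * a ^ 3 / b; b ^ 2 / a ^ 3] (q ^ 3)
       +
       (a ^ 2 / b * thetas [b / a ^ 3; q * b ^ 2 / a ^ 3] (q ^ 3) -
        b / a ^ 2 * thetas [q * a ^ 3 / b; a ^ 3 / b ^ 2] (q ^ 3)) /
         ((1 - a ^ 3 / b ^ 2) *
          qpochs_inf [q ^ 2 * b / a ^ 3; q ^ 3 * a ^ 3 / b] (q ^ 3)) *
         phi21 (q * b ^ 2 / a ^ 3) (q ^ 3) (q ^ 3 * b ^ 2 / a ^ 3) (q ^ 3) q).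
Proof.
intros q a b r c omega Hq Ha Hb Hr Hc Hw H1a HN1 Hty HN2 HBi Psi_terms sum_terms.
assert (Hq0 : q <> 0) by (apply nz_Cmod; lra).
assert (Hc0 : c <> 0) by (intros E; apply Hb; rewrite <- Hc, E; simpl; ring).
assert (Hp := cube_Cmod q Hq). assert (Hq2 := Cmod_sq_lt q Hq).
assert (Hp0 : q ^ 3 <> 0) by now apply Cpow_nz.
assert (Ha3 := Cpow_nz a 3 Ha). assert (Hb2 := Cpow_nz b 2 Hb).
unfold qpochs_inf in HN1, HN2. cbn [map Cprod fold_right] in HN1, HN2.
apply Cmult_nz_inv in HN1 as [D1 D2]. apply Cmult_nz_inv in D2 as [D2 _].
apply Cmult_nz_inv in HN2 as [D3 D4]. apply Cmult_nz_inv in D4 as [D4 _].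
set (B := b ^ 2 / a ^ 3) in *.
assert (HB : B <> 0) by now apply Cdiv_nz.
assert (NB : 1 - B <> 0) by (apply (one_sub_nz _ (q ^ 3)); [lra|exact HBi]).
(* The second numerator parameter [q a^3 / b], written as the partner [q u / B] of [u = b]. *)
set (b' := q * b / B).
assert (Eb' : b' = q * a ^ 3 / b) by (unfold b', B; field; now split).
assert (Hb' : b' <> 0) by (rewrite Eb'; apply Cdiv_nz; auto using Cmult_neq_0).
assert (EqB : q * b ^ 2 / a ^ 3 = q * B) by (unfold B; field; exact Ha).
assert (EpB : q ^ 3 * b ^ 2 / a ^ 3 = q ^ 3 * B) by (unfold B; field; exact Ha).
(* The normalising constants from [qpoch_ratio] for the two quotients of symbols. *)
set (N := qpoch_inf (q ^ 3 / b) (q ^ 3) * qpoch_inf (q ^ 2 * b) (q ^ 3)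
          * (qpoch_inf (q ^ 2 * b / a ^ 3) (q ^ 3) * qpoch_inf (q ^ 3 * a ^ 3 / b) (q ^ 3))).
assert (HpB := qinf_step_nz B (q ^ 3) (proj2 Hp) HBi).
set (phi_term := fun m : nat => qpochN (q * B) (q ^ 3) m / qpochN (q ^ 3 * B) (q ^ 3) m * q ^ m).
assert (Hphit : forall m,
  phi_term m = phi21_term (q * b ^ 2 / a ^ 3) (q ^ 3) (q ^ 3 * b ^ 2 / a ^ 3) (q ^ 3) q m).
{ intros m. unfold phi21_term, phi_term, qpochs. cbn [map Cprod fold_right].
  rewrite EqB, EpB, !qpoch_of_nat. field. split.
  - now apply qpochN_inf_nz.
  - apply qpochN_nz; lra. }
assert (Hphis : asummable phi_term) by (apply qratio_summable; lra || exact HpB).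
destruct (asummable_has_sum _ Hphis) as [phi Hphi].
assert (Hphi1 := has_sum_seq _ _ Hphi).
assert (Hphi2 := has_sum_series _ _ (has_sum_ext _ _ _ Hphit Hphi)).
assert (HT1 := psi22_eval q b B phi Hq Hb HB HBi Hphi1). fold b' in HT1.
assert (Hu2 : b / a ^ 3 <> 0) by now apply Cdiv_nz.
(* For [u = b / a^3] the parameters are [q / b'] and [q / b], the reflections of those of the first
   series. *)
assert (HT2 := psi22_eval q (b / a ^ 3) B phi Hq Hu2 HB HBi Hphi1).
assert (Hqb : q / b <> 0) by now apply Cdiv_nz.
replace (q * (b / a ^ 3) / B) with (q / b) in HT2 by (unfold B; field; now split).
assert (HA1 := wfac_prod_summable q q b b' Hq Hb Hb' Hq0
  ltac:(split; [rewrite Cmod_pow; simpl; nra|lra])).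
assert (HA2 := wfac_prod_summable q q (b / a ^ 3) (q / b) Hq Hu2 Hqb Hq0
  ltac:(split; [rewrite Cmod_pow; simpl; nra|lra])).
match type of HT1 with has_sum _ ?X => set (T1 := X) in * end.
match type of HT2 with has_sum _ ?X => set (T2 := X) in * end.
(* Each reflected factor contributes [q^(2k)], so the power [q^(-k)] becomes [q^(3k)]. *)
assert (Hrefl : forall k, CpowZ q (- k) *
    (wfac (q ^ 3) (b / a ^ 3) (q ^ 2 * (b / a ^ 3)) (- k)
     * wfac (q ^ 3) (q / b) (q ^ 2 * (q / b)) (- k))
  = CpowZ q (3 * k) * (wfac (q ^ 3) b (q ^ 2 * b) k * wfac (q ^ 3) b' (q ^ 2 * b') k)).
{ intros k. rewrite !wfac_reflect by assumption.
  replace (q / (b / a ^ 3)) with b' by (rewrite Eb'; field; now split).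
  replace (q / (q / b)) with b by (field; now split).
  rewrite CpowZ_mult_r by exact Hq0. change (Z.of_nat 2) with 2%Z.
  replace (3 * k)%Z with (- k + (2 * k + 2 * k))%Z by lia.
  rewrite !CpowZ_add by exact Hq0. ring. }
assert (HT2' := has_sum_ext _ _ _ Hrefl (has_sum_neg _ _ HT2)).
assert (HA2' : asummable (fun k => CpowZ q (3 * k) *
    (wfac (q ^ 3) b (q ^ 2 * b) k * wfac (q ^ 3) b' (q ^ 2 * b') k))).
{ apply (asummable_ext _ _ Hrefl).
  apply (summable_inj Z.opp (fun k => Cmod (CpowZ q k *
    (wfac (q ^ 3) (b / a ^ 3) (q ^ 2 * (b / a ^ 3)) k
     * wfac (q ^ 3) (q / b) (q ^ 2 * (q / b)) k)))); [intros; lia|exact HA2]. }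
(* The very-well-poised factor splits the summand through [(1 - a q^(2k)) q^k = q^k - a q^(3k)]. *)
set (c0 := / ((1 - a) * N)).
assert (Hterm : forall k,
  c0 * (CpowZ q k * (wfac (q ^ 3) b (q ^ 2 * b) k * wfac (q ^ 3) b' (q ^ 2 * b') k))
  + (- a * c0) * (CpowZ q (3 * k) *
       (wfac (q ^ 3) b (q ^ 2 * b) k * wfac (q ^ 3) b' (q ^ 2 * b') k)) = sum_terms k).
{ intros k. unfold sum_terms, qpochs. cbn [map Cprod fold_right].
  rewrite <- Eb'.
  assert (Eqb' : q ^ 3 * a ^ 3 / b = q ^ 2 * b') by (rewrite Eb'; field; exact Hb).
  rewrite Eqb' in D4 |- *.
  assert (Eb3 : q ^ 3 / b' = q ^ 2 * b / a ^ 3) by (rewrite Eb'; field; repeat split; assumption).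
  assert (D3' : qpoch_inf (q ^ 3 / b') (q ^ 3) <> 0) by now rewrite Eb3.
  replace ((1 - a * CpowZ q (2 * k)) / (1 - a) *
     (qpoch b (q ^ 3) k * (qpoch b' (q ^ 3) k * 1) /
      (qpoch (q ^ 2 * b) (q ^ 3) k * (qpoch (q ^ 2 * b') (q ^ 3) k * 1))) * CpowZ q k)
    with ((1 - a * CpowZ q (2 * k)) / (1 - a) *
     ((qpoch b (q ^ 3) k / qpoch (q ^ 2 * b) (q ^ 3) k)
      * (qpoch b' (q ^ 3) k / qpoch (q ^ 2 * b') (q ^ 3) k)) * CpowZ q k).
  2:{ unfold Cdiv. rewrite !Cinv_mult_total. replace (/ RtoC 1) with (RtoC 1) by field. ring. }
  rewrite !qpoch_ratio by assumption. rewrite Eb3.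
  replace (3 * k)%Z with (2 * k + k)%Z by lia. rewrite (CpowZ_add q) by exact Hq0.
  unfold c0, N. rewrite Eqb'. field. repeat split; assumption. }
assert (HS := has_sum_ext _ _ _ Hterm (has_sum_lin _ _ c0 (- a * c0) _ _ HT1 HT2')).
assert (HSa := asummable_ext _ _ Hterm (asummable_plus _ _ (asummable_scal _ c0 HA1)
                 (asummable_scal _ (- a * c0) HA2'))).
destruct (has_sum_CSeriesZ _ _ HSa HS) as [X1 X2].
assert (HPsi : forall k, sum_terms k = Psi_terms k).
{ intros k. unfold Psi_terms. now rewrite (Psi88_term_cubic q a b). }
destruct (has_sum_CSeriesZ _ _ (asummable_ext _ _ HPsi HSa) (has_sum_ext _ _ _ HPsi HS)) as [X3 X4].
split; [exact X3|]. split; [exact X1|]. split; [now exists phi|].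
split; [unfold Psi88; fold Psi_terms; congruence|].
rewrite X2.
replace (phi21 (q * b ^ 2 / a ^ 3) (q ^ 3) (q ^ 3 * b ^ 2 / a ^ 3) (q ^ 3) q) with phi
  by (symmetry; exact (CSeries_correct _ _ Hphi2)).
(* [G1] serves the term without 2phi1: here [W/Z = a], [Z^2 W = b/a^2], and the cubes are [b/a^3]
   and [b], with product [B]. *)
assert (G1 := theta_exchange omega r (c / a) c q Hq Hw Hr (Cdiv_nz _ _ Hc0 Ha) Hc0).
assert (Hca : c ^ 2 / a <> 0) by (apply Cdiv_nz; [now apply Cpow_nz|exact Ha]).
(* [G2] serves the coefficient of the 2phi1: now [W/Z = b/a^2] and [Z^2 W = a] have changed places,
   and the cubes are [a^3/b] and [B], with product [b]. *)
assert (G2 := theta_exchange omega r (a / c) (c ^ 2 / a) q Hq Hw Hr (Cdiv_nz _ _ Ha Hc0) Hca).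
replace ((c / a) ^ 3) with (b / a ^ 3) in G1 by (rewrite <- Hc; field; exact Ha).
replace ((c / a) ^ 2 * c) with (b / a ^ 2) in G1 by (rewrite <- Hc; field; exact Ha).
replace (c / a * c ^ 2) with (b / a) in G1 by (rewrite <- Hc; field; exact Ha).
replace (c / (c / a)) with a in G1 by (field; now split).
rewrite Hc in G1.
replace (b / a ^ 3 * b) with B in G1 by (unfold B; field; exact Ha).
replace (c ^ 2 / a / (a / c)) with (b / a ^ 2) in G2 by (rewrite <- Hc; field; now split).
replace ((a / c) ^ 2 * (c ^ 2 / a)) with a in G2 by (field; now split).
replace (a / c * (c ^ 2 / a) ^ 2) with (b / a) in G2 by (rewrite <- Hc; field; now split).
replace ((a / c) ^ 3) with (a ^ 3 / b) in G2 by (rewrite <- Hc; field; exact Hc0).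
replace ((c ^ 2 / a) ^ 3) with B in G2 by (unfold B; rewrite <- Hc; field; exact Ha).
replace (a ^ 3 / b * B) with b in G2 by (unfold B; field; now split).
(* The evaluations, [G1], [G2] and the goal contain the same thetas up to [x -> p/x] and [x -> 1/x];
   one representative of each is fixed. *)
assert (Hsym : forall x y : C, x <> 0 -> y = q ^ 3 / x -> theta y (q ^ 3) = theta x (q ^ 3)).
{ intros x y Hx ->. now apply theta_sym. }
assert (Hinv : forall x y : C, x <> 0 -> y = / x -> theta y (q ^ 3) = - theta x (q ^ 3) / x).
{ intros x y Hx ->. apply theta_inv; [lra|exact Hp0|exact Hx]. }
assert (Hab : a ^ 3 / b <> 0) by now apply Cdiv_nz.
unfold thetas, qpochs_inf, T1, T2. cbn [map Cprod fold_right].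
rewrite EqB.
rewrite (Hinv b (b / a ^ 3 / B)) by (try assumption; unfold B; field; now split).
rewrite (Hinv B (a ^ 3 / b ^ 2)) by (try assumption; unfold B; field; now split).
rewrite (Hinv (a ^ 3 / b) (b / a ^ 3)) in G1 |- * by (try assumption; field; now split).
replace (b / B) with (a ^ 3 / b) by (unfold B; field; now split).
rewrite (Hsym (q * (a ^ 3 / b)) (q ^ 2 * (b / a ^ 3)))
  by (try (now apply Cmult_neq_0); field; repeat split; assumption).
rewrite (Hsym (q * (b / a ^ 3)) (q ^ 2 * b / B))
  by (try (now apply Cmult_neq_0); unfold B; field; repeat split; assumption).
rewrite (Hsym (q * b) (q ^ 2 * (b / a ^ 3) / B))
  by (try (now apply Cmult_neq_0); unfold B; field; repeat split; assumption).
rewrite (Hsym (q ^ 2 * B) (q * a ^ 3 / b ^ 2))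
  by (try (apply Cmult_neq_0; [now apply Cpow_nz|exact HB]); unfold B; field; repeat split; assumption).
replace (q * b / a ^ 3) with (q * (b / a ^ 3)) by (field; exact Ha).
replace (q * a ^ 3 / b) with (q * (a ^ 3 / b)) by (field; exact Hb).
(* Source of the prefactor [(qa, q/a;q)_oo]; the factor [1 - a] cancels the one in [c0]. *)
assert (Etx : theta a q = (1 - a) * qpoch_inf (q * a) q * qpoch_inf (q / a) q).
{ rewrite theta_eq, (qinf_step a) by lra. replace (a * q) with (q * a) by ring. reflexivity. }
rewrite Etx in G1, G2.
assert (Nq : qpoch_inf q (q ^ 3) <> 0) by (apply qinf_nz; lra).
assert (NBab : b ^ 2 - a ^ 3 <> 0).
{ intros E. apply NB. unfold B.
  replace (1 - b ^ 2 / a ^ 3) with (- (b ^ 2 - a ^ 3) / a ^ 3) by (field; exact Ha).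
  rewrite E. field. exact Ha. }
unfold c0, N.
set (ty := theta (b / a ^ 2) q) in *.
set (qa := qpoch_inf (q * a) q) in *. set (qa' := qpoch_inf (q / a) q) in *.
set (d1 := qpoch_inf (q ^ 3 / b) (q ^ 3)) in *. set (d2 := qpoch_inf (q ^ 2 * b) (q ^ 3)) in *.
set (d3 := qpoch_inf (q ^ 2 * b / a ^ 3) (q ^ 3)) in *.
set (d4 := qpoch_inf (q ^ 3 * a ^ 3 / b) (q ^ 3)) in *.
set (dB := qpoch_inf B (q ^ 3)) in *. set (dqB := qpoch_inf (q * B) (q ^ 3)) in *.
set (e1 := qpoch_inf q (q ^ 3)) in *. set (e2 := qpoch_inf (q ^ 2) (q ^ 3)) in *.
set (e3 := qpoch_inf (q ^ 3) (q ^ 3)) in *.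
set (tb := theta b (q ^ 3)) in *. set (tB := theta B (q ^ 3)) in *.
set (tab := theta (a ^ 3 / b) (q ^ 3)) in *. set (tqb := theta (q * b) (q ^ 3)) in *.
set (tqqb := theta (q ^ 2 * b) (q ^ 3)) in *.
set (tqba := theta (q * (b / a ^ 3)) (q ^ 3)) in *.
set (tqab := theta (q * (a ^ 3 / b)) (q ^ 3)) in *.
set (tqB := theta (q * B) (q ^ 3)) in *. set (tqqB := theta (q ^ 2 * B) (q ^ 3)) in *.
set (Y := tb * tqba - a * (- tab / (a ^ 3 / b) * tqb)) in *.
set (Y' := tqab * tb + b / a * (tab * tqqb)) in *.
assert (EY : Y = (1 - a) * qa * qa' * (tqba * tB + b / a * (- tab / (a ^ 3 / b) * tqqB)) / ty).
{ rewrite <- G1. field. exact Hty. }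
assert (EY' : Y' = (tB * tqab - b / a ^ 2 * (tab * tqB)) * ((1 - a) * qa * qa') / ty).
{ rewrite G2. field. exact Hty. }
(* The form of [T1 - a T2] grouped by its two coefficients; the factor [a / b] before [Y'] comes
   from [theta(1/b;p) = - theta(b;p) / b]. *)
transitivity (/ ((1 - a) * (d1 * d2 * (d3 * d4))) *
  (phi / (1 - / B) * (a / b * Y') + e2 * e3 * dqB / (e1 ^ 2 * dB) * Y)).
- unfold Y, Y', B. field. repeat split; assumption.
- rewrite EY, EY'. unfold B. field. repeat split; assumption.
Qed.
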